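(* Let $P\subset\mathbb{R}^n$ be a closed convex cone that is spanning ($P-P=\mathbb{R}^n$) and pointed ($P\cap -P=\{0\}$), let $\Omega$ be the interior of $P$, and let $\mathcal{H}$ be an infinite dimensional separable Hilbert space. For an $E_0^P$-semigroup $\alpha=\{\alpha_x\}_{x\in P}$ on $B(\mathcal{H})$ such that $\alpha_x$ is not onto for every $x\in\Omega$, define $$\mathcal{E}_\alpha:=\{(x,T)\in\Omega\times B(\mathcal{H}) : \alpha_x(A)T=TA \text{ for all } A\in B(\mathcal{H})\}.$$ Then the following hold. (1) For every $E_0^P$-semigroup $\alpha$ on $B(\mathcal{H})$ such that $\alpha_x$ is not onto for every $x\in\Omega$, the set $\mathcal{E}_\alpha$ is a concrete product system over $\Omega$. (2) If $\alpha$ and $\beta$ are two $E_0^P$-semigroups on $B(\mathcal{H})$ such that $\alpha_x$ and $\beta_x$ are not onto for every $x\in\Omega$, then $\alpha$ and $\beta$ are cocycle conjugate if and only if $\mathcal{E}_\alpha$ and $\mathcal{E}_\beta$ are isomorphic as concrete product systems.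
   Context: An $E_0^P$-semigroup on $B(\mathcal{H})$ is a family $\alpha=\{\alpha_x\}_{x\in P}$ of normal unital $*$-endomorphisms of $B(\mathcal{H})$ such that $\alpha_x\circ\alpha_y=\alpha_{x+y}$ for all $x,y\in P$, $\alpha_0$ is the identity map, and for every $\rho\in B(\mathcal{H})_*$ (the predual, i.e. the trace class operators) and $A\in B(\mathcal{H})$ the map $P\ni x\mapsto \rho(\alpha_x(A))\in\mathbb{C}$ is continuous. Cocycle conjugacy: an $\alpha$-cocycle is a $\sigma$-weakly continuous family $\{u_x\}_{x\in P}$ of unitaries in $B(\mathcal{H})$ with $u_x\alpha_x(u_y)=u_{x+y}$ for all $x,y\in P$. A cocycle perturbation of $\alpha$ is a semigroup of the form $\{\mathrm{Ad}(u_x)\circ\alpha_x\}_{x\in P}$ with $\{u_x\}$ an $\alpha$-cocycle, where $\mathrm{Ad}(u)(A)=uAu^*$. Two $E_0^P$-semigroups $\alpha,\beta$ on $B(\mathcal{H})$ are cocycle conjugate if there is a normal $*$-isomorphism $\theta:B(\mathcal{H})\to B(\mathcal{H})$ such that $\{\theta\circ\alpha_x\circ\theta^{-1}\}_{x\in P}$ is a cocycle perturbation of $\beta$. Concrete product systems: $B(\mathcal{H})$ is regarded as a measurable space with the $\sigma$-algebra generated by the $\sigma$-weakly closed subsets, $\Omega$ carries its Borel $\sigma$-algebra, and $\Omega\times B(\mathcal{H})$ the product $\sigma$-algebra. Let $\mathcal{E}\subset\Omega\times B(\mathcal{H})$ be a measurable subset, and for $x\in\Omega$ put $\mathcal{E}(x)=\{T\in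 B(\mathcal{H}):(x,T)\in\mathcal{E}\}$. Then $\mathcal{E}$ is a concrete product system over $\Omega$ if: (i) the first-coordinate projection $\mathcal{E}\to\Omega$ is onto; (ii) for every $x\in\Omega$, $\mathcal{E}(x)$ is a vector subspace of $B(\mathcal{H})$, for all $T,S\in\mathcal{E}(x)$ the operator $T^*S$ is a scalar (multiple of the identity), denoted $\langle T,S\rangle$, and $\mathcal{E}(x)$ is a Hilbert space with respect to the inner product $\langle\cdot,\cdot\rangle$; (iii) for all $x,y\in\Omega$, the linear span of $\{TS: T\in\mathcal{E}(x),S\in\mathcal{E}(y)\}$ is dense in $\mathcal{E}(x+y)$; (iv) there is a sequence $V_1,V_2,\dots$ (infinite) of measurable maps $\Omega\to B(\mathcal{H})$ such that for every $x\in\Omega$, $\{V_1(x),V_2(x),\dots\}$ is an orthonormal basis of $\mathcal{E}(x)$ (in particular each $\mathcal{E}(x)$ is infinite dimensional). Two concrete product systems $\mathcal{E}\subset\Omega\times B(\mathcal{H})$ and $\mathcal{F}\subset\Omega\times B(\mathcal{K})$ are isomorphic if for every $x\in\Omega$ there is a unitary operator $U_x:\mathcal{E}(x)\to\mathcal{F}(x)$ such that the maps $\mathcal{E}\ni(x,T)\mapsto(x,U_x(T))\in\mathcal{F}$ and $\mathcal{F}\ni(x,T)\mapsto(x,U_x^*(T))\in\mathcal{E}$ are measurable and $U_{x+y}(TS)=U_x(T)U_y(S)$ for all $x,y\in\Omega$, $T\in\mathcal{E}(x)$, $S\in\mathcal{E}(y)$. *)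

(* Defs.v *)
From HB Require Import structures.
From mathcomp Require Import all_boot all_order all_algebra.
From mathcomp Require Import sesquilinear complex.
From mathcomp Require Import all_classical all_reals all_analysis.

Set Implicit Arguments.
Unset Strict Implicit.
Unset Printing Implicit Defensive.

Import Order.TTheory GRing.Theory Num.Theory numFieldNormedType.Exports.

Local Open Scope classical_set_scope.
Local Open Scope ring_scope.

(* R[i] with its structure kept folded, so that the topology and the normed
   module structure of a numClosedFieldType are found by inference. *)
Definition cplx (R : realType) : numClosedFieldType := R[i].

(* The inner product is linear in its first argument. *)
HB.mixin Record CompleteNormedModule_isHilbert (R : realType) H
    of CompleteNormedModule (cplx R) H := {
  ip : {dot H for (@Num.conj (cplx R))} ;
  ip_norm : forall x : H, `|x| ^+ 2 = ip x x
}.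

#[short(type="hilbertType")]
HB.structure Definition Hilbert (R : realType) :=
  {H of CompleteNormedModule (cplx R) H
      & CompleteNormedModule_isHilbert R H}.

Section linear_span.
Context {R : realType} {V : lmodType (cplx R)}.

Definition span (S : set V) : set V :=
  [set v | exists (m : nat) (a : 'I_m -> cplx R) (s : 'I_m -> V),
     (forall i, S (s i)) /\ v = \sum_i a i *: s i].

(* The next three notions are relative to a subspace [W] and a form on it, so
   that they apply both to a Hilbert space and to the fibres of a product
   system. *)
Definition hilbert_dense (form : V -> V -> cplx R) (W S : set V) : Prop :=
  S `<=` W /\
  forall v, W v -> forall e : cplx R, 0 < e ->
    exists2 w, S w & form (v - w) (v - w) < e.

Definition orthonormal_basis (form : V -> V -> cplx R) (W : set V)
    (e : nat -> V) : Prop :=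
  [/\ forall k, W (e k),
      forall j k, form (e j) (e k) = (j == k)%:R
    & hilbert_dense form W (span (range e))].

(* Here the form is linear in its second argument, as is <T, S> = T^* S. *)
Definition hilbert_on (form : V -> V -> cplx R) (W : set V) : Prop :=
  [/\ forall u v w a, W u -> W v -> W w ->
        form u (a *: v + w) = a * form u v + form u w,
      forall u v, W u -> W v -> form v u = (form u v)^*,
      forall u, W u -> u != 0 -> 0 < form u u
    & forall s : nat -> V, (forall k, W (s k)) ->
        (forall e : cplx R, 0 < e ->
           \forall j & k \near \oo, form (s j - s k) (s j - s k) < e) ->
        exists2 v, W v & form (s k - v) (s k - v) @[k --> \oo] --> 0].

End linear_span.

Definition separable (T : topologicalType) : Prop :=
  exists2 S : set T, countable S & dense S.

Definition infinite_dimensional (R : realType) (V : lmodType (cplx R)) : Prop :=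
  ~ exists s : seq V, span [set` s] = [set: V].

Section bounded_operators.
Context {R : realType} {H : hilbertType R}.

Definition bounded_op : {pred H -> H} := mem [set f : H -> H |
  linear f /\ exists M, forall x, `|f x| <= M * `|x|].

Lemma bounded_opP (f : H -> H) :
  f \in bounded_op <-> linear f /\ exists M, forall x, `|f x| <= M * `|x|.
Proof. by rewrite /bounded_op inE. Qed.

Lemma bounded_op_submod : submod_closed bounded_op.
Proof.
split=> [|a f g /bounded_opP[lf [M fM]] /bounded_opP[lg [N gN]]];
  apply/bounded_opP; split.
- by move=> b x y; rewrite /= scaler0 addr0.
- by exists 0 => x; rewrite mul0r normr0.
- move=> b x y.
  rewrite !fctE lf lg /= !scalerDr !scalerA (mulrC a b) !addrA.
  by congr (_ + _); rewrite addrAC.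
- exists (`|a| * M + N) => x; rewrite mulrDl.
  apply: le_trans (ler_normD _ _) _; apply: lerD => //.
  by rewrite normrZ -mulrA ler_wpM2l.
Qed.

HB.instance Definition _ :=
  GRing.isSubmodClosed.Build (cplx R) (H -> H) bounded_op bounded_op_submod.

End bounded_operators.

Record bop (R : realType) (H : hilbertType R) :=
  Bop { bop_fun :> H -> H ; bop_funP : bop_fun \in bounded_op }.

Section bop_structure.
Context {R : realType} {H : hilbertType R}.

HB.instance Definition _ := [isSub for @bop_fun R H].
HB.instance Definition _ := [Choice of bop H by <:].
HB.instance Definition _ := [SubChoice_isSubLmodule of bop H by <:].
HB.instance Definition _ := isPointed.Build (bop H) 0.

Fact bop_one_subproof : (idfun : H -> H) \in bounded_op.
Proof.
apply/bounded_opP; split=> [a x y //|].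
by exists 1 => x; rewrite mul1r.
Qed.

Fact bop_mul_subproof (A B : bop H) : (A \o B) \in bounded_op.
Proof.
have /bounded_opP[lA [M AM]] := bop_funP A.
have /bounded_opP[lB [N BN]] := bop_funP B.
apply/bounded_opP; split=> [a x y /=|]; first by rewrite lB lA.
exists (`|M| * N) => x /=; apply: le_trans (AM _) _; rewrite -mulrA.
have [->|Bx0] := eqVneq (B x) 0.
  rewrite normr0 mulr0 mulr_ge0// ?(le_trans _ (BN x))//.
apply: (@le_trans _ _ (`|M| * `|B x|)); last by rewrite ler_wpM2l.
have M0 : 0 <= M.
  by rewrite -(pmulr_lge0 _ (_ : 0 < `|B x|)) ?normr_gt0//
    (le_trans _ (AM _)).
by rewrite ger0_norm.
Qed.

Definition bop_one : bop H := Bop bop_one_subproof.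
Definition bop_mul (A B : bop H) : bop H := Bop (bop_mul_subproof A B).

Lemma bop_eq (A B : bop H) : (forall x, A x = B x) -> A = B.
Proof. by move=> AB; apply/val_inj/funext. Qed.

Fact bop_mulA : associative bop_mul.
Proof. by move=> A B D; exact: bop_eq. Qed.
Fact bop_mul1 : left_id bop_one bop_mul.
Proof. by move=> A; exact: bop_eq. Qed.
Fact bop_mulr1 : right_id bop_one bop_mul.
Proof. by move=> A; exact: bop_eq. Qed.
Fact bop_mulDl : left_distributive bop_mul +%R.
Proof. by move=> A B D; exact: bop_eq. Qed.
Fact bop_mulDr : right_distributive bop_mul +%R.
Proof.
move=> A B D; apply: bop_eq => x /=.
have /bounded_opP[lA _] := bop_funP A.
by have := lA 1 (B x) (D x); rewrite !scale1r.
Qed.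

HB.instance Definition _ := GRing.Zmodule_isPzRing.Build (bop H)
  bop_mulA bop_mul1 bop_mulr1 bop_mulDl bop_mulDr.

(* The adjoint exists and is unique by the Riesz representation theorem. *)
Definition adj (A : bop H) : bop H :=
  get [set B : bop H | forall x y, ip (A x) y = ip x (B y)].

Definition unitary_op (u : bop H) : Prop := adj u * u = 1 /\ u * adj u = 1.

End bop_structure.

Section predual.
Context {R : realType} {H : hilbertType R}.

(* Orthonormal bases are indexed by nat: the notions below are meant for a
   separable infinite dimensional H. *)
Definition onb (e : nat -> H) : Prop := orthonormal_basis ip setT e.

Definition diag_coef (T : bop H) (e : nat -> H) : nat -> cplx R :=
  fun k => ip (T (e k)) (e k).

(* [S] is the absolute value |T|. *)
Definition trace_class (T : bop H) : Prop :=
  exists S : bop H,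
    [/\ forall x, 0 <= ip (S x) x, S * S = adj T * T
      & forall e, onb e -> cvgn (series (diag_coef S e))].

Definition tr (T : bop H) : cplx R :=
  get [set z : cplx R |
    forall e, onb e -> series (diag_coef T e) @ \oo --> z].

Definition predual_pairing (A : bop H) :
    {ptws {T : bop H | trace_class T} -> cplx R} :=
  fun T => tr (sval T * A).

End predual.

Definition swop (R : realType) (H : hilbertType R) : Type :=
  initial_topology (@predual_pairing R H).

HB.instance Definition _ (R : realType) (H : hilbertType R) :=
  Topological.copy (swop H) (initial_topology (@predual_pairing R H)).
HB.instance Definition _ (R : realType) (H : hilbertType R) :=
  Pointed.copy (swop H) (bop H).

(* B(H) with the sigma-algebra generated by the sigma-weakly closed sets, and
   R^n with its Borel sigma-algebra. Subsets of the open set Omega are measured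
   in R^n, which induces the Borel sigma-algebra of Omega. *)
Definition bopM (R : realType) (H : hilbertType R) :=
  g_sigma_algebraType [set F : set (swop H) | closed F].
Definition borel_rV (R : realType) (n : nat) :=
  g_sigma_algebraType [set U : set 'rV[R]_n | open U].

Section semigroups.
Context {R : realType} {n : nat} {H : hilbertType R}.
Implicit Types (P : set 'rV[R]_n) (alpha beta : 'rV[R]_n -> bop H -> bop H).

(* Normal means sigma-weakly continuous. *)
Definition normal_star_hom (f : bop H -> bop H) : Prop :=
  [/\ linear f, forall A B, f (A * B) = f A * f B,
      forall A, f (adj A) = adj (f A)
    & continuous (f : swop H -> swop H)].

Record E0_semigroup P alpha : Prop := {
  E0_hom : forall x, P x -> normal_star_hom (alpha x) ;
  E0_unital : forall x, P x -> alpha x 1 = 1 ;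
  E0_add : forall x y, P x -> P y ->
    forall A, alpha x (alpha y A) = alpha (x + y) A ;
  E0_zero : forall A, alpha 0 A = A ;
  E0_continuous : forall (T : {T : bop H | trace_class T}) A,
    {within P, continuous (fun x => predual_pairing (alpha x A) T)}
}.

Record cocycle P alpha (u : 'rV[R]_n -> bop H) : Prop := {
  cocycle_continuous : {within P, continuous (u : 'rV[R]_n -> swop H)} ;
  cocycle_unitary : forall x, P x -> unitary_op (u x) ;
  cocycle_add : forall x y, P x -> P y ->
    u x * alpha x (u y) = u (x + y)
}.

Definition cocycle_perturbation P alpha beta : Prop :=
  exists2 u, cocycle P alpha u &
    forall x, P x -> forall A, beta x A = u x * alpha x A * adj (u x).

Definition cocycle_conjugate P alpha beta : Prop :=
  exists theta theta' : bop H -> bop H,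
    [/\ normal_star_hom theta, cancel theta theta', cancel theta' theta
      & cocycle_perturbation P beta
          (fun x A => theta (alpha x (theta' A)))].

Definition product_system_of P alpha : set (borel_rV R n * bopM H) :=
  [set p | P° p.1 /\
    forall A : bop H, alpha p.1 A * (p.2 : bop H) = (p.2 : bop H) * A].

End semigroups.

Section product_systems.
Context {R : realType} {n : nat}.
Implicit Type Omega : set 'rV[R]_n.

Definition fiber (H : hilbertType R) (E : set (borel_rV R n * bopM H))
  (x : 'rV[R]_n) : set (bop H) := [set T | E (x, T)].

(* The scalar T^* S. *)
Definition fiber_ip (H : hilbertType R) (T S : bop H) : cplx R :=
  get [set c : cplx R | adj T * S = c *: (1 : bop H)].

Record concrete_product_system (H : hilbertType R) Omega
    (E : set (borel_rV R n * bopM H)) : Prop := {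
  cps_sub : E `<=` Omega `*` setT ;
  cps_measurable : measurable E ;
  cps_onto : fst @` E = Omega ;
  cps_subspace : forall x, Omega x -> submod_closed [in fiber E x] ;
  cps_scalar : forall x T S, Omega x -> fiber E x T -> fiber E x S ->
    exists c : cplx R, adj T * S = c *: (1 : bop H) ;
  cps_hilbert : forall x, Omega x -> hilbert_on (@fiber_ip H) (fiber E x) ;
  cps_mul : forall x y, Omega x -> Omega y ->
    hilbert_dense (@fiber_ip H) (fiber E (x + y))
      (span [set T * S | T in fiber E x & S in fiber E y]) ;
  cps_basis : exists V : nat -> 'rV[R]_n -> bop H,
    (forall k, measurable_fun (Omega : set (borel_rV R n)) (V k : _ -> bopM H)) /\
    forall x, Omega x ->
      orthonormal_basis (@fiber_ip H) (fiber E x) (fun k => V k x)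
}.

Record fiber_unitary (H K : hilbertType R) (E : set (bop H)) (F : set (bop K))
    (U : bop H -> bop K) (Ustar : bop K -> bop H) : Prop := {
  fiber_unitary_fun : forall T, E T -> F (U T) ;
  fiber_unitary_linear : forall (a : cplx R) T S, E T -> E S ->
    U (a *: T + S) = a *: U T + U S ;
  fiber_unitary_adj_fun : forall T, F T -> E (Ustar T) ;
  fiber_unitary_adj : forall T S, E T -> F S ->
    fiber_ip (U T) S = fiber_ip T (Ustar S) ;
  fiber_unitaryK : forall T, E T -> Ustar (U T) = T ;
  fiber_unitaryVK : forall T, F T -> U (Ustar T) = T
}.

Definition product_system_isomorphic (H K : hilbertType R) Omega
    (E : set (borel_rV R n * bopM H)) (F : set (borel_rV R n * bopM K)) : Prop :=
  exists (U : 'rV[R]_n -> bop H -> bop K) (Ustar : 'rV[R]_n -> bop K -> bop H),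
    [/\ forall x, Omega x ->
          fiber_unitary (fiber E x) (fiber F x) (U x) (Ustar x),
        measurable_fun E
          (fun p => (p.1, U p.1 p.2) : borel_rV R n * bopM K),
        measurable_fun F
          (fun p => (p.1, Ustar p.1 p.2) : borel_rV R n * bopM H)
      & forall x y T S, Omega x -> Omega y -> fiber E x T -> fiber E y S ->
          U (x + y) (T * S) = U x T * U y S].

End product_systems.

Record closed_convex_cone (R : realType) (n : nat) (P : set 'rV[R]_n) : Prop := {
  cone_closed : closed P ;
  cone_convex : convex_set (P : set (convex_lmodType 'rV[R]_n)) ;
  cone_scale : forall (t : R) x, 0 <= t -> P x -> P (t *: x)
}.

Definition spanning (R : realType) (n : nat) (P : set 'rV[R]_n) : Prop :=
  [set x - y | x in P & y in P] = setT.

Definition pointed (R : realType) (n : nat) (P : set 'rV[R]_n) : Prop :=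
  P `&` [set - x | x in P] = [set 0].

(* Main.v *)
(* The intertwiners of a normal unital *-endomorphism [alpha] are determined by
   their value at a unit vector [e 0], which ranges over the range of the
   projection [alpha (rank1 (e 0) (e 0))]. Orthonormalizing the images under
   this projection of the vectors [e m] therefore gives a basis of the fibre of
   the product system at [x] that depends measurably on [x]. It is infinite:
   as [alpha_y] is not onto, the fibre at [y = x / 2] contains two isometries
   with orthogonal ranges, and their products give arbitrarily many in the
   fibre at [x].
   For a conjugacy [theta], which is inner, say [theta A = W * A * adj W], and a
   cocycle [u], the maps [T |-> adj (u x) * W * T * adj W] identify the product
   systems. Conversely, an isomorphism sends a basis of the fibre of [beta] at
   [x] to a basis of the fibre of [alpha] at [x], and both families of
   isometries have ranges spanning H, so that left multiplication by a unitary
   [u x] implements it. This is a measurable cocycle on the interior, and it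
   extends to the cone by [x |-> u (x + w) * beta x (adj (u w))], which does not
   depend on the interior point [w]. The extension is continuous because the
   Borel matrix coefficients of [u] are continuous off a meagre set, which the
   translates of a convergent sequence by a suitable [w] avoid. *)
From HB Require Import structures.
Require Import Defs.
From mathcomp Require Import all_boot all_order all_algebra.
From mathcomp Require Import sesquilinear complex.
From mathcomp Require Import all_classical all_reals all_analysis.
From mathcomp Require Import measurable_realfun.
From mathcomp Require Import ring lra.

Set Implicit Arguments.
Unset Strict Implicit.
Unset Printing Implicit Defensive.

Import Order.TTheory GRing.Theory Num.Theory numFieldNormedType.Exports.

Local Open Scope classical_set_scope.
Local Open Scope ring_scope.

(** * Positive forms and orthonormalization *)

(** The obstacle throughout is the sigma-weak topology. Normality, continuity and the measurable
    structure are defined by pairing with trace class operators, whereas the constructions control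
    matrix coefficients only. The bridge is an expansion of a trace class operator as a sum of rank
    one operators x |-> <x, h_k> a_k with |a_k| = |h_k| and the sum of the |h_k|^2 bounded. It is
    obtained without spectral theory, by orthonormalizing a basis for the possibly degenerate form
    <|T| x, y>; hence Gram-Schmidt is developed for positive semidefinite forms. On norm bounded
    sequences convergence of matrix coefficients is then sigma-weak convergence, and such sequences
    suffice: the operators to be compared are unitaries or finite rank projections. Likewise a
    sigma-weakly closed set is described inside a norm ball by countably many rational conditions on
    coefficients, so that an operator valued map is measurable as soon as its coefficients are. *)

Definition psd_form (C : numClosedFieldType) (V : lmodType C)
    (f : V -> V -> C) : Prop :=
  [/\ forall a u v w, f (a *: u + v) w = a * f u w + f v w,
      forall u v, f v u = (f u v)^*
    & forall u, 0 <= f u u].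

Section psd_forms.
Context {C : numClosedFieldType} {V : lmodType C} (f : V -> V -> C).
Hypothesis f_psd : psd_form f.

Lemma psdC u v : f v u = (f u v)^*. Proof. by case: f_psd. Qed.
Lemma psd_ge0 u : 0 <= f u u. Proof. by case: f_psd. Qed.
Lemma psdDl u v w : f (u + v) w = f u w + f v w.
Proof. by case: f_psd => /(_ 1 u v w); rewrite scale1r mul1r. Qed.
Lemma psd0l w : f 0 w = 0.
Proof. by apply: (addrI (f 0 w)); rewrite -psdDl !addr0. Qed.
Lemma psdZl a u w : f (a *: u) w = a * f u w.
Proof. by case: f_psd => /(_ a u 0 w); rewrite psd0l !addr0. Qed.
Lemma psdNl u w : f (- u) w = - f u w.
Proof. by rewrite -scaleN1r psdZl mulN1r. Qed.
Lemma psdBl u v w : f (u - v) w = f u w - f v w.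
Proof. by rewrite psdDl psdNl. Qed.
Lemma psdDr u v w : f w (u + v) = f w u + f w v.
Proof. by rewrite !(psdC _ w) psdDl rmorphD. Qed.
Lemma psd0r w : f w 0 = 0. Proof. by rewrite psdC psd0l rmorph0. Qed.
Lemma psdZr a u w : f w (a *: u) = a^* * f w u.
Proof. by rewrite !(psdC _ w) psdZl rmorphM. Qed.
Lemma psdNr u w : f w (- u) = - f w u.
Proof. by rewrite !(psdC _ w) psdNl rmorphN. Qed.
Lemma psdBr u v w : f w (u - v) = f w u - f w v.
Proof. by rewrite psdDr psdNr. Qed.
Lemma psd_suml I (r : seq I) (P : pred I) (F : I -> V) w :
  f (\sum_(i <- r | P i) F i) w = \sum_(i <- r | P i) f (F i) w.
Proof. by apply: (big_morph (f^~ w)) => [u v|]; rewrite ?psdDl ?psd0l. Qed.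
Lemma psd_sumr I (r : seq I) (P : pred I) (F : I -> V) w :
  f w (\sum_(i <- r | P i) F i) = \sum_(i <- r | P i) f w (F i).
Proof. by apply: (big_morph (f w)) => [u v|]; rewrite ?psdDr ?psd0r. Qed.

(** Expand [f (u - t *: v) (u - t *: v) >= 0]. If [f v v] is nonzero, [t = f u v / f v v] is the
    optimal choice; if it vanishes, only the linear term in [t] is left, and it cannot be made
    arbitrarily large. *)
Lemma psd_CS u v : `|f u v| ^+ 2 <= f u u * f v v.
Proof.
have main t : 0 <= f u u - (t^* * f u v + t * f v u) + `|t| ^+ 2 * f v v.
  have := psd_ge0 (u - t *: v).
  rewrite psdBl !psdBr !psdZr !psdZl normCK.
  by congr (_ <= _); ring.
have uv : f v u = (f u v)^* := psdC u v.
have [v0|vn0] := eqVneq (f v v) 0; last first.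
  have vgt0 : 0 < f v v by rewrite lt_def vn0 psd_ge0.
  have := main (f u v / f v v).
  have vr : (f v v)^* = f v v by rewrite -psdC.
  rewrite uv normrM normfV (gtr0_norm vgt0) rmorphM fmorphV /= vr.
  rewrite exprMn normCK => h.
  rewrite -(ler_pM2r (_ : 0 < (f v v)^-1)) ?invr_gt0// mulfK//.
  rewrite -subr_ge0; apply: le_trans h _.
  rewrite ?normCK.
  rewrite le_eqVlt; apply/orP; left; apply/eqP.
  by field.
rewrite v0 mulr0.
have [->|uvn0] := eqVneq (f u v) 0; first by rewrite normr0 expr0n.
have n0 : 0 < `|f u v| ^+ 2 by rewrite exprn_gt0// normr_gt0.
(* With this multiple of [f u v] the linear term is [2 * (f u u + 1)], so the whole expression is
   [- (f u u + 2)], which is negative. *)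
have := main ((f u u + 1) / `|f u v| ^+ 2 * f u v).
have ur : (f u u)^* = f u u by rewrite -psdC.
have nr : (`|f u v| ^+ 2)^* = `|f u v| ^+ 2.
  by rewrite conj_Creal// realX// normr_real.
rewrite v0 mulr0 addr0 !rmorphM fmorphV rmorphD rmorph1 /= nr ur uv.
have e : f u v * (f u v)^* = `|f u v| ^+ 2 by rewrite normCK.
have -> : f u u -
  ((f u u + 1) / `|f u v| ^+ 2 * (f u v)^* * f u v +
   (f u u + 1) / `|f u v| ^+ 2 * f u v * (f u v)^*) = - (f u u + 2).
  rewrite -!mulrA (mulrC (f u v)^*) e mulVf ?gt_eqF//; ring.
by rewrite oppr_ge0 => /(le_trans (_ : 2 <= _)) h; have := h (ltac:(by rewrite lerDr psd_ge0)); rewrite lern0.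
Qed.

Lemma psd_null u v : f u u = 0 -> f u v = 0.
Proof.
move=> u0; have := psd_CS u v; rewrite u0 mul0r => h.
by apply/eqP; rewrite -normr_eq0 -sqrf_eq0 eq_le h exprn_ge0.
Qed.

Lemma psd_nullr u v : f u u = 0 -> f v u = 0.
Proof. by move=> u0; rewrite psdC psd_null// rmorph0. Qed.

Lemma psd_addnull u v : f v v = 0 -> f (u + v) (u + v) = f u u.
Proof.
by move=> v0; rewrite psdDl !psdDr !(psd_null _ v0) (psd_nullr _ v0) !addr0.
Qed.

Definition ortho01 (u : nat -> V) : Prop :=
  (forall j k, j != k -> f (u j) (u k) = 0) /\
  (forall j, f (u j) (u j) = 1 \/ u j = 0).

Definition proj (u : nat -> V) (N : nat) (x : V) : V :=
  \sum_(j < N) f x (u j) *: u j.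

Section Bessel.
Variable u : nat -> V.
Hypothesis u01 : ortho01 u.

Lemma ortho01_coef x j : f x (u j) * f (u j) (u j) = f x (u j).
Proof.
by case: u01 => _ /(_ j)[->|->]; rewrite ?mulr1// psd0r mul0r.
Qed.

Lemma proj_ip (c : nat -> C) N j :
  f (\sum_(k < N) c k *: u k) (u j) = if (j < N)%N then c j * f (u j) (u j) else 0.
Proof.
rewrite psd_suml; case: ifP => jN.
  rewrite (bigD1 (Ordinal jN))//= psdZl big1 ?addr0// => k kj.
  by rewrite psdZl (proj1 u01) ?mulr0.
rewrite big1// => k _; rewrite psdZl (proj1 u01) ?mulr0//.
by apply: contraFneq jN => <-.
Qed.

Lemma psd_projl x N j : f (proj u N x) (u j) = if (j < N)%N then f x (u j) else 0.
Proof.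
rewrite -[f x (u j)]ortho01_coef; exact: (proj_ip (fun k => f x (u k))).
Qed.

Lemma psd_proj x N : f (proj u N x) (proj u N x) = \sum_(j < N) `|f x (u j)| ^+ 2.
Proof.
rewrite {2}/proj psd_sumr; apply: eq_bigr => j _.
rewrite psdZr psd_projl ltn_ord.
by rewrite normCK mulrC.
Qed.

Lemma psd_projr x y N :
  f x (proj u N y) = \sum_(j < N) f x (u j) * (f y (u j))^*.
Proof. by rewrite psd_sumr; apply: eq_bigr => j _; rewrite psdZr mulrC. Qed.

Lemma psd_resid x N :
  f (x - proj u N x) (x - proj u N x) = f x x - \sum_(j < N) `|f x (u j)| ^+ 2.
Proof.
have e : f x (proj u N x) = \sum_(j < N) `|f x (u j)| ^+ 2.
  by rewrite psd_projr; apply: eq_bigr => j _; rewrite normCK.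
have er : (\sum_(j < N) `|f x (u j)| ^+ 2)^* = \sum_(j < N) `|f x (u j)| ^+ 2.
  by rewrite rmorph_sum; apply: eq_bigr => j _; rewrite /= conj_Creal ?realX.
rewrite psdBl !psdBr psd_proj e (psdC x (proj u N x)) e er; ring.
Qed.

Lemma bessel x N : \sum_(j < N) `|f x (u j)| ^+ 2 <= f x x.
Proof. by rewrite -subr_ge0 -psd_resid psd_ge0. Qed.

Lemma projB N x y : proj u N (x - y) = proj u N x - proj u N y.
Proof.
by rewrite -sumrB; apply: eq_bigr => j _; rewrite psdBl scalerBl.
Qed.

(** Up to a null vector [w] lies in the span of the first [N] vectors, so [x] and [x - w] have the
    same residual up to a null vector, and a residual is never longer than its vector. *)
Lemma proj_best x w N : f (w - proj u N w) (w - proj u N w) = 0 ->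
  f (x - proj u N x) (x - proj u N x) <= f (x - w) (x - w).
Proof.
move=> w0.
have -> : x - proj u N x = ((x - w) - proj u N (x - w)) + (w - proj u N w).
  by rewrite projB opprB addrAC !addrA !subrK.
rewrite psd_addnull// psd_resid -subr_ge0 opprB addrC subrK.
by apply: sumr_ge0 => j _; rewrite exprn_ge0.
Qed.

End Bessel.

Section GramSchmidt.
Variable s : nat -> V.

(* A null residual is sent to 0, since 0^-1 = 0. *)
Let step (l : seq V) (x : V) : V :=
  let r := x - \sum_(v <- l) f x v *: v in (sqrtC (f r r))^-1 *: r.

Let gs_list := fix gs_list (n : nat) : seq V :=
  if n is m.+1 then rcons (gs_list m) (step (gs_list m) (s m)) else [::].

Definition gs (k : nat) : V := nth 0 (gs_list k.+1) k.

Let size_gs n : size (gs_list n) = n.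
Proof. by elim: n => //= n IH; rewrite size_rcons IH. Qed.

Let gs_listE n : gs_list n = [seq gs i | i <- iota 0 n].
Proof.
elim: n => // n IH; rewrite -addn1 iotaD map_cat -IH addn1 add0n /= -cats1.
by congr (_ ++ [:: _]); rewrite /gs /= nth_rcons size_gs ltnn eqxx.
Qed.

Definition gs_resid (m : nat) : V := s m - proj gs m (s m).

Lemma gsE m : gs m = (sqrtC (f (gs_resid m) (gs_resid m)))^-1 *: gs_resid m.
Proof.
have -> : gs m = step (gs_list m) (s m).
  by rewrite {1}/gs /= nth_rcons size_gs ltnn eqxx.
rewrite /step gs_listE big_map /gs_resid /proj.
have -> : \sum_(j <- iota 0 m) f (s m) (gs j) *: gs j =
    \sum_(j < m) f (s m) (gs j) *: gs j.
  by rewrite -(big_mkord xpredT (fun j => f (s m) (gs j) *: gs j)) /index_iota subn0.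
by [].
Qed.

Lemma gs_norm m : f (gs m) (gs m) = 1 \/ gs m = 0.
Proof.
rewrite gsE; set r := gs_resid m.
have [->|rn0] := eqVneq (f r r) 0; first by right; rewrite sqrtC0 invr0 scale0r.
left; rewrite psdZl psdZr mulrA -normCK normfV ger0_norm ?sqrtC_ge0 ?psd_ge0//.
by rewrite exprVn sqrtCK mulVf.
Qed.

Lemma gs_orth m j : (j < m)%N -> f (gs m) (gs j) = 0.
Proof.
elim/ltn_ind: m j => m IH j jm.
(* The truncated family satisfies [ortho01] by the induction hypothesis, which makes the projection
   formulas available. *)
pose u k := if (k < m)%N then gs k else 0.
have u01 : ortho01 u.
  split=> [a b ab|a]; rewrite /u; last first.
    by case: ifP => _; [exact: gs_norm|right].
  case: ifP => am; last by rewrite psd0l.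
  case: ifP => bm; last by rewrite psd0r.
  have [l|l|e] := ltngtP a b; last by rewrite e eqxx in ab.
    by rewrite psdC IH ?rmorph0.
  exact: IH.
rewrite gsE psdZl [X in _ * X]psdBl.
have -> : proj gs m (s m) = proj u m (s m).
  by apply: eq_bigr => k _; rewrite /u ltn_ord.
have -> : gs j = u j by rewrite /u jm.
by rewrite psd_projl// jm subrr mulr0.
Qed.

Lemma gs_ortho01 : ortho01 gs.
Proof.
split=> [a b ab|]; last exact: gs_norm.
have [l|l|e] := ltngtP a b; last by rewrite e eqxx in ab.
  by rewrite psdC gs_orth// rmorph0.
exact: gs_orth.
Qed.

(** Membership in the span of the first [N] vectors, modulo null vectors of the form. *)
Definition null_resid (u : nat -> V) N x :=
  f (x - proj u N x) (x - proj u N x) = 0.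

Lemma null_residS u N M x : ortho01 u -> (N <= M)%N ->
  null_resid u N x -> null_resid u M x.
Proof.
rewrite /null_resid => u01 NM xN; apply/eqP; rewrite eq_le psd_ge0 andbT -xN.
rewrite !psd_resid// lerD2l lerN2 -(subnKC NM) big_split_ord /= lerDl.
by apply: sumr_ge0 => j _; rewrite exprn_ge0.
Qed.

Lemma null_residD u N a x y : ortho01 u ->
  null_resid u N x -> null_resid u N y -> null_resid u N (a *: x + y).
Proof.
rewrite /null_resid => u01 xN yN.
have -> : a *: x + y - proj u N (a *: x + y) =
    a *: (x - proj u N x) + (y - proj u N y).
  rewrite scalerBr addrACA -opprD; congr (_ - _).
  rewrite scaler_sumr -big_split; apply: eq_bigr => j _ /=.
  by rewrite psdDl psdZl scalerDl scalerA.
by rewrite psd_addnull// psdZl psdZr xN !mulr0.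
Qed.

(** A residual that is not null is a multiple of the new vector [gs m], which absorbs it; if it is
    null, [gs m] is 0 and the residual stays null. *)
Lemma gs_null m : null_resid gs m.+1 (s m).
Proof.
rewrite /null_resid /proj big_ord_recr /= opprD addrA -[_ - \sum_(_ < m) _]/(gs_resid m).
set r := gs_resid m.
have rp : f (proj gs m (s m)) (gs m) = 0.
  by rewrite (psd_projl gs_ortho01) ltnn.
have sr : f (s m) (gs m) = f r (gs m) by rewrite psdBl rp subr0.
rewrite sr; have [r0|rn0] := eqVneq (f r r) 0.
  by rewrite gsE r0 sqrtC0 invr0 scale0r psd0r scaler0 subr0.
suff -> : f r (gs m) *: gs m = r by rewrite subrr psd0l.
rewrite gsE psdZr scalerA mulrAC -normCKC normfV ger0_norm ?sqrtC_ge0 ?psd_ge0//.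
by rewrite exprVn sqrtCK mulVf ?scale1r.
Qed.

Lemma gs_ind (W : set V) : W 0 -> (forall a x y, W x -> W y -> W (a *: x + y)) ->
  (forall k, W (s k)) -> forall k, W (gs k).
Proof.
move=> W0 WD Ws k; elim/ltn_ind: k => k IH.
rewrite gsE -[_ *: _]addr0; apply: (WD) => //.
rewrite /gs_resid addrC -scaleN1r; apply: (WD) => //.
apply: (big_ind W) => // [x y Wx Wy|j _]; first by rewrite -[x]scale1r; exact: WD.
by rewrite -[_ *: _]addr0; apply: (WD) => //; exact: IH.
Qed.

End GramSchmidt.
End psd_forms.

(** * Linear spans *)

Lemma span_ind (R : realType) (V : lmodType (cplx R)) (S W : set V) : W 0 ->
  (forall a x y, W x -> W y -> W (a *: x + y)) -> S `<=` W -> Defs.span S `<=` W.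
Proof.
move=> W0 WD SW _ [m [a [s [Ss ->]]]].
apply: (big_ind W) => // [x y Wx Wy|j _]; first by rewrite -[x]scale1r; exact: WD.
by rewrite -[_ *: _]addr0; apply: (WD) => //; exact: SW.
Qed.

Lemma span_in (R : realType) (V : lmodType (cplx R)) (S : set V) : S `<=` Defs.span S.
Proof.
move=> v Sv; exists 1%N, (fun=> 1), (fun=> v); split=> //.
by rewrite big_ord_recl big_ord0 scale1r addr0.
Qed.

Lemma span0 (R : realType) (V : lmodType (cplx R)) (S : set V) : Defs.span S 0.
Proof.
exists 0%N, (fun=> 0), (fun=> 0); split; first by case.
by rewrite big_ord0.
Qed.

Lemma spanD (R : realType) (V : lmodType (cplx R)) (S : set V) a x y :
  Defs.span S x -> Defs.span S y -> Defs.span S (a *: x + y).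
Proof.
move=> [m [b [s [Ss ->]]]] [l [c [t [St ->]]]].
exists (m + l)%N, (fun i => match fintype.split i with inl j => a * b j | inr j => c j end),
  (fun i => match fintype.split i with inl j => s j | inr j => t j end); split.
  by move=> i; case: (fintype.split i).
rewrite big_split_ord /= scaler_sumr; congr (_ + _); apply: eq_bigr => i _.
  by rewrite (unsplitK (inl i)) scalerA.
by rewrite (unsplitK (inr i)).
Qed.

Lemma span_sum (R : realType) (V : lmodType (cplx R)) (S : set V) N
    (c : nat -> cplx R) (v : nat -> V) :
  (forall j, (j < N)%N -> S (v j)) -> Defs.span S (\sum_(j < N) c j *: v j).
Proof.
move=> Sv; exists N, (fun i : 'I_N => c i), (fun i : 'I_N => v i).
by split=> // i; exact: Sv.
Qed.

(** * Limits of sequences, in normed spaces and in the complex numbers *)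

Section epsilon_limits.
Context {K : numFieldType} {V : normedModType K}.
Implicit Types (u : nat -> V) (l : V).

Lemma cvg_seqP u l : u n @[n --> \oo] --> l <->
  forall e : K, 0 < e -> exists N, forall n, (N <= n)%N -> `|u n - l| < e.
Proof.
split.
  move=> /cvgrPdist_lt ul e e0; have [N _ uN] := ul e e0.
  by exists N => n Nn; rewrite distrC; exact: uN.
move=> ul; apply/cvgrPdist_lt => e e0; have [N uN] := ul e e0.
by exists N => // n Nn; rewrite distrC; exact: uN.
Qed.

End epsilon_limits.

Section sequences.
Context {K : numFieldType} {V : normedModType K}.
Implicit Types (u : nat -> V) (l : V).

Lemma cvg_squeeze u l (v : nat -> K) :
  (forall n, `|u n - l| <= v n) -> v n @[n --> \oo] --> 0 -> u n @[n --> \oo] --> l.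
Proof.
move=> uv /cvgrPdist_lt v0; apply/cvg_seqP => e /v0 [N _ vN].
exists N => n /vN /=; rewrite sub0r normrN; apply: le_lt_trans.
by apply: le_trans (uv n) _; rewrite real_ler_norm// ger0_real// (le_trans _ (uv n)).
Qed.

Lemma cvg_sq0 u l : (`|u n - l| ^+ 2 @[n --> \oo] --> 0) -> u n @[n --> \oo] --> l.
Proof.
move=> /cvgrPdist_lt u0; apply/cvg_seqP => e e0.
have [N _ uN] := u0 (e ^+ 2) (exprn_gt0 _ e0).
exists N => n /uN /=; rewrite sub0r normrN ger0_norm ?exprn_ge0//.
by move=> h; rewrite -(@ltr_pXn2r _ 2) ?nnegrE// ltW.
Qed.

Lemma cvg_norm_sq u l : u n @[n --> \oo] --> l -> `|u n - l| ^+ 2 @[n --> \oo] --> 0.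
Proof.
move=> ul; suff h : `|u n - l| @[n --> \oo] --> 0.
  by rewrite -[X in _ --> X](mulr0 0); exact: (cvgM h h).
apply/cvg_seqP => e e0; have [N uN] := (cvg_seqP u l).1 ul e e0.
by exists N => n Nn; rewrite subr0 normr_id uN.
Qed.

Lemma cvg_seq_unique u l m : u n @[n --> \oo] --> l -> u n @[n --> \oo] --> m -> l = m.
Proof. by move=> ul um; exact: (cvg_unique _ ul um). Qed.

Lemma cvg_seq_const l : (fun _ : nat => l) n @[n --> \oo] --> l.
Proof. exact: cvg_cst. Qed.

Lemma cvg_seq_bounded u l : u n @[n --> \oo] --> l ->
  exists2 M : K, 0 < M & forall n, `|u n| <= M.
Proof.
move=> /cvg_seqP /(_ 1 ltr01)[N uN].
exists (\sum_(k < N) `|u k| + (`|l| + 1)).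
  by rewrite ltr_wpDl ?sumr_ge0// ltr_wpDl.
move=> n; have [Nn|nN] := leqP N n.
  rewrite ler_wpDl ?sumr_ge0// -[u n](subrK l) (le_trans (ler_normD _ _))//.
  by rewrite addrC lerD2l ltW ?uN.
rewrite ler_wpDr ?addr_ge0// (bigD1 (Ordinal nN))//= ler_wpDr// sumr_ge0//.
Qed.

End sequences.

Section sequence_algebra.
Context {K : numFieldType} {V : normedModType K}.

Lemma cvg_seqD (u v : nat -> V) (l m : V) : u n @[n --> \oo] --> l ->
  v n @[n --> \oo] --> m -> u n + v n @[n --> \oo] --> l + m.
Proof. by move=> ul vm; exact: cvgD. Qed.

Lemma cvg_seqB (u v : nat -> V) (l m : V) : u n @[n --> \oo] --> l ->
  v n @[n --> \oo] --> m -> u n - v n @[n --> \oo] --> l - m.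
Proof. by move=> ul vm; exact: cvgB. Qed.

Lemma cvg_seqM (u v : nat -> K) (l m : K) : u n @[n --> \oo] --> l ->
  v n @[n --> \oo] --> m -> u n * v n @[n --> \oo] --> l * m.
Proof. by move=> ul vm; exact: cvgM. Qed.

Lemma cvg_seqMl (a : K) (u : nat -> K) (l : K) : u n @[n --> \oo] --> l ->
  a * u n @[n --> \oo] --> a * l.
Proof. by move=> ul; apply: cvg_seqM => //; exact: cvg_cst. Qed.

Lemma cvg_seqMr (a : K) (u : nat -> K) (l : K) : u n @[n --> \oo] --> l ->
  u n * a @[n --> \oo] --> l * a.
Proof. by move=> ul; apply: cvg_seqM => //; exact: cvg_cst. Qed.

Lemma cvg_seqZr (a : K) (u : nat -> V) (l : V) : u n @[n --> \oo] --> l ->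
  a *: u n @[n --> \oo] --> a *: l.
Proof. by move=> ul; apply: cvgZ => //; exact: cvg_cst. Qed.

Lemma cvg_seq_sum (N : nat) (u : 'I_N -> nat -> V) (l : 'I_N -> V) :
  (forall i, u i n @[n --> \oo] --> l i) ->
  \sum_(i < N) u i n @[n --> \oo] --> \sum_(i < N) l i.
Proof.
elim: N u l => [|N IH] u l ul.
  rewrite big_ord0 (_ : (fun n => _) = fun=> 0); first exact: cvg_cst.
  by apply/funext => n; rewrite big_ord0.
rewrite big_ord_recl (_ : (fun n => _) =
  fun n => u ord0 n + \sum_(i < N) u (lift ord0 i) n).
  by apply: cvg_seqD => //; exact: IH.
by apply/funext => n; rewrite big_ord_recl.
Qed.

Lemma cvg_seq_norm (u : nat -> V) (l : V) : u n @[n --> \oo] --> l ->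
  `|u n - l| @[n --> \oo] --> (0 : K).
Proof.
move=> ul; apply/cvg_seqP => e e0; have [N uN] := (cvg_seqP u l).1 ul e e0.
by exists N => n Nn; rewrite subr0 normr_id uN.
Qed.

End sequence_algebra.

Arguments cvg_seqMl {K} a {u l}.
Arguments cvg_seqMr {K} a {u l}.
Arguments cvg_seqZr {K V} a {u l}.

Lemma cvg_conj (C : numClosedFieldType) (u : nat -> C) (l : C) :
  u n @[n --> \oo] --> l -> (u n)^* @[n --> \oo] --> l^*.
Proof.
move=> ul; apply/cvg_seqP => e e0; have [N uN] := (cvg_seqP (V := C) _ _).1 ul e e0.
by exists N => n /uN; rewrite -rmorphB norm_conjC.
Qed.

Lemma cauchy_seq_cvg (K : numFieldType) (V : completeNormedModType K) (u : nat -> V) :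
  (forall e : K, 0 < e -> exists N, forall m n, (N <= m)%N -> (N <= n)%N ->
     `|u m - u n| < e) -> exists l : V, u n @[n --> \oo] --> l.
Proof.
move=> uC; have : cauchy (u @ \oo).
  apply: cauchy_exP => e e0; have [N uN] := uC e e0.
  exists (u N); exists N => // n /= Nn.
  by rewrite -ball_normE /=; apply: uN.
by move=> /cauchy_cvgP h; exists (lim (u @ \oo)).
Qed.

(** Nonnegative elements of [cplx R] equal their real parts, so the supremum of these in [R]
    controls all later increments. *)
Lemma cplx_mono_cauchy (R : realType) (u : nat -> cplx R) (B : cplx R) :
  (forall n, 0 <= u n) -> (forall n, u n <= u n.+1) -> (forall n, u n <= B) ->
  forall e : cplx R, 0 < e -> exists N, forall m n, (N <= m)%N -> (m <= n)%N ->
     u n - u m < e.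
Proof.
move=> u0 uS uB e e0.
have uh : {homo u : n m / (n <= m)%N >-> n <= m} by apply: homo_leq => // y x z; exact: le_trans.
pose v n : R := complex.Re (u n : R[i]).
have uE n : u n = (v n)%:C%C by rewrite RRe_real// ger0_real.
have vh : {homo v : n m / (n <= m)%N >-> n <= m}.
  by move=> n m nm; rewrite -lecR -!uE; exact: uh.
have B0 : 0 <= B by exact: le_trans (uB 0%N).
have BE : B = (complex.Re (B : R[i]))%:C%C by rewrite RRe_real// ger0_real.
have vB : has_ubound (range v).
  by exists (complex.Re (B : R[i])) => _ [n _ <-]; rewrite -lecR -uE -BE.
have eE : e = (complex.Re (e : R[i]))%:C%C by rewrite RRe_real// gtr0_real.
have e0' : 0 < complex.Re (e : R[i]) by rewrite -ltcR -eE.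
have /cvgrPdist_lt/(_ _ e0')[N _ vN] := nondecreasing_cvgn vh vB.
exists N => m n Nm mn; rewrite !uE eE -rmorphB ltcR.
have vs k : v k <= sup (range v) by apply: ub_le_sup => //; exists k.
apply: le_lt_trans (vN m Nm); rewrite ger0_norm ?subr_ge0//.
by rewrite lerD2r.
Qed.

Lemma cvg_seq_ge0 (C : numFieldType) (u : nat -> C) (l : C) :
  u n @[n --> \oo] --> l -> (forall n, 0 <= u n) -> 0 <= l.
Proof.
move=> ul u0; suff <- : `|l| = l by [].
apply: (@cvg_seq_unique _ C u) => //; apply/cvg_seqP => e e0.
have [N uN] := (cvg_seqP (V := C) _ _).1 ul e e0.
exists N => n /uN; apply: le_lt_trans.
by rewrite -[X in `|X - _|]ger0_norm// ler_dist_dist.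
Qed.

Lemma cvg_seq_le (C : numFieldType) (u v : nat -> C) (l m : C) :
  u n @[n --> \oo] --> l -> v n @[n --> \oo] --> m ->
  (forall n, u n <= v n) -> l <= m.
Proof.
move=> ul vm uv; rewrite -subr_ge0.
apply: (cvg_seq_ge0 (cvg_seqB (V := C) vm ul)) => n.
by rewrite subr_ge0.
Qed.

Lemma cplx_posE (R : realType) (e : cplx R) : 0 < e ->
  exists2 r : R, 0 < r & e = r%:C%C.
Proof.
move=> e0; have eE : e = (complex.Re (e : R[i]))%:C%C by rewrite RRe_real// gtr0_real.
by exists (complex.Re (e : R[i])); rewrite // -ltcR -eE.
Qed.

Lemma cvg_invn (R : realType) :
  (n.+1%:R^-1 : cplx R) @[n --> \oo] --> (0 : cplx R).
Proof.
apply/cvg_seqP => _ /cplx_posE[r r0 ->].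
have [N _ h] := near_infty_natSinv_lt (PosNum r0).
exists N => k Nk; rewrite subr0 ger0_norm ?invr_ge0//.
by rewrite -(rmorph_nat (real_complex R)) -fmorphV ltcR; exact: h.
Qed.

Lemma cplx_ReIm_le (R : realType) (z : cplx R) (r : R) :
  `|z| < r%:C%C -> `|complex.Re (z : R[i])| < r /\ `|complex.Im (z : R[i])| < r.
Proof.
move=> zr; split; rewrite -ltcR; apply: le_lt_trans zr; first exact: normc_ge_Re.
have -> : complex.Im (z : R[i]) = complex.Re (- 'i%C * z : R[i]) by case: z => a b /=; ring.
apply: le_trans (normc_ge_Re _) _; rewrite normrM normrN normc_def /=.
by rewrite expr0n expr1n add0r sqrtr1 mul1r.
Qed.

Lemma cplx_norm_le (R : realType) (z : cplx R) :
  `|z| <= (`|complex.Re (z : R[i])| + `|complex.Im (z : R[i])|)%:C%C.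
Proof.
have i1 : `|'i%C : R[i]| = 1 by rewrite normc_def /= expr0n expr1n add0r sqrtr1.
rewrite {1}[z : R[i]]complexE; apply: le_trans (ler_normD _ _) _.
rewrite rmorphD /=; apply: lerD; last rewrite normrM i1 mul1r.
all: by rewrite normc_def /= expr0n addr0 sqrtr_sqr.
Qed.

Lemma cplx_cauchy_cvg (R : realType) (u : nat -> cplx R) :
  (forall e : cplx R, 0 < e -> exists N, forall m n, (N <= m)%N -> (N <= n)%N ->
     `|u m - u n| < e) -> exists l : cplx R, u n @[n --> \oo] --> l.
Proof.
move=> uC.
have uC' (e : R) : 0 < e -> exists N, forall m n, (N <= m)%N -> (N <= n)%N ->
    `|complex.Re (u m : R[i]) - complex.Re (u n : R[i])| < e /\
    `|complex.Im (u m : R[i]) - complex.Im (u n : R[i])| < e.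
  move=> e0; have [|N uN] := uC e%:C%C; first by rewrite ltcR.
  exists N => m n Nm Nn; have := cplx_ReIm_le (uN m n Nm Nn).
  by case: (u m) (u n) => [a b] [c d].
have [a ua] : exists a : R, complex.Re (u n : R[i]) @[n --> \oo] --> a.
  apply: cauchy_seq_cvg => e /uC'[N h]; exists N => m n Nm Nn.
  by have [] := h m n Nm Nn.
have [b ub] : exists b : R, complex.Im (u n : R[i]) @[n --> \oo] --> b.
  apply: cauchy_seq_cvg => e /uC'[N h]; exists N => m n Nm Nn.
  by have [] := h m n Nm Nn.
exists (a +i* b)%C; apply/cvg_seqP => _ /cplx_posE[r r0 ->].
have r2 : 0 < r / 2 by rewrite divr_gt0.
have [N1 h1] := (cvg_seqP (V := R) _ _).1 ua _ r2.
have [N2 h2] := (cvg_seqP (V := R) _ _).1 ub _ r2.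
exists (maxn N1 N2) => n; rewrite geq_max => /andP[/h1 n1 /h2 n2].
apply: le_lt_trans (cplx_norm_le _) _; rewrite ltcR [ltRHS]splitr.
by move: n1 n2; case: (u n) => c d /= n1 n2; exact: ltrD.
Qed.

(** * Hilbert spaces and bounded operators *)

Section inner_product.
Context {R : realType} {H : hilbertType R}.
Implicit Types (x y z : H) (a b : cplx R).

Lemma ip_psd : psd_form (@ip R H : H -> H -> cplx R).
Proof.
split=> [a u v w|u v|u].
- by rewrite linearPl.
- by rewrite hermC expr0 mul1r.
- by rewrite dnorm_ge0.
Qed.

Lemma ipC x y : ip y x = (ip x y)^*. Proof. exact: psdC ip_psd _ _. Qed.
Lemma ipDl x y z : ip (x + y) z = ip x z + ip y z.
Proof. exact: psdDl ip_psd _ _ _. Qed.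
Lemma ipDr x y z : ip z (x + y) = ip z x + ip z y.
Proof. exact: psdDr ip_psd _ _ _. Qed.
Lemma ipZl a x z : ip (a *: x) z = a * ip x z.
Proof. exact: psdZl ip_psd _ _ _. Qed.
Lemma ipZr a x z : ip z (a *: x) = a^* * ip z x.
Proof. exact: psdZr ip_psd _ _ _. Qed.
Lemma ip0l x : ip 0 x = 0. Proof. exact: psd0l ip_psd _. Qed.
Lemma ip0r x : ip x 0 = 0. Proof. exact: psd0r ip_psd _. Qed.
Lemma ipNr x z : ip z (- x) = - ip z x. Proof. exact: psdNr ip_psd _ _. Qed.
Lemma ipBl x y z : ip (x - y) z = ip x z - ip y z.
Proof. exact: psdBl ip_psd _ _ _. Qed.
Lemma ipBr x y z : ip z (x - y) = ip z x - ip z y.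
Proof. exact: psdBr ip_psd _ _ _. Qed.
Lemma ip_suml I (r : seq I) (P : pred I) (F : I -> H) z :
  ip (\sum_(i <- r | P i) F i) z = \sum_(i <- r | P i) ip (F i) z.
Proof. exact: psd_suml ip_psd _ _ _ _ _. Qed.
Lemma ip_sumr I (r : seq I) (P : pred I) (F : I -> H) z :
  ip z (\sum_(i <- r | P i) F i) = \sum_(i <- r | P i) ip z (F i).
Proof. exact: psd_sumr ip_psd _ _ _ _ _. Qed.

Lemma ip_sq x : ip x x = `|x| ^+ 2. Proof. by rewrite ip_norm. Qed.

Lemma ip_eq0 x : ip x x = 0 -> x = 0.
Proof. by rewrite ip_sq => /eqP; rewrite sqrf_eq0 normr_eq0 => /eqP. Qed.

Lemma ip_inj x y : (forall z, ip x z = ip y z) -> x = y.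
Proof.
by move=> xy; apply/eqP; rewrite -subr_eq0; apply/eqP/ip_eq0; rewrite ipBl xy subrr.
Qed.

Lemma ip_injr x y : (forall z, ip z x = ip z y) -> x = y.
Proof. by move=> xy; apply: ip_inj => z; rewrite ipC xy -ipC. Qed.

Lemma sq_le (a b : cplx R) : 0 <= a -> 0 <= b -> a ^+ 2 <= b ^+ 2 -> a <= b.
Proof. by move=> a0 b0; rewrite ler_pXn2r// nnegrE. Qed.

Lemma ip_CS x y : `|ip x y| <= `|x| * `|y|.
Proof.
apply: sq_le; rewrite ?mulr_ge0//.
by rewrite exprMn -!ip_sq; exact: psd_CS ip_psd _ _.
Qed.

Lemma norm_sqB x y : `|x - y| ^+ 2 = ip x x - (ip x y + (ip x y)^*) + ip y y.
Proof. rewrite -ip_sq ipBl !ipBr (ipC x y); ring. Qed.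

Lemma cvg_ip (u v : nat -> H) x y : u n @[n --> \oo] --> x -> v n @[n --> \oo] --> y ->
  ip (u n) (v n) @[n --> \oo] --> (ip x y : cplx R).
Proof.
move=> ux vy; have [M M0 uM] := cvg_seq_bounded ux.
apply: (@cvg_squeeze _ _ _ _ (fun n => M * `|v n - y| + `|u n - x| * `|y|)).
  move=> n; have -> : ip (u n) (v n) - ip x y = ip (u n) (v n - y) + ip (u n - x) y.
    by rewrite ipBr ipBl addrA subrK.
  apply: le_trans (ler_normD _ _) _; apply: lerD.
    by apply: le_trans (ip_CS _ _) _; rewrite ler_wpM2r.
  exact: ip_CS.
have h1 := cvg_seqMl M (cvg_seq_norm vy).
have h2 := cvg_seqMr `|y| (cvg_seq_norm ux).
by have := cvg_seqD (V := cplx R) h1 h2; rewrite mulr0 mul0r addr0.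
Qed.

Lemma cvg_ipl (u : nat -> H) x y : u n @[n --> \oo] --> x ->
  ip (u n) y @[n --> \oo] --> (ip x y : cplx R).
Proof. by move=> ux; apply: cvg_ip => //; exact: cvg_cst. Qed.

Lemma cvg_ipr (u : nat -> H) x y : u n @[n --> \oo] --> x ->
  ip y (u n) @[n --> \oo] --> (ip y x : cplx R).
Proof. by move=> ux; apply: cvg_ip => //; exact: cvg_cst. Qed.

(** The Radon-Riesz property, by expanding the squared distance. It later upgrades weak to norm
    convergence for unitaries and for endomorphism semigroups. *)
Lemma cvg_weak_norm (u : nat -> H) x :
  (ip (u n) x @[n --> \oo] --> (ip x x : cplx R)) ->
  (ip (u n) (u n) @[n --> \oo] --> (ip x x : cplx R)) -> u n @[n --> \oo] --> x.
Proof.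
move=> ux uu; apply: cvg_sq0.
have -> : (fun n => `|u n - x| ^+ 2) =
    (fun n => ip (u n) (u n) - (ip (u n) x + (ip (u n) x)^*) + ip x x).
  by apply/funext => n; rewrite norm_sqB.
have -> : 0 = ip x x - (ip x x + (ip x x)^*) + ip x x by rewrite -ipC; ring.
have h := cvg_seqB (V := cplx R) uu (cvg_seqD (V := cplx R) ux (cvg_conj ux)).
exact: (cvg_seqD (V := cplx R) h (@cvg_seq_const _ (cplx R) (ip x x))).
Qed.

End inner_product.

Arguments cvg_ipl {R H u x} y.
Arguments cvg_ipr {R H u x} y.

(** * Riesz representation *)

Section riesz.
Context {R : realType} {H : hilbertType R}.
Variables (phi : H -> cplx R) (M : cplx R).
Hypothesis phi_lin : forall a x y, phi (a *: x + y) = a * phi x + phi y.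
Hypothesis phi_bound : forall x, `|phi x| <= M * `|x|.

(** If [y] represents [phi], then [J x] is |x - y|^2 - |y|^2: the representing vector is sought as
    the minimizer of [J]. *)
Let J x : cplx R := ip x x - (phi x + (phi x)^*).

Let phiD x y : phi (x + y) = phi x + phi y.
Proof. by have := phi_lin 1 x y; rewrite scale1r mul1r. Qed.
Let phi0 : phi 0 = 0.
Proof. by apply: (addrI (phi 0)); rewrite -phiD !addr0. Qed.
Let phiZ a x : phi (a *: x) = a * phi x.
Proof. by rewrite -[a *: x]addr0 phi_lin phi0 addr0. Qed.

Let M0 (x : H) : 0 <= M * `|x|. Proof. exact: le_trans (phi_bound x). Qed.

Let J_real (x : H) : J x \is Num.real.
Proof.
apply: realB; first exact: ger0_real (psd_ge0 ip_psd x).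
by rewrite CrealE rmorphD /= conjCK addrC.
Qed.

Let phi_re (x : H) : phi x + (phi x)^* <= 2 * (M * `|x|).
Proof.
have r : phi x + (phi x)^* \is Num.real by rewrite CrealE rmorphD /= conjCK addrC.
apply: le_trans (real_ler_norm r) _; apply: le_trans (ler_normD _ _) _.
by rewrite norm_conjC mulr_natl mulr2n lerD.
Qed.

(** The bound on [phi] gives J x + |M|^2 >= (|x| - |M|)^2. *)
Let J_ge (x : H) : - `|M| ^+ 2 <= J x.
Proof.
have [->|x0] := eqVneq x 0.
  by rewrite /J ip0l phi0 rmorph0 !addr0 subr0 lerNl oppr0 exprn_ge0.
have Mn : M = `|M| by rewrite ger0_norm// -(pmulr_lge0 _ (_ : 0 < `|x|)) ?normr_gt0.
rewrite -subr_ge0 /J opprK; apply: (@le_trans _ _ ((`|x| - `|M|) ^+ 2)).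
  by rewrite real_exprn_even_ge0// realB// ?normr_real.
rewrite ip_sq -subr_ge0.
have -> : `|x| ^+ 2 - (phi x + (phi x)^*) + `|M| ^+ 2 - (`|x| - `|M|) ^+ 2 =
  2 * (M * `|x|) - (phi x + (phi x)^*) by rewrite [M in RHS]Mn; ring.
by rewrite subr_ge0.
Qed.

(** The linear parts cancel. As [J] at the midpoint is at least the infimum, near-minimizers are
    close to each other, so a minimizing sequence is Cauchy. *)
Let parallelogram (x y : H) : `|x - y| ^+ 2 =
  2 * (J x + J y) - 4 * J (2^-1 *: (x + y)).
Proof.
have h : (2^-1 : cplx R)^* = 2^-1 by rewrite conj_Creal// realV realn.
rewrite /J phiZ ipZl ipZr phiD rmorphM h rmorphD -!ip_sq ipBl !ipBr ipDl !ipDr /=.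
by field.
Qed.

Let inf_J : exists I : cplx R, (forall x, I <= J x) /\
  forall e : cplx R, 0 < e -> exists x, J x < I + e.
Proof.
pose S : set R := [set complex.Re (J x : R[i]) | x in setT].
have JE x : J x = (complex.Re (J x : R[i]))%:C%C by rewrite RRe_real.
have ME : - `|M| ^+ 2 = (complex.Re (- `|M| ^+ 2 : R[i]))%:C%C.
  by rewrite RRe_real// realN ger0_real// exprn_ge0.
have Si : has_inf S.
  split; first by exists (complex.Re (J 0 : R[i])), 0.
  exists (complex.Re (- `|M| ^+ 2 : R[i])) => _ [x _ <-].
  by rewrite -lecR -ME -JE.
exists (inf S)%:C%C; split.
  move=> x; rewrite JE lecR; apply: ge_inf; first by case: Si.
  by exists x.
move=> e e0.
have eE : e = (complex.Re (e : R[i]))%:C%C by rewrite RRe_real// gtr0_real.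
have e0' : 0 < complex.Re (e : R[i]) by rewrite -ltcR -eE.
have [_ [x _ <-] xe] := inf_adherent e0' Si.
by exists x; rewrite JE eE -rmorphD ltcR.
Qed.

Lemma riesz : exists y, forall x, phi x = ip x y.
Proof.
have [I [IJ Ie]] := inf_J.
have e_ k : (0 : cplx R) < k.+1%:R^-1 by rewrite invr_gt0 ltr0n.
pose u k := xchoose (Ie _ (e_ k)).
have uI k : J (u k) < I + k.+1%:R^-1 by exact: xchooseP (Ie _ (e_ k)).
have sq x y a b : J x < I + a -> J y < I + b -> `|x - y| ^+ 2 < 2 * (a + b).
  move=> xa yb; rewrite parallelogram.
  apply: (@le_lt_trans _ _ (2 * (J x + J y) - 4 * I)).
    by rewrite lerD2l lerN2 ler_pM2l.
  rewrite ltrBlDr; apply: (@lt_le_trans _ _ (2 * (I + a + (I + b)))).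
    by rewrite ltr_pM2l// ltrD.
  by rewrite le_eqVlt; apply/orP; left; apply/eqP; ring.
have inv_small := (cvg_seqP (V := cplx R) _ _).1 (@cvg_invn R).
have [|y uy] := @cauchy_seq_cvg _ _ u.
  move=> e e0; have [|N hN] := inv_small (e ^+ 2 / 4); first by rewrite divr_gt0// exprn_gt0.
  have {}hN k : (N <= k)%N -> k.+1%:R^-1 < e ^+ 2 / 4.
    by move=> /hN; rewrite subr0 ger0_norm// invr_ge0.
  exists N => m n Nm Nn; rewrite -(@ltr_pXn2r _ 2) ?nnegrE ?(ltW e0)//.
  apply: lt_trans (sq _ _ _ _ (uI m) (uI n)) _.
  have -> : e ^+ 2 = 2 * (e ^+ 2 / 4 + e ^+ 2 / 4) by field.
  by rewrite ltr_pM2l// ltrD ?hN.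
have cphi : phi (u k) @[k --> \oo] --> phi y.
  apply: (@cvg_squeeze _ (cplx R) _ _ (fun k => `|M| * `|u k - y|)).
    move=> k; have -> : phi (u k) - phi y = phi (u k - y).
      by rewrite -[- y]scaleN1r phiD phiZ mulN1r.
    apply: le_trans (phi_bound _) _; apply: le_trans (real_ler_norm _) _.
      by rewrite ger0_real// M0.
    by rewrite normrM normr_id.
  by have := cvg_seqMl `|M| (cvg_seq_norm uy); rewrite mulr0.
have cJ : J (u k) @[k --> \oo] --> J y.
  have h := cvg_ip uy uy.
  exact: (cvg_seqB (V := cplx R) h (cvg_seqD (V := cplx R) cphi (cvg_conj cphi))).
have Jy : J y <= I.
  rewrite -[leRHS]addr0.
  apply: (cvg_seq_le cJ (cvg_seqD (V := cplx R) (@cvg_seq_const _ (cplx R) I) (@cvg_invn R))).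
  by move=> n; exact: ltW (uI n).
(* [z] is the defect of the representation at [h]; minimality of [y] along the line [y + t *: h]
   forces it to vanish. *)
exists y => h; pose z := ip h y - phi h.
have var t : 0 <= t * z + (t * z)^* + `|t| ^+ 2 * ip h h.
  have := le_trans Jy (IJ (y + t *: h)).
  rewrite /J phiD phiZ ipDl !ipDr !ipZl !ipZr (ipC h y) -subr_ge0 normCK.
  congr (_ <= _); rewrite /z !(rmorphD, rmorphB, rmorphM) /=; ring.
apply/eqP; rewrite eq_sym -subr_eq0 -/z; apply/eqP.
have [h0|hn0] := eqVneq h 0.
  by rewrite /z h0 ip0l phi0 subrr.
have hgt : 0 < ip h h by rewrite ip_sq exprn_gt0// normr_gt0.
have hr : (ip h h)^* = ip h h by rewrite -ipC.
(* The minimizing parameter, where the quadratic takes the value -|z|^2 / <h, h>. *)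
have := var (- z^* / ip h h).
rewrite normrM normfV (gtr0_norm hgt) normrN norm_conjC exprMn.
rewrite !(rmorphM, rmorphN, fmorphV) /= conjCK hr normCK.
have -> : - z^* / ip h h * z + - z / ip h h * z^* + z * z^* * (ip h h)^-1 ^+ 2 * ip h h =
  - (z * z^* / ip h h) by field; rewrite gt_eqF.
rewrite oppr_ge0 pmulr_lle0 ?invr_gt0// -normCK => zz.
by apply/eqP; rewrite -normr_eq0 -sqrf_eq0 eq_le zz exprn_ge0.
Qed.
End riesz.

Section bop_theory.
Context {R : realType} {H : hilbertType R}.
Implicit Types (A B : bop H) (x y z : H) (a b : cplx R).

Lemma bop_lin A a x y : A (a *: x + y) = a *: A x + A y.
Proof. by have /bounded_opP[lA _] := bop_funP A; rewrite lA. Qed.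

Lemma bopD A x y : A (x + y) = A x + A y.
Proof. by have := bop_lin A 1 x y; rewrite !scale1r. Qed.
Lemma bop0 A : A 0 = 0. Proof. by apply: (addrI (A 0)); rewrite -bopD !addr0. Qed.
Lemma bopZ A a x : A (a *: x) = a *: A x.
Proof. by rewrite -[a *: x]addr0 bop_lin bop0 addr0. Qed.
Lemma bopN A x : A (- x) = - A x. Proof. by rewrite -scaleN1r bopZ scaleN1r. Qed.
Lemma bopB A x y : A (x - y) = A x - A y. Proof. by rewrite bopD bopN. Qed.
Lemma bop_sum A I (r : seq I) (P : pred I) (F : I -> H) :
  A (\sum_(i <- r | P i) F i) = \sum_(i <- r | P i) A (F i).
Proof. by apply: (big_morph A) => [u v|]; rewrite ?bopD ?bop0. Qed.

Lemma bop_bound A : exists2 M : cplx R, 0 < M & forall x, `|A x| <= M * `|x|.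
Proof.
have /bounded_opP[_ [M AM]] := bop_funP A.
exists (`|M| + 1) => [|x]; first by rewrite ltr_wpDl.
apply: le_trans (AM x) _; have [->|x0] := eqVneq x 0; first by rewrite normr0 !mulr0.
have M0 : 0 <= M.
  by rewrite -(pmulr_lge0 _ (_ : 0 < `|x|)) ?normr_gt0// (le_trans _ (AM x)).
by rewrite ler_wpM2r// ger0_norm// lerDl.
Qed.

Lemma bop_cvg A (u : nat -> H) x : u n @[n --> \oo] --> x ->
  A (u n) @[n --> \oo] --> A x.
Proof.
move=> ux; have [M M0 AM] := bop_bound A.
apply: (@cvg_squeeze _ _ _ _ (fun n => M * `|u n - x|)).
  by move=> n; rewrite -bopB.
by have := cvg_seqMl M (cvg_seq_norm ux); rewrite mulr0.
Qed.

Lemma bop_addE A B x : (A + B) x = A x + B x. Proof. by []. Qed.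
Lemma bop_scaleE a A x : (a *: A) x = a *: A x. Proof. by []. Qed.
Lemma bop_oppE A x : (- A) x = - A x. Proof. by []. Qed.
Lemma bop_mulE A B x : (A * B) x = A (B x). Proof. by []. Qed.
Lemma bop_oneE x : (1 : bop H) x = x. Proof. by []. Qed.
Lemma bop_zeroE x : (0 : bop H) x = 0. Proof. by []. Qed.
Lemma bop_sumE I (r : seq I) (P : pred I) (F : I -> bop H) x :
  (\sum_(i <- r | P i) F i) x = \sum_(i <- r | P i) F i x.
Proof. by apply: (big_morph (fun A : bop H => A x)). Qed.

Lemma bop_scalerAl a A B : a *: (A * B) = (a *: A) * B.
Proof. exact: bop_eq. Qed.
Lemma bop_scalerAr a A B : a *: (A * B) = A * (a *: B).
Proof. by apply: bop_eq => x; rewrite bop_scaleE !bop_mulE bop_scaleE bopZ. Qed.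

Lemma bop_weak_eq A B : (forall x y, ip (A x) y = ip (B x) y) -> A = B.
Proof. by move=> AB; apply: bop_eq => x; apply: ip_inj. Qed.

Fact bop_mk_subproof (f : H -> H) : (forall a x y, f (a *: x + y) = a *: f x + f y) ->
  (exists M, forall x, `|f x| <= M * `|x|) -> f \in bounded_op.
Proof. by move=> lf bf; apply/bounded_opP. Qed.

Definition bop_mk f lf bf : bop H := Bop (@bop_mk_subproof f lf bf).

Lemma adj_exists A : exists B : bop H, forall x y, ip (A x) y = ip x (B y).
Proof.
have [M M0 AM] := bop_bound A.
have ex y : exists z, forall x, ip (A x) y = ip x z.
  apply: (@riesz _ _ _ (M * `|y|)) => [a u v|x]; first by rewrite bop_lin ipDl ipZl.
  by apply: le_trans (ip_CS _ _) _; rewrite mulrAC ler_wpM2r.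
pose f y := get [set z | forall x, ip (A x) y = ip x z].
have fE x y : ip (A x) y = ip x (f y).
  have [z zE] := ex y; exact: (@getPex _ [set z | forall x, ip (A x) y = ip x z] (ex y)).
have lf a u v : f (a *: u + v) = a *: f u + f v.
  by apply: ip_injr => x; rewrite -fE !ipDr !ipZr !fE.
have bf : exists M, forall x, `|f x| <= M * `|x|.
  exists M => y; have [->|fy0] := eqVneq (f y) 0; first by rewrite normr0; apply: mulr_ge0 => //; exact: ltW.
  have f0 : 0 < `|f y| by rewrite normr_gt0.
  rewrite -(ler_pM2l f0) -expr2 -ip_sq -fE.
  rewrite (le_trans (real_ler_norm _))//.
    by rewrite fE ip_sq realX// normr_real.
  by apply: le_trans (ip_CS _ _) _; rewrite mulrCA mulrA ler_wpM2r.
by exists (bop_mk lf bf).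
Qed.

Lemma adjP A x y : ip (A x) y = ip x (adj A y).
Proof. exact: (@getPex _ [set B : bop H | forall x y, ip (A x) y = ip x (B y)] (adj_exists A)). Qed.

Lemma adjPr A x y : ip x (A y) = ip (adj A x) y.
Proof. by rewrite ipC adjP -ipC. Qed.

Lemma adj_uniq A B : (forall x y, ip (A x) y = ip x (B y)) -> adj A = B.
Proof. by move=> AB; apply: bop_eq => y; apply: ip_injr => x; rewrite -adjP AB. Qed.

Lemma adjK A : adj (adj A) = A.
Proof. by apply: adj_uniq => x y; rewrite -adjPr. Qed.
Lemma adjM A B : adj (A * B) = adj B * adj A.
Proof. by apply: adj_uniq => x y; rewrite !bop_mulE !adjP. Qed.
Lemma adjZ a A : adj (a *: A) = a^* *: adj A.
Proof. by apply: adj_uniq => x y; rewrite !bop_scaleE ipZl ipZr conjCK adjP. Qed.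
Fact rank1_linear (u v : H) a x y :
  ip (a *: x + y) v *: u = a *: (ip x v *: u) + ip y v *: u.
Proof. by rewrite ipDl ipZl scalerDl scalerA. Qed.

Fact rank1_bounded (u v : H) : exists M, forall x, `|ip x v *: u| <= M * `|x|.
Proof.
exists (`|v| * `|u|) => x; rewrite normrZ mulrAC ler_wpM2r//.
by rewrite mulrC ip_CS.
Qed.

Definition rank1 (u v : H) : bop H := bop_mk (rank1_linear u v) (rank1_bounded u v).

Lemma rank1E u v x : rank1 u v x = ip x v *: u. Proof. by []. Qed.
Lemma rank1D a u u' v : rank1 (a *: u + u') v = a *: rank1 u v + rank1 u' v.
Proof.
by apply: bop_eq => x; rewrite bop_addE bop_scaleE !rank1E scalerDr !scalerA mulrC.
Qed.
Lemma mul_rank1 A u v : A * rank1 u v = rank1 (A u) v.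
Proof. by apply: bop_eq => x; rewrite bop_mulE !rank1E bopZ. Qed.
Lemma adj_rank1 u v : adj (rank1 u v) = rank1 v u.
Proof.
by apply: adj_uniq => x y; rewrite !rank1E ipZl ipZr -ipC mulrC.
Qed.
Lemma rank1_rank1 u v w z : rank1 u v * rank1 w z = ip w v *: rank1 u z.
Proof. by rewrite mul_rank1 rank1E -[_ *: u]addr0 rank1D; apply: bop_eq => x; rewrite bop_addE rank1E scaler0 addr0. Qed.

Lemma bop_lim (A : nat -> bop H) M : (forall n x, `|A n x| <= M * `|x|) ->
  (forall x, exists y : H, A n x @[n --> \oo] --> y) ->
  exists2 B : bop H, (forall x, A n x @[n --> \oo] --> B x) & forall x, `|B x| <= M * `|x|.
Proof.
move=> AM Ac; pose f x := sval (cid (Ac x)).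
have fP x : A n x @[n --> \oo] --> f x := svalP (cid (Ac x)).
have lf a x y : f (a *: x + y) = a *: f x + f y.
  apply: cvg_seq_unique (fP _) _.
  have -> : (fun n => A n (a *: x + y)) = (fun n => a *: A n x + A n y).
    by apply/funext => n; rewrite bop_lin.
  exact: cvg_seqD (cvg_seqZr a (fP x)) (fP y).
have fM x : `|f x| <= M * `|x|.
  apply: sq_le => //; first exact: le_trans (AM 0%N x).
  rewrite -ip_sq; apply: cvg_seq_le (cvg_ip (fP x) (fP x)) (@cvg_seq_const _ (cplx R) _) _ => n.
  by rewrite ip_sq lerXn2r ?nnegrE//; exact: le_trans (AM 0%N x).
have bf : exists M, forall x, `|f x| <= M * `|x| by exists M.
by exists (bop_mk lf bf).
Qed.

Section expansion.
Variable u : nat -> H.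
Hypothesis u01 : ortho01 ip u.
Hypothesis u_dense : hilbert_dense ip setT (Defs.span (range u)).

Lemma span_null w : Defs.span (range u) w -> exists N, null_resid ip u N w.
Proof.
move: w; apply: (@span_ind R H (range u) [set w | exists N, null_resid ip u N w]) => [|a x y [N xN] [M yM]|_ [j _ <-]].
- by exists 0%N; rewrite /null_resid /proj big_ord0 subr0 ip0l.
- exists (maxn N M); apply: null_residD => //; first exact: ip_psd.
    exact: (null_residS ip_psd u01 (leq_maxl N M)).
  exact: (null_residS ip_psd u01 (leq_maxr N M)).
- exists j.+1; rewrite /null_resid; suff -> : proj ip u j.+1 (u j) = u j by rewrite subrr ip0l.
  rewrite /proj (bigD1 ord_max)//= big1 ?addr0 => [|i ij].
    by case: (proj2 u01 j) => ->; rewrite ?scale1r// scaler0.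
  by rewrite (proj1 u01) ?scale0r// eq_sym.
Qed.

(** A vector of the span within the tolerance has null residual from some rank on; from there on the
    projections of [x] approximate at least as well. *)
Lemma proj_cvg x : proj ip u N x @[N --> \oo] --> x.
Proof.
apply: cvg_sq0; apply/cvg_seqP => e e0.
have [w /span_null[N wN]] := proj2 u_dense x I _ e0.
move=> we; exists N => n Nn; rewrite subr0 distrC ger0_norm ?exprn_ge0// -ip_sq.
apply: le_lt_trans we; apply: proj_best => //; first exact: ip_psd.
exact: (null_residS ip_psd u01 Nn).
Qed.

Lemma parseval x y : \sum_(j < N) ip x (u j) * (ip y (u j))^* @[N --> \oo] --> ip x y.
Proof.
rewrite (_ : (fun N => _) = (fun N => ip x (proj ip u N y))).
  exact: (cvg_ipr x (@proj_cvg y)).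
by apply/funext => N; rewrite (psd_projr ip_psd).
Qed.

Lemma parseval_sq x : \sum_(j < N) `|ip x (u j)| ^+ 2 @[N --> \oo] --> `|x| ^+ 2.
Proof.
rewrite -ip_sq (_ : (fun N => _) = fun N => \sum_(j < N) ip x (u j) * (ip x (u j))^*).
  exact: parseval.
by apply/funext => N; apply: eq_bigr => j _; rewrite normCK.
Qed.

End expansion.

Lemma onb_ortho01 e : onb e -> @ortho01 _ H ip e.
Proof.
case=> _ ee _; split=> [j k jk|j]; first by rewrite ee (negbTE jk).
by left; rewrite ee eqxx.
Qed.

End bop_theory.

Arguments proj_cvg {R H u} _ _ x.
Arguments parseval {R H u} _ _ x y.
Arguments parseval_sq {R H u} _ _ x.

(** * Enumerating the nonzero vectors of a family; existence of orthonormal bases *)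

Section selection.
Variable p : pred nat.

Definition kth (k m : nat) : Prop := p m /\ count p (iota 0 m) = k.

(* The position of the [k]-th true value of [p], if there is one. *)
Definition sel (k : nat) : nat := xget 0%N (kth k).

Lemma countS m : count p (iota 0 m.+1) = (count p (iota 0 m) + p m)%N.
Proof. by rewrite -addn1 iotaD count_cat /= addn0. Qed.

Lemma count_mono m n : (m <= n)%N -> (count p (iota 0 m) <= count p (iota 0 n))%N.
Proof. by move=> mn; rewrite -(subnKC mn) iotaD count_cat leq_addr. Qed.

Lemma kth_uniq k m n : kth k m -> kth k n -> m = n.
Proof.
wlog mn : m n / (m <= n)%N.
  move=> h km kn; have [mn|/ltnW nm] := leqP m n; first exact: h.
  by apply/esym/h.
move=> [pm cm] [pn cn]; move: mn; rewrite leq_eqVlt => /orP[/eqP//|mn].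
by have := count_mono mn; rewrite countS pm cm cn addn1 ltnn.
Qed.

Lemma sel_eq k m : kth k m -> sel k = m.
Proof. by move=> km; apply: (xget_unique _ km) => n kn; exact: kth_uniq kn km. Qed.

Hypothesis p_infinite : forall M, exists2 m, (M <= m)%N & p m.

Lemma kth_ex k : exists m, kth k m.
Proof.
have cge j : exists m, (j <= count p (iota 0 m))%N.
  elim: j => [|j [m jm]]; first by exists 0%N.
  have [n mn pn] := p_infinite m.
  by exists n.+1; rewrite countS pn addn1 ltnS (leq_trans jm)// count_mono.
have exk : exists m, (k < count p (iota 0 m.+1))%N.
  have [m km] := cge k.+1; exists m; apply: leq_trans km _.
  exact: count_mono.
(* At the least [m] where the count first exceeds [k] the count must have just increased, so [p m]
   holds. *)
exists (ex_minn exk); case: ex_minnP => m km mmin.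
have cm : (count p (iota 0 m) <= k)%N.
  case: m km mmin => // m _ /(_ m) h; rewrite leqNgt; apply/negP => /h.
  by rewrite ltnn.
move: km; rewrite countS /kth; case: (p m) => /=; last by rewrite addn0 ltnNge cm.
rewrite addn1 ltnS => km; split=> //; apply/eqP.
by rewrite eqn_leq cm.
Qed.

Lemma selP k : kth k (sel k).
Proof. by have [m km] := kth_ex k; rewrite (sel_eq km). Qed.

Lemma sel_inj : injective sel.
Proof. by move=> j k jk; have [_ <-] := selP j; have [_ <-] := selP k; rewrite jk. Qed.

Lemma sel_surj m : p m -> exists k, sel k = m.
Proof. by move=> pm; exists (count p (iota 0 m)); apply: sel_eq. Qed.

End selection.

Section subfamily.
Context {R : realType} {V : lmodType (cplx R)} (f : V -> V -> cplx R).
Variable u : nat -> V.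
Hypothesis u01 : ortho01 f u.
Hypothesis u_infinite : forall M, exists2 m, (M <= m)%N & u m != 0.

Let v k := u (sel (fun m => u m != 0) k).

Lemma sel_orthonormal j k : f (v j) (v k) = (j == k)%:R.
Proof.
have [->|jk] := eqVneq j k; last first.
  by apply: (proj1 u01); apply: contra_neq jk; exact: sel_inj.
have [+ _] := selP u_infinite k; rewrite -/(v k) => vk0.
by case: (proj2 u01 (sel (fun m => u m != 0) k)) => // v0; rewrite /v v0 eqxx in vk0.
Qed.

Lemma sel_span : Defs.span (range u) `<=` Defs.span (range v).
Proof.
apply: span_ind; [exact: span0|by move=> *; exact: spanD|move=> _ [m _ <-]].
have [->|um0] := eqVneq (u m) 0; first exact: span0.
have [k km] := @sel_surj (fun m => u m != 0) _ um0.
by apply: span_in; exists k => //; rewrite /v km.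
Qed.

End subfamily.

Section onb_existence.
Context {R : realType} {H : hilbertType R}.

(** Gram-Schmidt along a dense sequence, with the zero vectors removed afterwards. *)
Lemma onb_exists : separable H -> infinite_dimensional H -> exists e : nat -> H, onb e.
Proof.
move=> [S cS dS] infH.
have [g ginj] : exists g : H -> nat, {in S &, injective g}.
  by have /countable_injP[g gi] := cS; exists g; exact: gi.
(* For an [n] that codes no point of [S] the value is arbitrary, which is harmless: only the points
   of [S] have to be reached. *)
pose s n : H := get [set x | S x /\ g x = n].
have sS x : S x -> exists n, s n = x.
  move=> Sx; exists (g x); have [Sy gy] : S (s (g x)) /\ g (s (g x)) = g x.
    exact: (@getPex _ [set y | S y /\ g y = g x] (ex_intro _ x (conj Sx erefl))).
  by apply: ginj => //; exact/mem_set.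
pose u := gs ip s.
have u01 : ortho01 ip u := gs_ortho01 ip_psd s.
have s_span k : Defs.span (range u) (s k).
  have /ip_eq0/eqP := gs_null ip_psd s k; rewrite subr_eq0 => /eqP ->.
  by apply: (@span_sum _ _ _ _ (fun j => ip (s k) (u j)) u) => j _; exists j.
have u_dense : hilbert_dense ip setT (Defs.span (range u)).
  split=> // v _ e e0.
  have se0 : 0 < sqrtC e by rewrite sqrtC_gt0.
  have [w [+ Sw]] : ball v (sqrtC e) `&` S !=set0.
    by apply: dS; [exists v; exact: ballxx|exact: ball_open].
  rewrite -ball_normE /= => vw; exists w; last first.
    rewrite ip_sq -[ltRHS]sqrtCK ltr_pXn2r// nnegrE//; exact: ltW.
  by have [n <-] := sS w Sw; exact: s_span.
have u_inf M : exists2 m, (M <= m)%N & u m != 0.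
  (* Otherwise every vector equals its projection on the first [M] vectors, which then span the
     space. *)
  apply: contrapT => noM; apply: infH.
  have uM0 m : (M <= m)%N -> u m = 0.
    by move=> Mm; apply/eqP/negPn/negP => um; apply: noM; exists m.
  exists [seq u i | i <- iota 0 M]; apply/seteqP; split=> // x _.
  have h : proj ip u N x @[N --> \oo] --> proj ip u M x.
    apply/cvg_seqP => e e0; exists M => n Mn.
    rewrite /proj -(subnKC Mn) big_split_ord /= addrAC subrr add0r big1 ?normr0//.
    by move=> i _; rewrite uM0 ?scaler0// leq_addr.
  rewrite (cvg_seq_unique (proj_cvg u01 u_dense x) h).
  apply: (@span_sum _ _ _ _ (fun j => ip x (u j)) u) => j jM; apply/mapP; exists j => //.
  by rewrite mem_iota.
exists (fun k => u (sel (fun m => u m != 0) k)); split=> //.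
  exact: (sel_orthonormal u01 u_inf).
split=> // v _ e e0; have [w /sel_span sw we] := proj2 u_dense v I e e0.
by exists w.
Qed.

End onb_existence.

(** * Trace class operators and the sigma-weak topology *)

Section trace.
Context {R : realType} {H : hilbertType R}.
Implicit Types (T S A : bop H).

Section positive_operator.
Variable S : bop H.
Hypothesis S_pos : forall x, 0 <= ip (S x) x.
Variable e : nat -> H.
Hypothesis e_onb : onb e.

Let f x y : cplx R := ip (S x) y.

(* Polarization: a form with real diagonal is hermitian. *)
Lemma positive_psd : psd_form f.
Proof.
have r u : (f u u)^* = f u u by apply/eqP; rewrite -CrealE ger0_real// S_pos.
split=> [a u v w|u v|u]; rewrite /f ?bop_lin ?ipDl ?ipZl// -/(f _ _).
have fD x y z : f (x + y) z = f x z + f y z by rewrite /f bopD ipDl.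
have fDr x y z : f z (x + y) = f z x + f z y by rewrite /f ipDr.
have h1 := r (u + v); have h2 := r (u + 'i *: v).
have fi x y : f x ('i *: y) = - 'i * f x y by rewrite /f ipZr conjCi.
have fi' x y : f ('i *: y) x = 'i * f y x by rewrite /f bopZ ipZl.
rewrite !fD !fDr !rmorphD /= !r in h1.
rewrite !fD !fDr !fi' !fi !rmorphD !rmorphM !rmorphN /= !r conjCi in h2.
set a := f u v in h1 h2 *; set b := f v u in h1 h2 *.
have e1 : a^* + b^* = a + b.
  apply/eqP; rewrite -subr_eq0; apply/eqP.
  by move/eqP: h1; rewrite -subr_eq0 => /eqP <-; ring.
have e2 : a^* - b^* = b - a.
  apply: (mulfI (neq0Ci (cplx R))); apply/eqP; rewrite -subr_eq0; apply/eqP.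
  by move/eqP: h2; rewrite -subr_eq0 => /eqP <-; ring.
have -> : a^* = ((a^* + b^*) + (a^* - b^*)) / 2 by field.
by rewrite e1 e2; field.
Qed.

Let e_dense (x : H) (d : cplx R) : 0 < d ->
  exists2 w, Defs.span (range e) w & `|x - w| < d.
Proof.
move=> d0; have [_ _ [_ /(_ x I _ (exprn_gt0 2 d0))[w sw xw]]] := e_onb.
by exists w => //; rewrite -(@ltr_pXn2r _ 2) ?nnegrE -?ip_sq// ltW.
Qed.

Let u := gs f e.

Let u01 : ortho01 f u := gs_ortho01 positive_psd e.

Lemma positive_selfadjoint : adj S = S.
Proof.
by apply: adj_uniq => x y; rewrite -[LHS]/(f x y) (psdC positive_psd y x) -ipC.
Qed.

Let h k := S (u k).

Let null_span w : Defs.span (range e) w -> exists N, null_resid f u N w.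
Proof.
move: w; apply: (@span_ind R H (range e) [set w | exists N, null_resid f u N w])
  => [|a x y [N xN] [M yM]|_ [j _ <-]].
- by exists 0%N; rewrite /null_resid /proj big_ord0 subr0 (psd0l positive_psd).
- exists (maxn N M); apply: null_residD => //; first exact: positive_psd.
    exact: (null_residS positive_psd u01 (leq_maxl N M)).
  exact: (null_residS positive_psd u01 (leq_maxr N M)).
- by exists j.+1; exact: gs_null positive_psd e j.
Qed.

Let form_le : exists2 M : cplx R, 0 < M & forall x, f x x <= M * `|x| ^+ 2.
Proof.
have [M M0 SM] := bop_bound S; exists M => // x.
apply: le_trans (real_ler_norm (ger0_real (S_pos x))) _.
by apply: le_trans (ip_CS _ _) _; rewrite expr2 mulrA ler_wpM2r.
Qed.

(** The form is dominated by the square of the norm, so the span of [e] is also dense for the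
    form. *)
Let resid_cvg x : f (x - proj f u N x) (x - proj f u N x) @[N --> \oo] --> (0 : cplx R).
Proof.
apply/cvg_seqP => d d0; have [M M0 fM] := form_le.
have dM : 0 < sqrtC (d / M) by rewrite sqrtC_gt0 divr_gt0.
have [w /null_span[N wN] xw] := e_dense x dM.
exists N => n Nn; rewrite subr0 ger0_norm ?(psd_ge0 positive_psd)//.
apply: (@le_lt_trans _ _ (f (x - w) (x - w))).
  apply: (proj_best positive_psd u01).
  exact: (null_residS positive_psd u01 Nn wN).
apply: le_lt_trans (fM _) _; rewrite -ltr_pdivlMl// mulrC -[ltRHS]sqrtCK.
by rewrite ltr_pXn2r// nnegrE// ltW.
Qed.

(* [|Sy|^4 <= <Sy, y> <S(Sy), Sy>], by Cauchy-Schwarz for the form. *)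
Let sq_le_form : exists2 M : cplx R, 0 < M & forall y, `|S y| ^+ 2 <= M * f y y.
Proof.
have [M M0 fM] := form_le; exists M => // y.
have [->|Sy0] := eqVneq (S y) 0.
  by rewrite normr0 expr0n mulr_ge0 ?S_pos// ltW.
have p : 0 < `|S y| ^+ 2 by rewrite exprn_gt0// normr_gt0.
rewrite -(ler_pM2r p).
have := psd_CS positive_psd y (S y); rewrite {1}/f ip_sq ger0_norm ?exprn_ge0//.
rewrite expr2 => le1; apply: le_trans le1 _.
rewrite mulrAC [leRHS]mulrC; apply: ler_wpM2l; first exact: S_pos.
exact: fM.
Qed.

(** The projections approximate [x] in the form only and need not converge in [H]; [sq_le_form]
    converts this into norm convergence of their images under [S]. *)
Lemma positive_expansion x : S (proj f u N x) @[N --> \oo] --> S x.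
Proof.
have [M M0 SM] := sq_le_form.
apply: cvg_sq0; apply: (@cvg_squeeze _ (cplx R) _ _
  (fun N => M * f (x - proj f u N x) (x - proj f u N x))).
  move=> N; rewrite subr0 ger0_norm ?exprn_ge0//.
  by rewrite distrC -bopB; exact: SM.
by have := cvg_seqMl M (@resid_cvg x); rewrite mulr0.
Qed.

(** By Parseval the left side is a double sum of |<S e_i, u_k>|^2. Summed over [k] first, Bessel for
    the form bounds it by <S e_i, e_i>, so the trace of [S] bounds the whole. *)
Lemma positive_sum B : (forall N, \sum_(i < N) ip (S (e i)) (e i) <= B) ->
  forall K, \sum_(k < K) `|h k| ^+ 2 <= B.
Proof.
move=> SB K.
have e01 := onb_ortho01 e_onb; have [_ _ e_d] := e_onb.
apply: (@cvg_seq_le _ (fun N => \sum_(k < K) \sum_(i < N) `|ip (h k) (e i)| ^+ 2) (fun=> B)).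
- by apply: cvg_seq_sum => k; exact: parseval_sq.
- exact: cvg_cst.
move=> N; rewrite exchange_big /=; apply: le_trans (SB N); apply: ler_sum => i _.
rewrite (_ : \sum_(_ < K) _ = \sum_(k < K) `|f (e i) (u k)| ^+ 2).
  exact: (bessel positive_psd u01).
by apply: eq_bigr => k _; rewrite /f adjP positive_selfadjoint ipC norm_conjC.
Qed.

End positive_operator.

(* [T = sum_k |T u_k><S u_k|] for the vectors [u_k] obtained by orthonormalizing
   a basis for the form <S x, y>, where S = |T|. *)
Lemma trace_class_expansion T (e : nat -> H) : onb e -> trace_class T ->
  exists a h : nat -> H, exists B : cplx R,
  [/\ forall k, `|a k| = `|h k|,
      forall K, \sum_(k < K) `|h k| ^+ 2 <= B
    & forall x, \sum_(k < K) ip x (h k) *: a k @[K --> \oo] --> T x].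
Proof.
move=> e_onb [S [S_pos SS S_tr]].
pose f x y : cplx R := ip (S x) y; pose u := gs f e.
have TS x : `|T x| = `|S x|.
  apply/eqP; rewrite -(@eqrXn2 _ 2)// -!ip_sq adjPr [X in _ == X]adjPr.
  by rewrite (positive_selfadjoint S_pos) -!bop_mulE SS.
have [B cB] : exists B, forall N, \sum_(i < N) ip (S (e i)) (e i) <= B.
  have [B _ cB] := cvg_seq_bounded (S_tr e e_onb); exists B => N.
  have := cB N; rewrite /series /= big_mkord; apply: le_trans.
  by apply: real_ler_norm; rewrite ger0_real// sumr_ge0.
exists (fun k => T (u k)), (fun k => S (u k)), B; split=> // [|x].
  exact: (positive_sum S_pos e_onb cB).
have cS := @positive_expansion S S_pos e e_onb x.
apply/cvg_seqP => d d0; have [N cN] := (cvg_seqP _ _).1 cS d d0.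
exists N => n Nn; have := cN n Nn; rewrite -!bopB -TS; congr (`|_| < _).
rewrite bopB; congr (_ - _); rewrite bop_sum; apply: eq_bigr => k _.
by rewrite bopZ {1}adjP (positive_selfadjoint S_pos).
Qed.

Section trace_value.
Variables (a h : nat -> H) (B : cplx R) (T : bop H).
Hypothesis ah : forall k, `|a k| = `|h k|.
Hypothesis hB : forall K, \sum_(k < K) `|h k| ^+ 2 <= B.
Hypothesis T_exp : forall x, \sum_(k < K) ip x (h k) *: a k @[K --> \oo] --> T x.

Let tail d : 0 < d -> exists K, forall L M, (K <= L)%N -> (L <= M)%N ->
  \sum_(L <= k < M) `|h k| ^+ 2 < d.
Proof.
move=> d0; have [||N hN] := @cplx_mono_cauchy R (fun N => \sum_(k < N) `|h k| ^+ 2) B _ _ hB d d0.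
- by move=> n; rewrite sumr_ge0// => j _; rewrite exprn_ge0.
- by move=> n; rewrite big_ord_recr lerDl /= exprn_ge0.
exists N => L M NL LM; have := hN L M NL LM.
by rewrite -!(big_mkord xpredT (fun k => `|h k| ^+ 2)) (big_cat_nat (leq0n L) LM)//= addrAC subrr add0r.
Qed.

Lemma sigma_weak_tail (A : bop H) (C : cplx R) L M : 0 < C ->
  (forall x, `|A x| <= C * `|x|) ->
  `|\sum_(L <= k < M) ip (A (a k)) (h k)| <= C * \sum_(L <= k < M) `|h k| ^+ 2.
Proof.
move=> C0 AC; apply: le_trans (ler_norm_sum _ _ _) _; rewrite mulr_sumr.
apply: ler_sum => k _; apply: le_trans (ip_CS _ _) _.
by rewrite expr2 mulrA ler_wpM2r// (le_trans (AC _))// ah.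
Qed.

Lemma sigma_weak_cvg (A : bop H) :
  exists l : cplx R, \sum_(k < K) ip (A (a k)) (h k) @[K --> \oo] --> l.
Proof.
have [C C0 AC] := bop_bound A; apply: cplx_cauchy_cvg => d d0.
have [|K hK] := @tail (d / C); first by rewrite divr_gt0.
have main L M : (K <= L)%N -> (L <= M)%N ->
    `|\sum_(k < M) ip (A (a k)) (h k) - \sum_(k < L) ip (A (a k)) (h k)| < d.
  move=> KL LM.
  rewrite -!(big_mkord xpredT (fun k => ip (A (a k)) (h k))) (big_cat_nat (leq0n L) LM)//= addrAC subrr add0r.
  apply: le_lt_trans (sigma_weak_tail _ _ C0 AC) _.
  by rewrite -ltr_pdivlMl// mulrC hK.
exists K => m n Km Kn; have [mn|/ltnW nm] := leqP m n; last exact: main.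
by rewrite distrC; exact: main.
Qed.

(** The diagonal series is the double series of <A e_i, h_k><a_k, e_i>. Summed over [i] first it
    gives <A a_k, h_k> by Parseval, whatever the basis; [t_tail] bounds the tails in [k] uniformly
    in the number of terms in [i], which justifies the exchange. *)
Lemma trace_onb (A : bop H) (l : cplx R) (e : nat -> H) : onb e ->
  (\sum_(k < K) ip (A (a k)) (h k) @[K --> \oo] --> l) ->
  series (diag_coef (T * A) e) @ \oo --> l.
Proof.
move=> e_onb Al; have e01 := onb_ortho01 e_onb; have [_ _ e_d] := e_onb.
have [C C0 AC] := bop_bound A; have [C' C'0 A'C] := bop_bound (adj A).
pose t K i := \sum_(k < K) ip (A (e i)) (h k) * ip (a k) (e i).
pose b L M := \sum_(L <= k < M) `|h k| ^+ 2.
have t_tail L M N : (L <= M)%N -> `|\sum_(i < N) (t M i - t L i)| <= (C' ^+ 2 + 1) * b L M.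
  move=> LM.
  have -> : \sum_(i < N) (t M i - t L i) =
      \sum_(L <= k < M) \sum_(i < N) ip (A (e i)) (h k) * ip (a k) (e i).
    rewrite exchange_big; apply: eq_bigr => i _ /=; rewrite /t.
    rewrite -!(big_mkord xpredT (fun k => ip (A (e i)) (h k) * ip (a k) (e i))).
    by rewrite (big_cat_nat (leq0n L) LM)//= addrAC subrr add0r.
  apply: le_trans (ler_norm_sum _ _ _) _; rewrite mulr_sumr.
  apply: ler_sum => k _; apply: le_trans (ler_norm_sum _ _ _) _.
  apply: (@le_trans _ _ (\sum_(i < N) (`|ip (adj A (h k)) (e i)| ^+ 2 + `|ip (a k) (e i)| ^+ 2))).
    apply: ler_sum => i _; rewrite normrM adjP ipC norm_conjC.
    have /orP[xy|yx] := real_leVge (normr_real (ip (adj A (h k)) (e i))) (normr_real (ip (a k) (e i))).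
      by rewrite ler_wpDl ?exprn_ge0// expr2 ler_wpM2r.
    by rewrite ler_wpDr ?exprn_ge0// expr2 ler_wpM2l.
  rewrite big_split mulrDl mul1r /=; apply: lerD.
    apply: le_trans (bessel ip_psd e01 _ _) _; rewrite ip_sq -exprMn.
    by rewrite lerXn2r ?nnegrE ?mulr_ge0// ltW.
  by apply: le_trans (bessel ip_psd e01 _ _) _; rewrite ip_sq ah.
have t_cvg i : t K i @[K --> \oo] --> ip (T (A (e i))) (e i).
  have := cvg_ipl (e i) (@T_exp (A (e i))).
  rewrite (_ : (fun K => ip _ _) = t^~ i) //; apply/funext => K.
  by rewrite ip_suml; apply: eq_bigr => k _; rewrite ipZl.
apply/cvg_seqP => d d0.
have d3 : 0 < d / 3 by rewrite divr_gt0.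
have CC : 0 < C' ^+ 2 + 1 by rewrite ltr_wpDl ?exprn_ge0 ?ltW.
have [|K1 hK1] := @tail (d / 3 / (C' ^+ 2 + 1)); first by rewrite divr_gt0.
have [K2 hK2] := (cvg_seqP (V := cplx R) _ _).1 Al _ d3.
pose K := maxn K1 K2.
have tN : \sum_(i < N) t K i @[N --> \oo] --> \sum_(k < K) ip (A (a k)) (h k).
  rewrite (_ : (fun N => _) = fun N => \sum_(k < K) \sum_(i < N) ip (a k) (e i) * (ip (adj A (h k)) (e i))^*).
    by apply: cvg_seq_sum => k; rewrite adjP; exact: parseval.
  apply/funext => N; rewrite exchange_big; apply: eq_bigr => k _; apply: eq_bigr => i _.
  by rewrite mulrC adjP -ipC.
have [N hN] := (cvg_seqP (V := cplx R) _ _).1 tN _ d3.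
exists N => n Nn; rewrite /series /= big_mkord /diag_coef.
have h3 : `|\sum_(i < n) ip (T (A (e i))) (e i) - \sum_(i < n) t K i| <= d / 3.
  have cT : \sum_(i < n) t M i @[M --> \oo] --> \sum_(i < n) ip (T (A (e i))) (e i).
    by apply: cvg_seq_sum => i; exact: t_cvg.
  have := cvg_seq_norm (cvg_seqB (V := cplx R) cT (@cvg_seq_const _ (cplx R) (\sum_(i < n) t K i))).
  move=> cT0; apply/ler_addgt0Pr => r r0.
  have [M0 hM] := (cvg_seqP (V := cplx R) _ _).1 cT _ r0.
  have := hM _ (leq_maxr K M0); set M := maxn K M0; rewrite distrC => hM'.
  rewrite -[X in X - _](subrK (\sum_(i < n) t M i)) -addrA addrC.
  apply: le_trans (ler_normD _ _) _; apply: lerD; last exact: ltW.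
  rewrite -sumrB; apply: le_trans (t_tail _ _ _ (leq_maxl _ _)) _.
  by rewrite mulrC -ler_pdivlMr// ltW// hK1 ?leq_maxl.
have -> : \sum_(i < n) ip ((T * A) (e i)) (e i) - l =
   (\sum_(i < n) ip (T (A (e i))) (e i) - \sum_(i < n) t K i) +
   ((\sum_(i < n) t K i - \sum_(k < K) ip (A (a k)) (h k)) +
   (\sum_(k < K) ip (A (a k)) (h k) - l)) by rewrite !subrKA.
have -> : d = d / 3 + (d / 3 + d / 3) by field.
apply: le_lt_trans (ler_normD _ _) _; apply: ler_ltD => //.
apply: le_lt_trans (ler_normD _ _) _; apply: ltrD; first exact: hN.
by apply: hK2; exact: leq_maxr.
Qed.

End trace_value.

Lemma tr_eq (T : bop H) (e : nat -> H) (l : cplx R) : onb e ->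
  (forall e', onb e' -> series (diag_coef T e') @ \oo --> l) -> tr T = l.
Proof.
move=> e_onb Tl.
have h : forall e', onb e' -> series (diag_coef T e') @ \oo --> tr T.
  exact: (@getPex _ [set z : cplx R |
    forall e', onb e' -> series (diag_coef T e') @ \oo --> z] (ex_intro _ l Tl)).
exact: (@cvg_seq_unique _ (cplx R) _ _ _ (h e e_onb) (Tl e e_onb)).
Qed.
End trace.

Section sigma_weak.
Context {R : realType} {H : hilbertType R}.
Variable e : nat -> H.
Hypothesis e_onb : onb e.
Implicit Types (T A : bop H).

(** The form in which trace class operators are used from here on: the pairing with [T] is a series
    of matrix coefficients dominated by the |h_k|^2. *)
Lemma trace_classE T : trace_class T -> exists a h : nat -> H, exists B : cplx R,
  [/\ forall k, `|a k| = `|h k|,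
      forall K, \sum_(k < K) `|h k| ^+ 2 <= B
    & forall A, \sum_(k < K) ip (A (a k)) (h k) @[K --> \oo] --> tr (T * A)].
Proof.
move=> Tt; have [a [h [B [ah hB TE]]]] := trace_class_expansion e_onb Tt.
exists a, h, B; split=> // A.
have [l Al] := sigma_weak_cvg ah hB A.
suff -> : tr (T * A) = l by [].
by apply: (tr_eq e_onb) => e' e'_onb; exact: (trace_onb ah hB TE e'_onb Al).
Qed.

Lemma rank1_trace_class (u v : H) : trace_class (rank1 u v).
Proof.
(* The absolute value of [rank1 u v]: |u||v| times the projection onto the line of [v]. For [v = 0]
   the inverse is 0, and the operator vanishes as well. *)
exists ((`|u| / `|v|) *: rank1 v v); split.
- move=> x; rewrite bop_scaleE rank1E !ipZl mulr_ge0 ?divr_ge0//.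
  by rewrite [ip v x]ipC -normCK exprn_ge0.
- apply: bop_eq => x.
  rewrite adj_rank1 rank1_rank1 bop_mulE !bop_scaleE bopZ !rank1E ipZl !scalerA !ip_sq.
  congr (_ *: _).
  have [->|v0] := eqVneq v 0; first by rewrite ip0r !(mulr0, mul0r).
  by field; rewrite normr_eq0.
move=> e' e'_onb.
have /(_ (`|u| / `|v| *: v) v) := parseval (onb_ortho01 e'_onb) (let: And3 _ _ d := e'_onb in d).
move=> h; apply/cvg_ex; exists (ip (`|u| / `|v| *: v) v).
rewrite (_ : series _ = fun N => \sum_(j < N) ip (`|u| / `|v| *: v) (e' j) * (ip v (e' j))^*)//.
apply/funext => N; rewrite /series /= big_mkord; apply: eq_bigr => j _.
by rewrite /diag_coef bop_scaleE rank1E !ipZl (ipC v (e' j)); ring.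
Qed.

Lemma tr_rank1 (u v : H) A : tr (rank1 u v * A) = ip (A u) v.
Proof.
apply: (tr_eq e_onb) => e' e'_onb.
have /(_ u (adj A v)) := parseval (onb_ortho01 e'_onb) (let: And3 _ _ d := e'_onb in d).
rewrite -adjP (_ : (fun N => _) = series (diag_coef (rank1 u v * A) e'))//.
apply/funext => N; rewrite /series /= big_mkord; apply: eq_bigr => j _.
by rewrite /diag_coef bop_mulE rank1E !ipZl [in RHS]adjP (ipC (adj A v) (e' j)) mulrC.
Qed.

Definition rank1_tc (u v : H) : {T : bop H | trace_class T} :=
  exist _ (rank1 u v) (rank1_trace_class u v).

Lemma swop_cvg (F : set_system (swop H)) (A : swop H) : Filter F ->
  (forall T : {T : bop H | trace_class T},
     (fun B : swop H => predual_pairing B T) @ F --> predual_pairing A T) -> F --> A.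
Proof.
move=> FF FT.
have h : (@predual_pairing R H @ F : set_system {ptws {T : bop H | trace_class T} -> cplx R})
    --> (@predual_pairing R H A).
  apply/cvg_sup => T U.
  have /= -> := @nbhsE (initial_topology (fun f : {T : bop H | trace_class T} -> cplx R => f T)) (predual_pairing A).
  case=> B [[C oC <-] CA] BU; apply: filterS BU _.
  by apply: (FT T); apply: open_nbhs_nbhs.
move=> U [B [[W oW <-] WA] BU]; apply: filterS BU _.
by apply: h; apply: open_nbhs_nbhs.
Qed.

Lemma pairing_continuous (T : {T : bop H | trace_class T}) :
  continuous (fun A : swop H => predual_pairing A T).
Proof.
move=> A U AU.
have h1 : continuous (fun f : {ptws {T : bop H | trace_class T} -> cplx R} => f T).
  move=> f; have /cvg_sup/(_ T) h : nbhs f --> (f : {ptws {T : bop H | trace_class T} -> cplx R}).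
    exact: cvg_id.
  move=> V fV; apply: h.
  exact: (@initial_continuous _ _ (fun f : {T : bop H | trace_class T} -> cplx R => f T) f V fV).
have h2 := @initial_continuous _ _ (@predual_pairing R H).
exact: (h2 A _ (h1 _ _ AU)).
Qed.

Lemma coef_continuous (u v : H) : continuous (fun A : swop H => ip ((A : bop H) u) v : cplx R).
Proof.
rewrite (_ : (fun A => _) = fun A : swop H => predual_pairing A (rank1_tc u v)).
  exact: pairing_continuous.
by apply/funext => A; rewrite -tr_rank1.
Qed.

(** The uniform bound makes the tails of the series for [tr (T * A j)] small uniformly in [j], so
    that finitely many coefficients decide. *)
Lemma pairing_seq_cvg (A : nat -> bop H) (A0 : bop H) (M : cplx R) T :
  (forall j x, `|A j x| <= M * `|x|) ->
  (forall x y, ip (A j x) y @[j --> \oo] --> ip (A0 x) y) ->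
  trace_class T -> tr (T * A j) @[j --> \oo] --> tr (T * A0).
Proof.
move=> AM Aw /trace_classE[a [h [B [ah hB TE]]]].
have [C C0 AC] := bop_bound A0.
pose D := `|M| + C; have D0 : 0 < D by rewrite ltr_wpDl.
have ADj j x : `|A j x| <= D * `|x|.
  apply: le_trans (AM j x) _; apply: le_trans (real_ler_norm _) _.
    by rewrite ger0_real// (le_trans _ (AM j x)).
  by rewrite normrM normr_id ler_wpM2r// lerDl ltW.
have AD x : `|A0 x| <= D * `|x|.
  by apply: le_trans (AC x) _; rewrite ler_wpM2r// lerDr.
apply/cvg_seqP => d d0; have d3 : 0 < d / 3 by rewrite divr_gt0.
have [||N hN] := @cplx_mono_cauchy R (fun N => \sum_(k < N) `|h k| ^+ 2) B _ _ hB (d / 3 / D) (divr_gt0 d3 D0).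
- by move=> n; rewrite sumr_ge0// => j _; rewrite exprn_ge0.
- by move=> n; rewrite big_ord_recr lerDl /= exprn_ge0.
have tail (A' : bop H) : (forall x, `|A' x| <= D * `|x|) ->
    `|tr (T * A') - \sum_(k < N) ip (A' (a k)) (h k)| <= d / 3.
  move=> AD'.
  have cT := cvg_seqB (V := cplx R) (TE A') (@cvg_seq_const _ (cplx R) (\sum_(k < N) ip (A' (a k)) (h k))).
  apply/ler_addgt0Pr => r r0.
  have [M0 hM] := (cvg_seqP (V := cplx R) _ _).1 cT _ r0.
  have := hM _ (leq_maxr N M0); set L := maxn N M0.
  have NL : (N <= L)%N by exact: leq_maxl.
  rewrite distrC => hM'.
  set X := tr _ - _ in hM' *.
  rewrite -[X](subrK (\sum_(k < L) ip (A' (a k)) (h k) - \sum_(k < N) ip (A' (a k)) (h k))) addrC.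
  apply: le_trans (ler_normD _ _) _; apply: lerD; last exact: ltW.
  rewrite -!(big_mkord xpredT (fun k => ip (A' (a k)) (h k))) (big_cat_nat (leq0n N) NL)//=.
  rewrite addrAC subrr add0r; apply: le_trans (sigma_weak_tail ah _ _ D0 AD') _.
  rewrite mulrC -ler_pdivlMr// ltW//; have := hN N L (leqnn N) NL.
  by rewrite -!(big_mkord xpredT (fun k => `|h k| ^+ 2)) (big_cat_nat (leq0n N) NL)//= addrAC subrr add0r.
have fin : \sum_(k < N) ip (A j (a k)) (h k) @[j --> \oo] --> \sum_(k < N) ip (A0 (a k)) (h k).
  by apply: cvg_seq_sum => k; exact: Aw.
have [J hJ] := (cvg_seqP (V := cplx R) _ _).1 fin _ d3.
exists J => j /hJ jJ.
have -> : tr (T * A j) - tr (T * A0) =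
   (tr (T * A j) - \sum_(k < N) ip (A j (a k)) (h k)) +
   ((\sum_(k < N) ip (A j (a k)) (h k) - \sum_(k < N) ip (A0 (a k)) (h k)) +
   (\sum_(k < N) ip (A0 (a k)) (h k) - tr (T * A0))) by rewrite !subrKA.
have -> : d = d / 3 + (d / 3 + d / 3) by field.
apply: le_lt_trans (ler_normD _ _) _; apply: ler_ltD; first exact: tail (ADj j).
apply: le_lt_trans (ler_normD _ _) _; apply: ltr_leD => //.
by rewrite distrC; exact: tail.
Qed.

Lemma swop_seq_cvg (A : nat -> bop H) (A0 : bop H) (M : cplx R) :
  (forall j x, `|A j x| <= M * `|x|) ->
  (forall x y, ip (A j x) y @[j --> \oo] --> ip (A0 x) y) ->
  (A j : swop H) @[j --> \oo] --> (A0 : swop H).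
Proof.
move=> AM Aw; apply: swop_cvg => -[T Tt] /=.
exact: (pairing_seq_cvg AM Aw Tt).
Qed.

Lemma closed_swop_seq (F : set (swop H)) (A : nat -> bop H) (A0 : bop H) (M : cplx R) :
  closed F -> (forall j, F (A j)) -> (forall j x, `|A j x| <= M * `|x|) ->
  (forall x y, ip (A j x) y @[j --> \oo] --> ip (A0 x) y) -> F A0.
Proof.
move=> cF FA AM Aw.
apply: (closed_cvg F cF _ _ (swop_seq_cvg AM Aw)); exact: nearW.
Qed.

End sigma_weak.

Lemma normal_seq (R : realType) (H K : hilbertType R) (e : nat -> H) (e' : nat -> K)
    (f : bop H -> bop K) : onb e -> onb e' ->
  continuous (f : swop H -> swop K) ->
  forall (A : nat -> bop H) (A0 : bop H) (M : cplx R),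
  (forall j x, `|A j x| <= M * `|x|) ->
  (forall x y, ip (A j x) y @[j --> \oo] --> ip (A0 x) y) ->
  forall x y, ip (f (A j) x) y @[j --> \oo] --> ip (f A0 x) y.
Proof.
move=> e_onb e'_onb fc A A0 M AM Aw x y.
have h1 := swop_seq_cvg e_onb AM Aw.
have h2 : (f (A j) : swop K) @[j --> \oo] --> (f A0 : swop K).
  exact: (cvg_comp _ _ h1 (fc A0)).
exact: (cvg_comp _ _ h2 (@coef_continuous R K e' e'_onb x y (f A0))).
Qed.

Definition re (R : realType) (z : cplx R) : R := complex.Re (z : R[i]).
Definition im (R : realType) (z : cplx R) : R := complex.Im (z : R[i]).

Section re_im.
Context {R : realType}.
Implicit Types z w : cplx R.

Lemma reD z w : re (z + w) = re z + re w. Proof. by case: z w => [a b] [c d]. Qed.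
Lemma imD z w : im (z + w) = im z + im w. Proof. by case: z w => [a b] [c d]. Qed.
Lemma reN z : re (- z) = - re z. Proof. by case: z. Qed.
Lemma imN z : im (- z) = - im z. Proof. by case: z. Qed.
Lemma reB z w : re (z - w) = re z - re w. Proof. by rewrite reD reN. Qed.
Lemma imB z w : im (z - w) = im z - im w. Proof. by rewrite imD imN. Qed.
Lemma reM z w : re (z * w) = re z * re w - im z * im w.
Proof. by case: z w => [a b] [c d]. Qed.
Lemma imM z w : im (z * w) = re z * im w + im z * re w.
Proof. by case: z w => [a b] [c d]. Qed.
Lemma re_conj z : re (z^*) = re z.
Proof. by case: z. Qed.
Lemma im_conj z : im (z^*) = - im z.
Proof. by case: z. Qed.
Lemma re_im_inj z w : re z = re w -> im z = im w -> z = w.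
Proof. by case: z w => [a b] [c d] /= -> ->. Qed.
Lemma re_ge0 z : 0 <= z -> z = (re z)%:C%C.
Proof. by move=> z0; rewrite RRe_real// ger0_real. Qed.
Lemma norm_sq_re_im z : `|z| ^+ 2 = (re z ^+ 2 + im z ^+ 2)%:C%C.
Proof. by rewrite add_Re2_Im2. Qed.

Lemma cvg_re_im (u : nat -> cplx R) (l : cplx R) : u n @[n --> \oo] --> l ->
  re (u n) @[n --> \oo] --> re l /\ im (u n) @[n --> \oo] --> im l.
Proof.
move=> ul; split; apply/cvg_seqP => e e0.
all: have [|N uN] := (cvg_seqP (V := cplx R) _ _).1 ul e%:C%C; first by rewrite ltcR.
all: exists N => n /uN /cplx_ReIm_le[h1 h2]; by [rewrite -reB|rewrite -imB].
Qed.

Lemma cvg_of_re_im (u : nat -> cplx R) (l : cplx R) :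
  re (u n) @[n --> \oo] --> re l -> im (u n) @[n --> \oo] --> im l ->
  u n @[n --> \oo] --> l.
Proof.
move=> ua ub; apply/cvg_seqP => _ /cplx_posE[r r0 ->].
have r2 : 0 < r / 2 by rewrite divr_gt0.
have [N1 h1] := (cvg_seqP (V := R) _ _).1 ua _ r2.
have [N2 h2] := (cvg_seqP (V := R) _ _).1 ub _ r2.
exists (maxn N1 N2) => n; rewrite geq_max => /andP[/h1 n1 /h2 n2].
apply: le_lt_trans (cplx_norm_le _) _; rewrite ltcR [ltRHS]splitr.
by rewrite -reB -imB in n1 n2; exact: ltrD.
Qed.

End re_im.

(** * Measurability of operator valued maps *)

Section complex_measurable.
Context {R : realType} {d : measure_display} {T : measurableType d}.
Variable D : set T.
Implicit Types f g : T -> cplx R.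

Definition cmeas f : Prop :=
  measurable_fun D (fun x => re (f x)) /\ measurable_fun D (fun x => im (f x)).

Lemma cmeas_cst (c : cplx R) : cmeas (fun=> c).
Proof. by split; exact: measurable_cst. Qed.

Lemma cmeasD f g : cmeas f -> cmeas g -> cmeas (fun x => f x + g x).
Proof.
move=> [f1 f2] [g1 g2]; split.
  by under eq_fun do rewrite reD; exact: measurable_funD.
by under eq_fun do rewrite imD; exact: measurable_funD.
Qed.

Lemma cmeasN f : cmeas f -> cmeas (fun x => - f x).
Proof.
move=> [f1 f2]; split.
  by under eq_fun do rewrite reN; exact: measurable_funN.
by under eq_fun do rewrite imN; exact: measurable_funN.
Qed.

Lemma cmeasB f g : cmeas f -> cmeas g -> cmeas (fun x => f x - g x).
Proof. by move=> mf mg; apply: cmeasD => //; exact: cmeasN. Qed.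

Lemma cmeasM f g : cmeas f -> cmeas g -> cmeas (fun x => f x * g x).
Proof.
move=> [f1 f2] [g1 g2]; split.
  under eq_fun do rewrite reM.
  by apply: measurable_funB; exact: measurable_funM.
under eq_fun do rewrite imM.
by apply: measurable_funD; exact: measurable_funM.
Qed.

Lemma cmeas_conj f : cmeas f -> cmeas (fun x => (f x)^*).
Proof.
move=> [f1 f2]; split.
  by under eq_fun do rewrite re_conj.
by under eq_fun do rewrite im_conj; exact: measurable_funN.
Qed.

Lemma cmeas_sum (N : nat) (f : 'I_N -> T -> cplx R) :
  (forall i, cmeas (f i)) -> cmeas (fun x => \sum_(i < N) f i x).
Proof.
elim: N f => [|N IH] f mf.
  by under eq_fun do rewrite big_ord0; exact: cmeas_cst.
under eq_fun do rewrite big_ord_recl; apply: cmeasD => //; exact: IH.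
Qed.

Lemma cmeas_cvg (f : nat -> T -> cplx R) g : (forall m, cmeas (f m)) ->
  (forall x, D x -> f m x @[m --> \oo] --> g x) -> cmeas g.
Proof.
move=> mf fg; split.
  apply: (@measurable_fun_cvg _ _ _ _ (fun m x => re (f m x))) => [m|x Dx].
    by case: (mf m).
  by have [] := cvg_re_im (fg x Dx).
apply: (@measurable_fun_cvg _ _ _ _ (fun m x => im (f m x))) => [m|x Dx].
  by case: (mf m).
by have [] := cvg_re_im (fg x Dx).
Qed.

Lemma cmeas_eq_in f g : (forall x, D x -> f x = g x) -> cmeas f -> cmeas g.
Proof. by move=> fg mf; apply: (@cmeas_cvg (fun=> f)) => // x Dx; rewrite fg//; exact: cvg_cst. Qed.

Lemma cmeas_invsqrt f : (forall x, D x -> 0 <= f x) -> cmeas f ->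
  cmeas (fun x => (sqrtC (f x))^-1).
Proof.
move=> f0 [mf _].
(* The real power with exponent -1/2 is measurable and agrees with the inverse square root even at
   0, where both are 0. *)
pose g x := (re (f x) `^ (- 2^-1))%:C%C : cplx R.
apply: (@cmeas_eq_in g) => [x Dx|].
  have fE := re_ge0 (f0 x Dx).
  have r0 : 0 <= re (f x) by rewrite -lecR -fE; exact: f0.
  rewrite /g powRN powR12_sqrt// fmorphV; congr (_^-1).
  have -> : sqrtC (f x) = sqrtC (((Num.sqrt (re (f x)))%:C%C : cplx R) ^+ 2).
    by rewrite -rmorphXn /= sqr_sqrtr// -fE.
  by rewrite sqrCK// lecR sqrtr_ge0.
split; last exact: measurable_cst.
have h := measurableT_comp (measurable_powR (- 2^-1 : R)) mf.
exact: h.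
Qed.

Hypothesis mD : measurable D.

Lemma cmeas_set_eq f (c : cplx R) : cmeas f -> measurable (D `&` [set x | f x = c]).
Proof.
move=> [m1 m2].
rewrite (_ : _ `&` _ = (D `&` (fun x => re (f x)) @^-1` [set re c]) `&`
   (D `&` (fun x => im (f x)) @^-1` [set im c])).
  by apply: measurableI; [apply: m1|apply: m2].
apply/seteqP; split=> [x [Dx /= ->]//|x [[Dx /= e1] [_ /= e2]]].
by split=> //; exact: re_im_inj.
Qed.

Lemma cmeas_set_box f (a b r : R) : cmeas f ->
  measurable (D `&` [set x | `|re (f x) - a| < r /\ `|im (f x) - b| < r]).
Proof.
move=> [m1 m2].
rewrite (_ : _ `&` _ = (D `&` (fun x => re (f x)) @^-1` ball a r) `&`
   (D `&` (fun x => im (f x)) @^-1` ball b r)).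
  by apply: measurableI; [apply: m1|apply: m2] => //; exact: measurable_ball.
apply/seteqP; split=> [x [Dx [e1 e2]]|x [[Dx e1] [_ e2]]].
  by rewrite /ball /= distrC; split; split=> //=; rewrite distrC.
by split=> //; rewrite /= distrC [X in _ /\ X < _]distrC.
Qed.

Lemma cmeas_set_norm_le f (c : cplx R) : 0 <= c -> cmeas f ->
  measurable (D `&` [set x | `|f x| <= c]).
Proof.
move=> c0 [m1 m2].
have mg : measurable_fun D (fun x => re (f x) ^+ 2 + im (f x) ^+ 2).
  by apply: measurable_funD; exact: measurable_funX.
rewrite (_ : _ `&` _ = D `&` (fun x => re (f x) ^+ 2 + im (f x) ^+ 2) @^-1`
  `]-oo, re c ^+ 2]%classic); first exact: mg.
apply/seteqP; split=> [x [Dx /= h]|x [Dx /= h]]; split=> //=.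
  rewrite in_itv /= -lecR -norm_sq_re_im rmorphXn /= -re_ge0//.
  by rewrite lerXn2r ?nnegrE.
rewrite in_itv /= -lecR -norm_sq_re_im rmorphXn /= -re_ge0// in h.
by apply: sq_le.
Qed.

End complex_measurable.

Lemma continuous_cmeas (R : realType) (X : ptopologicalType) (G : set (set X))
    (O : set X) (f : X -> cplx R) :
  (forall U : set X, open U -> measurable (U : set (g_sigma_algebraType G))) ->
  open O -> (forall x, O x -> {for x, continuous f}) ->
  cmeas (O : set (g_sigma_algebraType G)) f.
Proof.
move=> GO oO fc.
have main (h : cplx R -> R) : (forall z w, `|h z - h w|%:C%C <= `|z - w| :> cplx R) ->
    measurable_fun (O : set (g_sigma_algebraType G)) (fun x => h (f x)).
  move=> hL mO; apply: (measurability _ (RGenOInfty.measurableE R)) => //.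
  move=> _ [_ [a ->] <-]; apply: GO; rewrite openE => x [Ox /=].
  rewrite in_itv /= andbT => afx; apply: filterI; first exact: open_nbhs_nbhs.
  have e0 : 0 < (h (f x) - a)%:C%C :> cplx R by rewrite ltcR subr_gt0.
  have fx : f y @[y --> x] --> f x := fc x Ox.
  move/cvgrPdist_lt: fx => /(_ _ e0); apply: filterS => y /=.
  move=> /(le_lt_trans (hL _ _)); rewrite ltcR in_itv /= andbT => hy.
  have := le_lt_trans (ler_norm _) hy.
  by rewrite ltrD2l ltrN2.
split; apply: main => z w.
  by rewrite -reB; exact: normc_ge_Re.
rewrite -imB; have -> : im (z - w) = re (- 'i%C * (z - w)).
  by case: (z - w) => a b; rewrite /re /im /=; ring.
apply: le_trans (normc_ge_Re _) _; rewrite normrM normrN normc_def /=.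
by rewrite expr0n expr1n add0r sqrtr1 mul1r.
Qed.

Lemma bopM_open (R : realType) (H : hilbertType R) (U : set (swop H)) :
  open U -> measurable (U : set (bopM H)).
Proof.
move=> oU; rewrite -[U]setCK; apply: measurableC; apply: sub_sigma_algebra.
by rewrite /= closedC.
Qed.

Lemma borel_rV_open (R : realType) n (U : set 'rV[R]_n) :
  open U -> measurable (U : set (borel_rV R n)).
Proof. by move=> oU; exact: sub_sigma_algebra. Qed.

Lemma cvg_seq_eq (K : numFieldType) (V : normedModType K) (v : nat -> V) (m : V)
    (u : nat -> V) (l : V) : (forall n, u n = v n) -> l = m ->
  v n @[n --> \oo] --> m -> u n @[n --> \oo] --> l.
Proof. by move=> /funext -> ->. Qed.

Lemma cvg_dense (R : realType) (H : hilbertType R) (phi : nat -> H -> cplx R)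
    (phi0 : H -> cplx R) (M : cplx R) (S : set H) : 0 < M ->
  (forall j x y, `|phi j x - phi j y| <= M * `|x - y|) ->
  (forall x y, `|phi0 x - phi0 y| <= M * `|x - y|) ->
  (forall x (d : cplx R), 0 < d -> exists2 s, S s & `|x - s| < d) ->
  (forall s, S s -> phi j s @[j --> \oo] --> phi0 s) ->
  forall x, phi j x @[j --> \oo] --> phi0 x.
Proof.
move=> M0 phiL phi0L Sd Sc x; apply/cvg_seqP => d d0.
have d3 : 0 < d / 3 by rewrite divr_gt0.
have [s Ss xs] := Sd x (d / 3 / M) (divr_gt0 d3 M0).
have [N hN] := (cvg_seqP (V := cplx R) _ _).1 (Sc s Ss) _ d3.
have Mx : M * `|x - s| < d / 3 by rewrite mulrC -ltr_pdivlMr.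
exists N => n /hN nN.
have -> : phi n x - phi0 x = (phi n x - phi n s) + ((phi n s - phi0 s) + (phi0 s - phi0 x)).
  by rewrite !subrKA.
have -> : d = d / 3 + (d / 3 + d / 3) by field.
apply: le_lt_trans (ler_normD _ _) _; apply: ltrD; first exact: le_lt_trans Mx.
apply: le_lt_trans (ler_normD _ _) _; apply: ltrD => //.
by rewrite distrC; exact: le_lt_trans Mx.
Qed.

Section operator_measurable.
Context {R : realType} {H : hilbertType R}.
Variable e : nat -> H.
Hypothesis e_onb : onb e.

Lemma coef_cmeas (u v : H) :
  cmeas (setT : set (bopM H)) (fun A : bopM H => ip ((A : bop H) u) v).
Proof.
apply: (@continuous_cmeas R (swop H)) => //; first by move=> U; exact: bopM_open.
  exact: openT.
by move=> A _; exact: coef_continuous e_onb u v A.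
Qed.

Lemma onb_dense x (d : cplx R) : 0 < d ->
  exists2 w, Defs.span (range e) w & `|x - w| < d.
Proof.
move=> d0; have [_ _ [_ /(_ x I _ (exprn_gt0 2 d0))[w sw xw]]] := e_onb.
by exists w => //; rewrite -(@ltr_pXn2r _ 2) ?nnegrE -?ip_sq// ltW.
Qed.

(** The uniform bound makes the coefficients equi-Lipschitz in each variable. Convergence thus
    passes from basis vectors to their span and to its closure, in [x] against each [e k] and then
    in [y]. *)
Lemma weak_of_basis (A : nat -> bop H) (A0 : bop H) (M : cplx R) :
  (forall j x, `|A j x| <= M * `|x|) ->
  (forall i k, ip (A j (e i)) (e k) @[j --> \oo] --> ip (A0 (e i)) (e k)) ->
  forall x y, ip (A j x) y @[j --> \oo] --> ip (A0 x) y.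
Proof.
move=> AM Ae x y.
have [C C0 AC] := bop_bound A0.
pose D := `|M| + C; have D0 : 0 < D by rewrite ltr_wpDl.
have ADj j z : `|A j z| <= D * `|z|.
  apply: le_trans (AM j z) _; apply: le_trans (real_ler_norm _) _.
    by rewrite ger0_real// (le_trans _ (AM j z)).
  by rewrite normrM normr_id ler_wpM2r// lerDl ltW.
have AD z : `|A0 z| <= D * `|z|.
  by apply: le_trans (AC z) _; rewrite ler_wpM2r// lerDr.
have Dy (z : H) : 0 < D * `|z| + 1 by rewrite ltr_wpDl// mulr_ge0// ltW.
have step1 k : ip (A j x) (e k) @[j --> \oo] --> ip (A0 x) (e k).
  apply: (@cvg_dense R H (fun j x => ip (A j x) (e k)) (fun x => ip (A0 x) (e k)) _
     (Defs.span (range e)) (Dy (e k)) _ _ _ _ x) => [j z w|z w|z d|s].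
  - rewrite -ipBl -bopB; apply: le_trans (ip_CS _ _) _.
    rewrite mulrDl mul1r ler_wpDr// mulrAC; apply: ler_wpM2r => //; exact: ADj.
  - rewrite -ipBl -bopB; apply: le_trans (ip_CS _ _) _.
    rewrite mulrDl mul1r ler_wpDr// mulrAC; apply: ler_wpM2r => //; exact: AD.
  - exact: onb_dense.
  apply: (@span_ind R H (range e) [set s | ip (A j s) (e k) @[j --> \oo] --> ip (A0 s) (e k)]).
  - by apply: (@cvg_seq_eq _ (cplx R) (fun=> 0) 0) => [j||];
      rewrite ?bop0 ?ip0l//; exact: cvg_cst.
  - move=> a u v /= cu cv.
    apply: cvg_seq_eq _ _ (cvg_seqD (V := cplx R) (cvg_seqMl a cu) cv) => [j|];
      by rewrite bop_lin ipDl ipZl.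
  - by move=> _ [i _ <-]; exact: Ae.
apply: (@cvg_dense R H (fun j y => ip (A j x) y) (fun y => ip (A0 x) y) _
     (Defs.span (range e)) (Dy x) _ _ _ _ y) => [j z w|z w|z d|s].
- rewrite -ipBr; apply: le_trans (ip_CS _ _) _.
  by rewrite mulrDl mul1r ler_wpDr//; apply: ler_wpM2r => //; exact: ADj.
- rewrite -ipBr; apply: le_trans (ip_CS _ _) _.
  by rewrite mulrDl mul1r ler_wpDr//; apply: ler_wpM2r => //; exact: AD.
- exact: onb_dense.
apply: (@span_ind R H (range e) [set s | ip (A j x) s @[j --> \oo] --> ip (A0 x) s]).
- by apply: (@cvg_seq_eq _ (cplx R) (fun=> 0) 0) => [j||];
    rewrite ?ip0r//; exact: cvg_cst.
- move=> a u v /= cu cv.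
  apply: cvg_seq_eq _ _ (cvg_seqD (V := cplx R) (cvg_seqMl a^* cu) cv) => [j|];
    by rewrite ipDr ipZr.
- by move=> _ [i _ <-]; exact: step1.
Qed.

Section maps.
Context {d : measure_display} {T : measurableType d}.
Variables (D : set T) (f : T -> bop H).
Hypothesis mf : forall i j, cmeas D (fun x => ip (f x (e i)) (e j)).

Lemma cmeas_ip (g h : T -> H) :
  (forall j, cmeas D (fun x => ip (g x) (e j))) ->
  (forall j, cmeas D (fun x => ip (h x) (e j))) ->
  cmeas D (fun x => ip (g x) (h x)).
Proof.
move=> mg mh; have [_ _ ed] := e_onb.
apply: (@cmeas_cvg _ _ _ D (fun N x => \sum_(j < N) ip (g x) (e j) * (ip (h x) (e j))^*)).
  by move=> N; apply: cmeas_sum => j; apply: cmeasM => //; exact: cmeas_conj.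
by move=> x _; exact: (parseval (onb_ortho01 e_onb) ed).
Qed.

(** Moving [f x] across the inner product reduces the claim to inner products of two varying
    vectors, to which [cmeas_ip] applies twice. *)
Lemma coef_cmeas_apply (g h : T -> H) :
  (forall j, cmeas D (fun x => ip (g x) (e j))) ->
  (forall j, cmeas D (fun x => ip (h x) (e j))) ->
  cmeas D (fun x => ip (f x (g x)) (h x)).
Proof.
move=> mg mh; have [_ _ ed] := e_onb.
rewrite (_ : (fun x => _) = fun x => ip (g x) (adj (f x) (h x))); last first.
  by apply/funext => x; rewrite adjP.
apply: cmeas_ip => // j.
rewrite (_ : (fun x => _) = fun x => (ip (f x (e j)) (h x))^*); last first.
  by apply/funext => x; rewrite -ipC adjPr.
by apply: cmeas_conj; apply: cmeas_ip => // i; exact: mf.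
Qed.

End maps.
End operator_measurable.

Lemma dense_seq (R : realType) (H : hilbertType R) : Defs.separable H ->
  exists s : nat -> H, forall (x : H) (d : cplx R), 0 < d -> exists n, `|x - s n| < d.
Proof.
move=> [S cS dS].
have [g ginj] : exists g : H -> nat, {in S &, injective g}.
  by have /countable_injP[g gi] := cS; exists g; exact: gi.
pose s n : H := get [set x | S x /\ g x = n].
exists s => x d d0.
have [w [+ Sw]] : ball x d `&` S !=set0.
  by apply: dS; [exists x; exact: ballxx|exact: ball_open].
rewrite -ball_normE /= => xw; exists (g w); suff -> : s (g w) = w by [].
have [Sy gy] : S (s (g w)) /\ g (s (g w)) = g w.
  exact: (@getPex _ [set y | S y /\ g y = g w] (ex_intro _ w (conj Sw erefl))).
by apply: ginj => //; exact/mem_set.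
Qed.

Section operator_valued.
Context {R : realType} {H : hilbertType R}.
Hypothesis H_sep : Defs.separable H.
Variable e : nat -> H.
Hypothesis e_onb : onb e.

Definition op_le (m : nat) (A : bop H) : Prop := forall x, `|A x| <= m%:R * `|x|.

Lemma op_le_ex (A : bop H) : exists m, op_le m A.
Proof.
have [M M0 AM] := bop_bound A; have ME := re_ge0 (ltW M0).
exists (Num.bound (re M)) => x; apply: le_trans (AM x) _; apply: ler_wpM2r => //.
rewrite ME -(rmorph_nat (real_complex R)) lecR ltW// archi_boundP//.
by rewrite -lecR -ME ltW.
Qed.

(** Tests a norm bound by countably many coefficients, which makes norm balls measurable. *)
Lemma op_leP (s : nat -> H) : (forall (x : H) (d : cplx R), 0 < d -> exists n, `|x - s n| < d) ->
  forall m (A : bop H), (forall p q, `|ip (A (s p)) (s q)| <= m%:R * `|s p| * `|s q|) -> op_le m A.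
Proof.
move=> s_dense m A Apq x.
have sub (y : H) : exists n : nat -> nat, s (n k) @[k --> \oo] --> y.
  have ex k : exists j, `|y - s j| < k.+1%:R^-1 by apply: s_dense; rewrite invr_gt0 ltr0n.
  exists (fun k => sval (cid (ex k))).
  apply: (@cvg_squeeze _ _ _ _ (fun k => k.+1%:R^-1)) => [k|]; last exact: cvg_invn.
  by rewrite distrC ltW//; exact: (svalP (cid (ex k))).
have norm_cvg (n : nat -> nat) (y : H) : s (n k) @[k --> \oo] --> y ->
    `|s (n k)| @[k --> \oo] --> (`|y| : cplx R).
  move=> ny; apply: (@cvg_squeeze _ (cplx R) _ _ (fun k => `|s (n k) - y|)) => [k|].
    exact: ler_dist_dist.
  exact: cvg_seq_norm.
have le2 y : `|ip (A x) y| <= m%:R * `|x| * `|y|.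
  have [n nx] := sub x; have [l ly] := sub y.
  have c1 := cvg_ip (@bop_cvg R H A _ _ nx) ly.
  have c2 := cvg_seqM (cvg_seqMl m%:R (norm_cvg n x nx)) (norm_cvg l y ly).
  apply: cvg_seq_le _ c2 (fun k => Apq (n k) (l k)).
  apply: (@cvg_squeeze _ (cplx R) _ _ (fun k => `|ip (A (s (n k))) (s (l k)) - ip (A x) y|)) => [k|].
    exact: ler_dist_dist.
  exact: (cvg_seq_norm (V := cplx R) c1).
have [->|Ax0] := eqVneq (A x) 0; first by rewrite normr0 mulr_ge0.
have Ax : 0 < `|A x| by rewrite normr_gt0.
rewrite -(ler_pM2r Ax) -expr2 -ip_sq; apply: le_trans (le2 (A x)).
by rewrite ip_sq ger0_norm// exprn_ge0.
Qed.

(** A finite matrix with rational real and imaginary parts, coded by nested sequences so that the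
    codes form a countable type; absent entries read as 0. *)
Let entry (q : seq (seq (rat * rat))) i j := nth (0, 0) (nth [::] q i) j.

Let close N (A : bop H) q := forall i j, (i < N)%N -> (j < N)%N ->
  `|re (ip (A (e i)) (e j)) - ratr (entry q i j).1| < N.+1%:R^-1 /\
  `|im (ip (A (e i)) (e j)) - ratr (entry q i j).2| < N.+1%:R^-1.

Let close_ex N (A : bop H) : exists q, close N A q.
Proof.
have rat_approx (r : R) : exists q : rat, `|r - ratr q| < N.+1%:R^-1.
  have [|q] := @rat_in_itvoo R (r - N.+1%:R^-1) (r + N.+1%:R^-1).
    by rewrite ltrD2l (lt_trans _ (_ : 0 < _)) ?oppr_lt0 ?invr_gt0 ?ltr0n.
  rewrite in_itv /= => /andP[q1 q2]; exists q.
  by rewrite distrC real_ltr_distl ?num_real// q1 q2.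
pose f1 i j := sval (cid (rat_approx (re (ip (A (e i)) (e j))))).
pose f2 i j := sval (cid (rat_approx (im (ip (A (e i)) (e j))))).
exists (mkseq (fun i => mkseq (fun j => (f1 i j, f2 i j)) N) N) => i j iN jN.
rewrite /entry !nth_mkseq//=; split.
  exact: (svalP (cid (rat_approx (re (ip (A (e i)) (e j)))))).
exact: (svalP (cid (rat_approx (im (ip (A (e i)) (e j)))))).
Qed.

(* On norm balls the sigma-weakly closed sets are determined by countably many
   conditions on matrix coefficients. *)
Let closed_ball (F : set (swop H)) m (A : bop H) : closed F -> op_le m A ->
  F A <-> forall N, exists q, (exists S, [/\ F S, op_le m S & close N S q]) /\ close N A q.
Proof.
move=> cF Am; split=> [FA N|FN].
  by have [q Aq] := close_ex N A; exists q; split=> //; exists A.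
have ex N : exists S, [/\ F S, op_le m S & exists q, close N S q /\ close N A q].
  by have [q [[S [FS Sm Sq]] Aq]] := FN N; exists S; split=> //; exists q.
pose S N := sval (cid (ex N)).
have SP N : [/\ F (S N), op_le m (S N) & exists q, close N (S N) q /\ close N A q].
  exact: (svalP (cid (ex N))).
have Sm j x : `|S j x| <= m%:R * `|x| by have [_ + _] := SP j; exact.
apply: (closed_swop_seq e_onb cF _ Sm) => [j|]; first by have [] := SP j.
apply: (weak_of_basis e_onb Sm) => i k.
have two : (2 * N.+1%:R^-1 : R) @[N --> \oo] --> (0 : R).
  rewrite -[X in _ --> X](mulr0 2); apply: cvg_seqMl.
  apply/cvg_seqP => r r0; have [N _ h] := near_infty_natSinv_lt (PosNum r0).
  exists N => n Nn; rewrite subr0 ger0_norm ?invr_ge0//; exact: h.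
have near_le (g : cplx R -> R) : (forall N (z w : R) (q : R), `|z - q| < N.+1%:R^-1 ->
    `|w - q| < N.+1%:R^-1 -> `|z - w| <= 2 * N.+1%:R^-1).
  move=> N z w q zq wq; rewrite -(subrKA q) mulr_natl mulr2n.
  by apply: le_trans (ler_normD _ _) _; rewrite lerD// ?ltW// distrC.
apply: cvg_of_re_im; apply/cvg_seqP => r r0;
  have [N0 hN0] := (cvg_seqP (V := R) _ _).1 two r r0;
  exists (maxn N0 (maxn i k).+1) => n; rewrite !geq_max gtn_max => /andP[/hN0 nN0 /andP[ni nk]];
  have [_ _ [q [Sq Aq]]] := SP n;
  have [s1 s2] := Sq i k ni nk; have [a1 a2] := Aq i k ni nk;
  rewrite subr0 ger0_norm ?mulr_ge0 ?invr_ge0// in nN0; apply: le_lt_trans nN0.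
- exact: near_le s1 a1.
- exact: near_le s2 a2.
Qed.

(** The preimage of a closed set is cut along the norm balls of natural radius, which exhaust B(H);
    on each of them [closed_ball] applies. *)
Lemma bopM_measurable {d : measure_display} {T : measurableType d} (D : set T)
    (f : T -> bop H) : measurable D ->
  (forall i j, cmeas D (fun x => ip (f x (e i)) (e j))) ->
  measurable_fun D (f : T -> bopM H).
Proof.
move=> mD mf _; apply: (@measurability _ _ _ (bopM H) D f
  [set F : set (swop H) | closed F] erefl) => //.
move=> _ [F cF <-].
have [s s_dense] := dense_seq H_sep.
have mcst (u : H) : forall j, cmeas D (fun x => ip u (e j)) by move=> j; exact: cmeas_cst.
have mball m : measurable (D `&` [set x | op_le m (f x)]).
  rewrite (_ : _ `&` _ = \bigcap_p \bigcap_q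
     (D `&` [set x | `|ip (f x (s p)) (s q)| <= m%:R * `|s p| * `|s q|])).
    apply: bigcapT_measurable => p; apply: bigcapT_measurable => q.
    apply: cmeas_set_norm_le => //.
    exact: (coef_cmeas_apply e_onb mf (mcst (s p)) (mcst (s q))).
  apply/seteqP; split=> [x [Dx fx] p _ q _|x fx].
    split=> //=; apply: le_trans (ip_CS _ _) _; rewrite ler_wpM2r//; exact: fx.
  split; first by case: (fx 0%N I 0%N I).
  by apply: (op_leP s_dense) => p q; case: (fx p I q I).
have mclose N q : measurable (D `&` [set x | close N (f x) q]).
  rewrite (_ : _ `&` _ = \bigcap_i \bigcap_j (if (i < N)%N && (j < N)%N then
     D `&` [set x | `|re (ip (f x (e i)) (e j)) - ratr (entry q i j).1| < N.+1%:R^-1 /\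
       `|im (ip (f x (e i)) (e j)) - ratr (entry q i j).2| < N.+1%:R^-1] else D)).
    apply: bigcapT_measurable => i; apply: bigcapT_measurable => j.
    by case: ifP => // _; exact: cmeas_set_box.
  apply/seteqP; split=> [x [Dx fx] i _ j _|x fx].
    by case: ifP => // /andP[iN jN]; split=> //; exact: fx.
  have Dx : D x by have := fx 0%N I 0%N I; case: ifP => // _ [].
  split=> // i j iN jN; have := fx i I j I; rewrite iN jN /= => -[_].
  exact.
(* Which codes [q] are admissible depends on [F], [m] and [N] but not on the point [x], so each [N]
   contributes a countable union of measurable sets. *)
rewrite (_ : _ `&` _ = \bigcup_m ((D `&` [set x | op_le m (f x)]) `&`
   \bigcap_N \bigcup_q (if `[< exists S, [/\ F S, op_le m S & close N S q] >]
      then D `&` [set x | close N (f x) q] else set0))).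
  apply: bigcupT_measurable => m; apply: measurableI => //.
  apply: bigcapT_measurable => N; apply: countable_bigcupT_measurable => // q.
  by case: ifP.
apply/seteqP; split=> [x [Dx Ffx]|x [m _ [[Dx fm] h]]].
  have [m fm] := op_le_ex (f x); exists m => //; split=> // N _.
  have [q [/asboolP Sq fq]] := (closed_ball cF fm).1 Ffx N.
  by exists q => //; rewrite Sq.
split=> //; apply/(closed_ball cF fm) => N; have [q _] := h N I.
by case: ifP => // /asboolP Sq [_ fq]; exists q.
Qed.

End operator_valued.

(** * Intertwiners of an endomorphism *)

Definition intertwiner (R : realType) (H : hilbertType R) (alpha : bop H -> bop H)
  (T : bop H) : Prop := forall A, alpha A * T = T * A.

Section isometry_families.
Context {R : realType} {H : hilbertType R}.
Implicit Types V W : nat -> bop H.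

Definition isometries V : Prop := forall j k, adj (V j) * V k = (j == k)%:R *: (1 : bop H).

Lemma isometries_ip V : isometries V ->
  forall j k x y, ip (V k x) (V j y) = (j == k)%:R * ip x y.
Proof. by move=> VV j k x y; rewrite adjPr -[adj _ _]bop_mulE VV bop_scaleE ipZl. Qed.

Lemma isometries_norm V (x : nat -> H) L M : isometries V ->
  `|\sum_(L <= k < M) V k (x k)| ^+ 2 = \sum_(L <= k < M) `|x k| ^+ 2.
Proof.
move=> VV; rewrite -ip_sq ip_suml; apply: eq_big_nat => k /andP[Lk kM].
rewrite ip_sumr (bigD1_seq k) ?mem_index_iota ?Lk ?iota_uniq//=.
rewrite big1 ?addr0 => [|j jk]; rewrite (isometries_ip VV) ?(negbTE jk) ?mul0r//.
by rewrite eqxx mul1r ip_sq.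
Qed.

Lemma isometries_sum_cvg V (x : nat -> H) (B : cplx R) : isometries V ->
  (forall K, \sum_(k < K) `|x k| ^+ 2 <= B) ->
  exists y : H, \sum_(k < K) V k (x k) @[K --> \oo] --> y.
Proof.
move=> VV xB; apply: cauchy_seq_cvg => d d0.
have [||N hN] := @cplx_mono_cauchy R (fun N => \sum_(k < N) `|x k| ^+ 2) B _ _ xB
    (d ^+ 2) (exprn_gt0 2 d0).
- by move=> n; rewrite sumr_ge0// => j _; rewrite exprn_ge0.
- by move=> n; rewrite big_ord_recr lerDl /= exprn_ge0.
have main L M : (N <= L)%N -> (L <= M)%N ->
    `|\sum_(k < M) V k (x k) - \sum_(k < L) V k (x k)| < d.
  move=> NL LM; rewrite -!(big_mkord xpredT (fun k => V k (x k))).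
  rewrite (big_cat_nat (leq0n L) LM)//= addrAC subrr add0r.
  rewrite -(@ltr_pXn2r _ 2) ?nnegrE ?(ltW d0)// isometries_norm//.
  have := hN L M NL LM.
  by rewrite -!(big_mkord xpredT (fun k => `|x k| ^+ 2)) (big_cat_nat (leq0n L) LM)//= addrAC subrr add0r.
exists N => m n Nm Nn; have [mn|/ltnW nm] := leqP m n; last exact: main.
by rewrite distrC; exact: main.
Qed.

Lemma isometries_bessel V x K : isometries V -> \sum_(k < K) `|adj (V k) x| ^+ 2 <= `|x| ^+ 2.
Proof.
move=> VV; pose y := \sum_(k < K) V k (adj (V k) x).
have yy : `|y| ^+ 2 = \sum_(k < K) `|adj (V k) x| ^+ 2.
  have := isometries_norm (fun k => adj (V k) x) 0 K VV.
  by rewrite !big_mkord.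
have xy : ip x y = `|y| ^+ 2.
  rewrite yy ip_sumr; apply: eq_bigr => k _; rewrite adjPr ip_sq//.
have := exprn_ge0 2 (normr_ge0 (x - y)).
rewrite norm_sqB xy conj_Creal ?realX ?normr_real// !ip_sq -yy.
rewrite (_ : _ - (_ + _) + _ = `|x| ^+ 2 - `|y| ^+ 2); last by ring.
by rewrite subr_ge0.
Qed.

(** [u] is the strong sum of the [W k * adj (V k)]: Bessel makes the partial sums contractions and
    square summability makes them converge. *)
Lemma isometries_transfer V W : isometries V -> isometries W ->
  exists2 u : bop H, (forall x, \sum_(k < K) W k (adj (V k) x) @[K --> \oo] --> u x) &
    forall k, u * V k = W k.
Proof.
move=> VV WW.
pose A K : bop H := \sum_(k < K) W k * adj (V k).
have AE K x : A K x = \sum_(k < K) W k (adj (V k) x) by rewrite /A bop_sumE.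
have [||u Au _] := @bop_lim R H A 1.
- move=> K x; rewrite mul1r; apply: sq_le => //.
  have := isometries_norm (fun k => adj (V k) x) 0 K WW.
  by rewrite !big_mkord AE => ->; exact: isometries_bessel.
- move=> x; have [y Ay] := @isometries_sum_cvg W (fun k => adj (V k) x) _ WW (fun K => isometries_bessel x K VV).
  by exists y; apply: cvg_seq_eq Ay.
exists u => [x|k]; first by apply: cvg_seq_eq (Au x) => //.
apply: bop_eq => x; apply: cvg_seq_unique (Au _) _.
apply/cvg_seqP => d d0; exists k.+1 => n kn.
rewrite AE (bigD1 (Ordinal kn))//= big1 ?addr0 => [|j jk].
  by rewrite -[adj _ _]bop_mulE VV eqxx scale1r bop_oneE subrr normr0.
rewrite -[adj _ _]bop_mulE VV; have -> : (nat_of_ord j == k) = false.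
  by apply: contraNF jk => /eqP jk; apply/eqP/val_inj.
by rewrite scale0r bop_zeroE bop0.
Qed.

Definition total V : Prop := forall x, \sum_(k < K) V k (adj (V k) x) @[K --> \oo] --> x.

Lemma total_eq V (A B : bop H) : total V -> (forall k, A * V k = B * V k) -> A = B.
Proof.
move=> tV AB; apply: bop_eq => x.
apply: cvg_seq_unique (bop_cvg (A := A) (tV x)) _.
apply: cvg_seq_eq (bop_cvg (A := B) (tV x)) => // n.
by rewrite !bop_sum; apply: eq_bigr => k _; rewrite -!bop_mulE AB.
Qed.

(** The transfers from [V] to [W] and back are adjoint to each other term by term, so it suffices
    that they are mutually inverse, which is tested on the total families. *)
Lemma unitary_transfer V W : isometries V -> isometries W -> total V -> total W ->
  exists u : bop H, [/\ unitary_op u, forall k, u * V k = W k &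
    forall x, \sum_(k < K) W k (adj (V k) x) @[K --> \oo] --> u x].
Proof.
move=> VV WW tV tW.
have [u uE uV] := isometries_transfer VV WW.
have [v vE vW] := isometries_transfer WW VV.
exists u; split=> //.
have -> : unitary_op u = (v * u = 1 /\ u * v = 1).
  rewrite /unitary_op; suff -> : adj u = v by [].
  apply: adj_uniq => x y; apply: cvg_seq_unique (cvg_ipl y (uE x)) _.
  apply: cvg_seq_eq (cvg_ipr x (vE y)) => // n.
  by rewrite ip_suml ip_sumr; apply: eq_bigr => k _; rewrite !adjP adjK.
split; [apply: (total_eq tV)|apply: (total_eq tW)] => k.
  by rewrite -mulrA uV vW mul1r.
by rewrite -mulrA vW uV mul1r.
Qed.

End isometry_families.

Section one_endomorphism.
Context {R : realType} {H : hilbertType R}.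
Variable e : nat -> H.
Hypothesis e_onb : onb e.
Variable alpha : bop H -> bop H.
Hypothesis alpha_lin : linear alpha.
Hypothesis alpha_mul : forall A B, alpha (A * B) = alpha A * alpha B.
Hypothesis alpha_adj : forall A, alpha (adj A) = adj (alpha A).

Let alpha0 : alpha 0 = 0.
Proof.
have := alpha_lin 1 0 0; rewrite scaler0 addr0 scale1r => h.
by apply: (addrI (alpha 0)); rewrite -h addr0.
Qed.
Let alphaZ a A : alpha (a *: A) = a *: alpha A.
Proof. by rewrite -[a *: A]addr0 alpha_lin alpha0 addr0. Qed.
Let alphaD A B : alpha (A + B) = alpha A + alpha B.
Proof. by have := alpha_lin 1 A B; rewrite !scale1r. Qed.

Lemma e_norm1 k : ip (e k) (e k) = 1.
Proof. by have [_ -> _] := e_onb; rewrite eqxx. Qed.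

Definition corner : bop H := alpha (rank1 (e 0%N) (e 0%N)).

(** [alpha] carries the product of rank one operators to [ip x y] times [corner]. The boundedness of
    [inter z] and the scalar products of intertwiners both come from this identity. *)
Lemma inter_sq x y z w :
  ip (alpha (rank1 x (e 0%N)) z) (alpha (rank1 y (e 0%N)) w) = ip x y * ip (corner z) w.
Proof.
rewrite [LHS]adjPr -alpha_adj -[alpha _ (alpha _ _)]bop_mulE -alpha_mul.
by rewrite adj_rank1 rank1_rank1 alphaZ bop_scaleE ipZl.
Qed.

Fact inter_linear (z : H) a x y :
  alpha (rank1 (a *: x + y) (e 0%N)) z =
  a *: alpha (rank1 x (e 0%N)) z + alpha (rank1 y (e 0%N)) z.
Proof. by rewrite rank1D alpha_lin. Qed.

Fact inter_bounded (z : H) :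
  exists M : cplx R, forall x, `|alpha (rank1 x (e 0%N)) z| <= M * `|x|.
Proof.
exists `|alpha (rank1 (e 0%N) (e 0%N)) z| => x; apply: sq_le; rewrite ?mulr_ge0// exprMn -!ip_sq.
by rewrite !inter_sq e_norm1 mul1r mulrC.
Qed.

(* The intertwiners are determined by their value at the first basis vector,
   which ranges over the range of the projection [corner]. *)
Definition inter (z : H) : bop H := bop_mk (inter_linear z) (inter_bounded z).

Lemma interE z x : inter z x = alpha (rank1 x (e 0%N)) z. Proof. by []. Qed.

Lemma inter_intertwiner z : intertwiner alpha (inter z).
Proof.
move=> A; apply: bop_eq => x; rewrite !bop_mulE !interE -[LHS]bop_mulE -alpha_mul.
by rewrite mul_rank1.
Qed.

Lemma corner_proj : corner * corner = corner.
Proof. by rewrite /corner -alpha_mul rank1_rank1 e_norm1 scale1r. Qed.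

(** As [x] is [rank1 x (e 0)] applied to [e 0], the relation at this operator expresses [T x]
    through [T (e 0)]. *)
Lemma intertwiner_inter T : intertwiner alpha T -> T = inter (T (e 0%N)).
Proof.
move=> aT; apply: bop_eq => x; rewrite interE -[RHS]bop_mulE aT bop_mulE.
by rewrite rank1E e_norm1 scale1r.
Qed.

Lemma intertwiner_corner T : intertwiner alpha T -> corner (T (e 0%N)) = T (e 0%N).
Proof. by move=> aT; rewrite [in RHS](intertwiner_inter aT) interE. Qed.

Lemma intertwiner_lin a T S : intertwiner alpha T -> intertwiner alpha S ->
  intertwiner alpha (a *: T + S).
Proof.
by move=> aT aS A; rewrite mulrDr mulrDl -bop_scalerAr -bop_scalerAl aT aS.
Qed.

Lemma intertwiner0 : intertwiner alpha 0.
Proof. by move=> A; rewrite mulr0 mul0r. Qed.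

Lemma intertwiner_scalar T S : intertwiner alpha T -> intertwiner alpha S ->
  adj T * S = ip (S (e 0%N)) (T (e 0%N)) *: (1 : bop H).
Proof.
move=> aT aS; apply: bop_weak_eq => x y.
rewrite bop_scaleE ipZl bop_mulE -adjPr {1}(intertwiner_inter aT) {1}(intertwiner_inter aS).
by rewrite !interE inter_sq intertwiner_corner// mulrC.
Qed.

Lemma scalar_inj (c d : cplx R) : c *: (1 : bop H) = d *: (1 : bop H) -> c = d.
Proof.
move=> /(congr1 (fun A : bop H => ip (A (e 0%N)) (e 0%N))).
by rewrite !bop_scaleE !ipZl !bop_oneE e_norm1 !mulr1.
Qed.

Lemma fiber_ip_scalar T S (c : cplx R) : adj T * S = c *: (1 : bop H) -> fiber_ip T S = c.
Proof.
move=> TS; have h : adj T * S = fiber_ip T S *: (1 : bop H).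
  exact: (@getPex _ [set c : cplx R | adj T * S = c *: (1 : bop H)] (ex_intro _ c TS)).
by apply: scalar_inj; rewrite -h -TS.
Qed.

(** The arguments change places since [fiber_ip] is linear in the second one and [ip] in the
    first. *)
Lemma fiber_ipE T S : intertwiner alpha T -> intertwiner alpha S ->
  fiber_ip T S = ip (S (e 0%N)) (T (e 0%N)).
Proof. by move=> aT aS; apply: fiber_ip_scalar; exact: intertwiner_scalar. Qed.

(** Lets approximation of intertwiners be tested at the single vector [e 0]. *)
Lemma intertwiner_norm T x : intertwiner alpha T -> `|T x| = `|T (e 0%N)| * `|x|.
Proof.
move=> aT; apply/eqP; rewrite -(@eqrXn2 _ 2) ?mulr_ge0// exprMn -!ip_sq.
rewrite {1 2}(intertwiner_inter aT) !interE inter_sq intertwiner_corner//.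
by rewrite mulrC.
Qed.

Section normal.
Hypothesis alpha_normal : continuous (alpha : swop H -> swop H).
Hypothesis alpha1 : alpha 1 = 1.

Let P N : bop H := \sum_(k < N) rank1 (e k) (e k).

(** The place where normality enters. Orthogonality to all ranges means that [alpha (rank1 (e 0) y)]
    kills [x] for every [y], hence so does [alpha (P N)]. The projections [P N] converge weakly to
    1, so [alpha 1 = 1] kills [x] too. *)
Lemma intertwiner_total (x : H) :
  (forall T, intertwiner alpha T -> forall y, ip x (T y) = 0) -> x = 0.
Proof.
move=> xT; have [_ _ ed] := e_onb; have e01 := onb_ortho01 e_onb.
have ax y : alpha (rank1 (e 0%N) y) x = 0.
  apply: ip_inj => z; rewrite ip0l adjP -alpha_adj adj_rank1.
  by rewrite -interE xT//; exact: inter_intertwiner.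
have aP N : alpha (P N) x = 0.
  rewrite /P (big_morph alpha alphaD alpha0) bop_sumE big1// => k _.
  have -> : rank1 (e k) (e k) = rank1 (e k) (e 0%N) * rank1 (e 0%N) (e k).
    by rewrite rank1_rank1 e_norm1 scale1r.
  by rewrite alpha_mul bop_mulE ax bop0.
have PE N y : P N y = proj ip e N y.
  by rewrite /P bop_sumE.
have PM N y : `|P N y| <= 1 * `|y|.
  rewrite mul1r; apply: sq_le => //; rewrite PE -!ip_sq (psd_proj ip_psd e01).
  exact: (bessel ip_psd e01).
have Pw y z : ip (P N y) z @[N --> \oo] --> ip ((1 : bop H) y) z.
  by apply: cvg_seq_eq (cvg_ipl z (proj_cvg e01 ed y)) => // N; rewrite PE.
have h0 (a b : H) : ip (alpha (P j) a) b @[j --> \oo] --> ip (alpha 1 a) b.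
  exact: (normal_seq e_onb e_onb alpha_normal PM Pw).
have h := h0 x x; rewrite alpha1 bop_oneE in h; apply: ip_eq0; apply: cvg_seq_unique h _.
by apply: (@cvg_seq_eq _ (cplx R) (fun=> 0) 0) => // [N|]; [rewrite aP ip0l|exact: cvg_cst].
Qed.

(** What the [V k] miss of a vector is orthogonal to their ranges, hence by approximation to the
    range of every intertwiner, and [intertwiner_total] applies. *)
Lemma intertwiner_basis_total (V : nat -> bop H) : isometries V ->
  (forall k, intertwiner alpha (V k)) ->
  (forall T, intertwiner alpha T -> forall d : cplx R, 0 < d ->
     exists2 S, Defs.span (range V) S & `|(T - S) (e 0%N)| < d) ->
  total V.
Proof.
move=> VV aV Vd.
(* Transferring a family to itself yields the strong sum of the [V k * adj (V k)], the projection
   onto the closed span of the ranges. *)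
have [q qE qV] := isometries_transfer VV VV.
suff q1 : forall x, x - q x = 0.
  by move=> x; apply: cvg_seq_eq (qE x) => //; apply/eqP; rewrite -subr_eq0 q1.
move=> x; apply: intertwiner_total => T aT y; set r := x - q x.
have rV k z : ip r (V k z) = 0.
  rewrite ipBl; apply/eqP; rewrite subr_eq0; apply/eqP.
  apply: cvg_seq_unique _ (cvg_ipl (V k z) (qE x)).
  apply/cvg_seqP => d d0; exists k.+1 => n kn.
  rewrite ip_suml (bigD1 (Ordinal kn))//= big1 ?addr0 => [|j jk].
    by rewrite (isometries_ip VV) eqxx mul1r -adjPr subrr normr0.
  rewrite (isometries_ip VV) (_ : (k == j) = false) ?mul0r//.
  by apply: contraNF jk => /eqP jk; apply/eqP/val_inj.
have rS S : Defs.span (range V) S -> ip r (S y) = 0.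
  move: S; apply: (@span_ind R (bop H) (range V) [set S | ip r (S y) = 0]) => /=.
  - exact: ip0r.
  - move=> a A B Ay By; rewrite -[LHS]/(ip r (a *: (A : bop H) y + (B : bop H) y)).
    by rewrite ipDr ipZr Ay By mulr0 addr0.
  - by move=> _ [k _ <-].
have iS S : Defs.span (range V) S -> intertwiner alpha S.
  move: S; apply: (@span_ind R (bop H) (range V) [set S | intertwiner alpha S]) => /=.
  - exact: intertwiner0.
  - by move=> a A B; exact: intertwiner_lin.
  - by move=> _ [k _ <-]; exact: aV.
apply/eqP; rewrite -normr_eq0 eq_le normr_ge0 andbT; apply/ler_addgt0Pr => d d0.
rewrite add0r; have M0 : 0 < `|r| * `|y| + 1 by rewrite ltr_wpDl ?mulr_ge0.
have [S sS TS] := Vd T aT (d / (`|r| * `|y| + 1)) (divr_gt0 d0 M0).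
have -> : ip r (T y) = ip r ((T - S) y) by rewrite bop_addE bop_oppE ipDr ipNr (rS _ sS) oppr0 addr0.
apply: le_trans (ip_CS _ _) _.
rewrite (@intertwiner_norm (T - S)); last first.
  by rewrite addrC -scaleN1r; apply: intertwiner_lin => //; exact: iS.
rewrite mulrCA mulrC; move: TS; rewrite ltr_pdivlMr// => /ltW; apply: le_trans.
by rewrite mulrC ler_wpM2l// lerDl.
Qed.

End normal.
End one_endomorphism.

Section intertwiner_space.
Context {R : realType} {H : hilbertType R}.
Variable e : nat -> H.
Hypothesis e_onb : onb e.
Variable alpha : bop H -> bop H.
Hypothesis alpha_lin : linear alpha.
Hypothesis alpha_mul : forall A B, alpha (A * B) = alpha A * alpha B.
Hypothesis alpha_adj : forall A, alpha (adj A) = adj (alpha A).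

Let p := corner e alpha.
Let J (z : H) : bop H := inter e_onb alpha_lin alpha_mul alpha_adj z.

Let JE z : J z (e 0%N) = p z. Proof. by []. Qed.
Let J_int z : intertwiner alpha (J z). Proof. exact: inter_intertwiner. Qed.
Let pp z : p (p z) = p z.
Proof. by rewrite -[LHS]bop_mulE /p corner_proj. Qed.

Lemma intertwiner_sub T S : intertwiner alpha T -> intertwiner alpha S ->
  intertwiner alpha (T - S).
Proof.
by move=> aT aS; rewrite addrC -scaleN1r; apply: intertwiner_lin.
Qed.

Lemma fiber_ip_sq T : intertwiner alpha T -> fiber_ip T T = `|T (e 0%N)| ^+ 2.
Proof. by move=> aT; rewrite (fiber_ipE e_onb alpha_lin alpha_mul alpha_adj aT aT) ip_sq. Qed.

Lemma intertwiner_eq0 T : intertwiner alpha T -> T (e 0%N) = 0 -> T = 0.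
Proof.
move=> aT T0; rewrite (intertwiner_inter e_onb alpha_lin alpha_mul alpha_adj aT) T0.
by apply: bop_eq => x; rewrite interE bop0.
Qed.

(** Evaluation at [e 0] identifies the fibre isometrically with the range of [corner], where
    completeness is inherited from [H] because [corner] is continuous. *)
Lemma intertwiner_hilbert : hilbert_on (@fiber_ip R H) [set T | intertwiner alpha T].
Proof.
have fE := fiber_ipE e_onb alpha_lin alpha_mul alpha_adj.
split=> /=.
- move=> u v w a au av aw; rewrite !fE ?bop_addE ?bop_scaleE ?ipDl ?ipZl//.
  exact: intertwiner_lin.
- by move=> u v au av; rewrite !fE// ipC.
- move=> u au u0; rewrite fiber_ip_sq// exprn_gt0// normr_gt0.
  by apply: contraNneq u0 => u00; rewrite (intertwiner_eq0 au u00).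
move=> s as_ sC.
have [z sz] : exists z : H, s k (e 0%N) @[k --> \oo] --> z.
  apply: cauchy_seq_cvg => d d0.
  have [[A B] /= [[N1 _ AN] [N2 _ BN]] AB] := sC (d ^+ 2) (exprn_gt0 2 d0).
  exists (maxn N1 N2) => m n; rewrite !geq_max => /andP[m1 _] /andP[_ n2].
  have := AB (m, n) (conj (AN m m1) (BN n n2)).
  rewrite /= fiber_ip_sq; last exact: intertwiner_sub.
  by move=> h; rewrite -(@ltr_pXn2r _ 2) ?nnegrE// ltW.
have pz : p z = z.
  apply: cvg_seq_unique (bop_cvg (A := p) sz) _; apply: cvg_seq_eq sz => // n.
  by rewrite /p (intertwiner_corner e_onb alpha_lin alpha_mul alpha_adj (as_ n)).
exists (J z); first exact: J_int.
apply: cvg_seq_eq (cvg_norm_sq sz) => // n.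
rewrite fiber_ip_sq; last by apply: intertwiner_sub => //; exact: J_int.
by rewrite bop_addE bop_oppE JE pz.
Qed.

Definition gvec : nat -> H := gs ip (fun m => corner e alpha (e m)).

Lemma gvec_ortho01 : ortho01 ip gvec. Proof. exact: gs_ortho01 ip_psd _. Qed.

Lemma gvec_corner k : corner e alpha (gvec k) = gvec k.
Proof.
apply: (@gs_ind _ _ ip (fun m => p (e m)) [set v | p v = v]) => /=.
- exact: bop0.
- by move=> a x y px py; rewrite bop_lin px py.
- by move=> j; exact: pp.
Qed.

(** [corner] is bounded and fixes [z], so images under it of combinations of the [e m] approximate
    [z], and these have null residual from some rank on. *)
Lemma gvec_cvg z : p z = z -> proj ip gvec N z @[N --> \oo] --> z.
Proof.
move=> pz; have [_ _ ed] := e_onb; have e01 := onb_ortho01 e_onb.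
have [M M0 pM] := bop_bound p.
apply: cvg_sq0; apply/cvg_seqP => d d0.
have sd : 0 < sqrtC d / M by rewrite divr_gt0// sqrtC_gt0.
have [w sw zw] := onb_dense e_onb z sd.
have [N wN] : exists N, null_resid ip gvec N (p w).
  move: w sw {zw}; apply: (@span_ind R H (range e) [set w | exists N, null_resid ip gvec N (p w)]).
  - by exists 0%N; rewrite /null_resid /proj big_ord0 subr0 bop0 ip0l.
  - move=> a x y [N xN] [L yL]; exists (maxn N L); rewrite bop_lin.
    apply: null_residD => //; [exact: ip_psd|exact: gvec_ortho01| |].
      exact: (null_residS ip_psd gvec_ortho01 (leq_maxl N L)).
    exact: (null_residS ip_psd gvec_ortho01 (leq_maxr N L)).
  - by move=> _ [j _ <-]; exists j.+1; exact: gs_null ip_psd (fun m => p (e m)) j.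
exists N => n Nn; rewrite subr0 distrC ger0_norm ?exprn_ge0// -ip_sq.
apply: (@le_lt_trans _ _ (ip (z - p w) (z - p w))).
  apply: (proj_best ip_psd gvec_ortho01).
  exact: (null_residS ip_psd gvec_ortho01 Nn wN).
rewrite ip_sq -{1}pz -bopB -[ltRHS]sqrtCK ltr_pXn2r ?nnegrE ?sqrtC_ge0 ?(ltW d0)//.
by apply: le_lt_trans (pM _) _; rewrite mulrC -ltr_pdivlMr.
Qed.

(** If [gvec] vanished from [M] on, [M + 1] orthonormal vectors would lie in the span of [M] others.
    Summing the squared coefficients along rows and along columns gives [M + 1 <= M]. *)
Lemma gvec_infinite :
  (forall m, exists v : nat -> bop H, (forall i, (i < m)%N -> intertwiner alpha (v i)) /\
     forall i j, (i < m)%N -> (j < m)%N -> adj (v i) * v j = (i == j)%:R *: (1 : bop H)) ->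
  forall M, exists2 m, (M <= m)%N & gvec m != 0.
Proof.
move=> large M; apply: contrapT => noM.
have g0 m : (M <= m)%N -> gvec m = 0.
  by move=> Mm; apply/eqP/negPn/negP => um; apply: noM; exists m.
have [v [vE vv]] := large M.+1.
(* Padding by zeros makes the finite family an instance of [ortho01], so that Bessel applies to
   it. *)
pose w i := if (i < M.+1)%N then v i (e 0%N) else 0.
have wip i j : (i < M.+1)%N -> (j < M.+1)%N -> ip (w i) (w j) = (i == j)%:R.
  move=> iM jM; rewrite /w iM jM adjPr -[adj _ _]bop_mulE vv// bop_scaleE ipZl.
  by rewrite (e_norm1 e_onb) mulr1 eq_sym.
have w01 : ortho01 ip w.
  split=> [i j ij|i].
    have [iM|iM] := ltnP i M.+1; last by rewrite /w ltnNge iM /= ip0l.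
    have [jM|jM] := ltnP j M.+1; last by rewrite [w j]/w ltnNge jM /= ip0r.
    by rewrite wip// (negbTE ij).
  have [iM|iM] := ltnP i M.+1; first by left; rewrite wip// eqxx.
  by right; rewrite /w ltnNge iM.
have pw i : p (w i) = w i.
  rewrite /w; case: ifP => iM; last exact: bop0.
  exact: (intertwiner_corner e_onb alpha_lin alpha_mul alpha_adj (vE i iM)).
have projM i : proj ip gvec M (w i) = w i.
  apply: cvg_seq_unique _ (gvec_cvg (pw i)).
  apply/cvg_seqP => d d0; exists M => n Mn.
  rewrite /proj -(subnKC Mn) big_split_ord /= addrAC subrr add0r big1 ?normr0//.
  by move=> j _; rewrite g0 ?scaler0// leq_addr.
have : (M.+1%:R : cplx R) <= M%:R.
  apply: (@le_trans _ _ (\sum_(i < M.+1) \sum_(j < M) `|ip (w i) (gvec j)| ^+ 2)).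
    rewrite -[leLHS](_ : \sum_(i < M.+1) ip (w i) (w i) = _); last first.
      under eq_bigr do rewrite wip ?eqxx//.
      by rewrite sumr_const card_ord.
    apply: ler_sum => i _.
    by rewrite -(psd_proj ip_psd gvec_ortho01) projM.
  rewrite exchange_big /= -[leRHS](_ : \sum_(j < M) (1 : cplx R) = _); last first.
    by rewrite sumr_const card_ord.
  apply: ler_sum => j _.
  apply: (@le_trans _ _ (ip (gvec j) (gvec j))); last first.
    by case: (proj2 gvec_ortho01 j) => ->; rewrite ?ip0l.
  apply: le_trans (bessel ip_psd w01 (gvec j) M.+1).
  by apply: ler_sum => i _; rewrite ipC norm_conjC.
by rewrite ler_nat ltnn.
Qed.

Section infinite.
Hypothesis gvec_inf : forall M, exists2 m, (M <= m)%N & gvec m != 0.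

(** The zeros of [gvec] are skipped by [sel], since a basis of a fibre must consist of unit
    vectors. *)
Definition basis_vec (k : nat) : H := gvec (sel (fun m => gvec m != 0) k).
Definition ibasis (k : nat) : bop H := inter e_onb alpha_lin alpha_mul alpha_adj (basis_vec k).

Lemma ibasis_intertwiner k : intertwiner alpha (ibasis k). Proof. exact: J_int. Qed.

Lemma ibasis_e0 k : ibasis k (e 0%N) = basis_vec k.
Proof. exact: gvec_corner. Qed.

Lemma ibasis_isometries : isometries ibasis.
Proof.
move=> j k.
rewrite (intertwiner_scalar e_onb alpha_lin alpha_mul alpha_adj (ibasis_intertwiner j) (ibasis_intertwiner k)).
by rewrite !ibasis_e0 (sel_orthonormal gvec_ortho01 gvec_inf) eq_sym.
Qed.

Lemma ibasis_approx T (d : cplx R) : intertwiner alpha T -> 0 < d ->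
  exists2 S, Defs.span (range ibasis) S & `|(T - S) (e 0%N)| < d.
Proof.
move=> aT d0; set z := T (e 0%N).
have pz : p z = z := intertwiner_corner e_onb alpha_lin alpha_mul alpha_adj aT.
have /cvg_seqP/(_ d d0)[N hN] := gvec_cvg pz.
exists (\sum_(j < N) ip z (gvec j) *: J (gvec j)).
  apply: (big_ind (Defs.span (range ibasis))) => [|S S' hS hS'|j _]; first exact: span0.
    by rewrite -[S]scale1r; exact: spanD.
  rewrite -[X in Defs.span _ X]addr0; apply: spanD; last exact: span0.
  have [->|gj] := eqVneq (gvec j) 0.
    rewrite (_ : J 0 = 0); first exact: span0.
    by apply: bop_eq => x; rewrite /J interE bop0.
  have [k km] := @sel_surj (fun m => gvec m != 0) _ gj.
  by apply: span_in; exists k => //; rewrite /ibasis /basis_vec km.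
have := hN N (leqnn N); rewrite distrC bop_addE bop_oppE bop_sumE.
congr (`|_ - _| < d); apply: eq_bigr => j _.
by rewrite bop_scaleE JE gvec_corner.
Qed.

Lemma ibasis_onb : orthonormal_basis (@fiber_ip R H) [set T | intertwiner alpha T] ibasis.
Proof.
have iS S : Defs.span (range ibasis) S -> intertwiner alpha S.
  move: S; apply: (@span_ind R (bop H) (range ibasis) [set S | intertwiner alpha S]) => /=.
  - exact: intertwiner0.
  - by move=> a A B; exact: intertwiner_lin.
  - by move=> _ [k _ <-]; exact: ibasis_intertwiner.
split.
- exact: ibasis_intertwiner.
- by move=> j k; apply: (fiber_ip_scalar e_onb); exact: ibasis_isometries.
split=> [S /iS//|T aT d d0].
have sd : 0 < sqrtC d by rewrite sqrtC_gt0.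
have [S sS TS] := ibasis_approx aT sd; exists S => //.
rewrite fiber_ip_sq; last by apply: intertwiner_sub => //; exact: iS.
by rewrite -[ltRHS]sqrtCK ltr_pXn2r ?nnegrE// ltW.
Qed.

Lemma ibasis_total : continuous (alpha : swop H -> swop H) -> alpha 1 = 1 -> total ibasis.
Proof.
move=> ac a1; apply: (intertwiner_basis_total e_onb alpha_lin alpha_mul alpha_adj ac a1).
- exact: ibasis_isometries.
- exact: ibasis_intertwiner.
- by move=> T aT d d0; exact: ibasis_approx.
Qed.

End infinite.

(** If the fibre were the line of one isometry [V], totality of the ranges would make [V] unitary
    and [alpha] the conjugation by [V], which is onto. *)
Lemma not_onto_pair : continuous (alpha : swop H -> swop H) -> alpha 1 = 1 ->
  ~ (forall B, exists A, alpha A = B) ->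
  exists V W, [/\ intertwiner alpha V, intertwiner alpha W, adj V * V = 1, adj W * W = 1 &
    adj V * W = 0].
Proof.
move=> ac a1 nonto.
have sc T S : intertwiner alpha T -> intertwiner alpha S -> adj T * S = _ := 
  intertwiner_scalar e_onb alpha_lin alpha_mul alpha_adj (T := T) (S := S).
have tot := intertwiner_total e_onb alpha_lin alpha_mul alpha_adj ac a1.
have unitize T : intertwiner alpha T -> T != 0 ->
    exists2 c : cplx R, c != 0 & adj (c *: T) * (c *: T) = 1.
  move=> aT T0; have T00 : `|T (e 0%N)| != 0.
    rewrite normr_eq0; apply: contraNneq T0 => T00.
    by rewrite (intertwiner_eq0 aT T00).
  exists `|T (e 0%N)|^-1; first by rewrite invr_eq0.
  rewrite adjZ -bop_scalerAl -bop_scalerAr sc// scalerA ip_sq scalerA.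
  rewrite conj_Creal ?realV ?normr_real// -invfM -expr2 mulVf ?scale1r//.
  by rewrite expf_neq0.
have aZ c T : intertwiner alpha T -> intertwiner alpha (c *: T).
  move=> aT; rewrite -[c *: T]addr0; apply: intertwiner_lin => //; exact: intertwiner0.
have [T aT T0] : exists2 T, intertwiner alpha T & T != 0.
  apply: contrapT => noT; have := e_norm1 e_onb 0%N.
  rewrite (tot (e 0%N)) ?ip0l => [/eqP|T aT y]; first by rewrite eq_sym oner_eq0.
  have [->|T0] := eqVneq T 0; first exact: ip0r.
  by case: noT; exists T.
have [c c0 cT] := unitize T aT T0.
set V := c *: T in cT; have aV : intertwiner alpha V by exact: aZ.
(* Removing from [S] its component along [V] and normalizing gives the second isometry. *)
suff [S aS S0] : exists2 S, intertwiner alpha S & S - ip (S (e 0%N)) (V (e 0%N)) *: V != 0.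
  set W := S - _ in S0; have aW : intertwiner alpha W.
    by apply: intertwiner_sub => //; exact: aZ.
  have [b b0 bW] := unitize W aW S0.
  exists V, (b *: W); split=> //; first exact: aZ.
  rewrite -bop_scalerAr /W mulrBr -bop_scalerAr cT sc// subrr.
  exact: scaler0.
apply: contrapT => noS; apply: nonto => B.
have SV S : intertwiner alpha S -> S = ip (S (e 0%N)) (V (e 0%N)) *: V.
  move=> aS; apply/eqP; rewrite -subr_eq0; apply/negPn/negP => S0.
  by apply: noS; exists S.
have VV : V * adj V = 1.
  apply: bop_eq => x; apply/eqP; rewrite -subr_eq0; apply/eqP.
  rewrite -oppr0 -[LHS]opprK; congr (- _); rewrite opprB.
  apply: tot => S aS y; rewrite (SV S aS) bop_scaleE ipZr ipBl bop_mulE bop_oneE.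
  rewrite [ip (V _) _]adjP -[adj V (V y)]bop_mulE cT bop_oneE.
  by rewrite [ip x (V y)]adjPr subrr mulr0.
(* With [V] unitary the intertwining relation reads [alpha A = V * A * adj V]; this is the solution
   for the value [B]. *)
exists (adj V * B * V).
rewrite -[LHS]mulr1 -VV mulrA aV !mulrA VV mul1r -mulrA VV mulr1//.
Qed.

End intertwiner_space.

(** * Product systems of E0-semigroups *)

Section cone.
Context {R : realType} {n : nat}.
Variable P : set 'rV[R]_n.+1.
Hypothesis P_cone : closed_convex_cone P.
Hypothesis P_spanning : spanning P.

Lemma cone_add x y : P x -> P y -> P (x + y).
Proof.
move=> Px Py.
have h0 : (0 : R) <= 2^-1 by rewrite invr_ge0.
have h1 : (2^-1 : R) <= 1 by rewrite invf_le1 ?ler1n.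
have := cone_convex P_cone (Itv01 h0 h1) (mem_set Px) (mem_set Py).
rewrite inE => Pm; have := cone_scale P_cone (ler0n R 2) Pm.
congr P; transitivity (2 *: (2^-1 *: x + (1 - 2^-1) *: y)) => //.
rewrite scalerDr !scalerA mulfV// scale1r.
by rewrite (_ : 2 * (1 - 2^-1) = 1) ?scale1r//; field.
Qed.

Lemma cone0 : P 0.
Proof.
have [x Px [y Py _]] : [set x - y | x in P & y in P] 0 by rewrite P_spanning.
by rewrite -(scale0r x); exact: (cone_scale P_cone (lexx 0) Px).
Qed.

Lemma interior_rVP (x : 'rV[R]_n.+1) :
  P° x <-> exists2 r : R, 0 < r & forall y, `|y - x| < r -> P y.
Proof.
split.
  move=> /nbhs_normP[r r0 Pr]; exists r => // y xy; apply: Pr.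
  by rewrite /ball_ /= distrC.
move=> [r r0 Pr]; suff : nbhs x P by []; apply: (iffRL (nbhs_normP x P)); exists r => // y xy; apply: Pr.
by rewrite distrC.
Qed.

Lemma interior_scale (t : R) x : 0 < t -> P° x -> P° (t *: x).
Proof.
move=> t0 /interior_rVP[r r0 Pr]; apply/interior_rVP; exists (t * r); first exact: mulr_gt0.
move=> y yx; rewrite -(scale1r y) -(mulfV (lt0r_neq0 t0)) -scalerA.
apply: (cone_scale P_cone (ltW t0)); apply: Pr.
have -> : t^-1 *: y - x = t^-1 *: (y - t *: x).
  by rewrite scalerBr scalerA mulVf ?scale1r// gt_eqF.
by rewrite normrZ gtr0_norm ?invr_gt0// mulrC ltr_pdivrMr// mulrC.
Qed.

Lemma interior_add x y : P x -> P° y -> P° (x + y).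
Proof.
move=> Px /interior_rVP[r r0 Pr]; apply/interior_rVP; exists r => // z zx.
rewrite -(subrK x z) addrC; apply: cone_add => //; apply: Pr.
by rewrite -addrA -opprD.
Qed.

(** Each coordinate vector is some [p j - q j] with both terms in [P]. If [y] differs from [w], the
    sum of the [p j + q j], by coordinates c_j less than 1 in absolute value, then [y] is the sum of
    the (1 + c_j) p_j + (1 - c_j) q_j, with nonnegative coefficients. *)
Lemma interior_nonempty : exists w, P° w.
Proof.
have ex (j : 'I_n.+1) : exists pq, [/\ P pq.1, P pq.2 & pq.1 - pq.2 = delta_mx 0 j :> 'rV[R]_n.+1].
  have : [set x - y | x in P & y in P] (delta_mx 0 j) by rewrite P_spanning.
  by move=> [p Pp [q Pq pq]]; exists (p, q).
pose p j := (sval (cid (ex j))).1; pose q j := (sval (cid (ex j))).2.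
have Pp j : P (p j) by have [] := svalP (cid (ex j)).
have Pq j : P (q j) by have [] := svalP (cid (ex j)).
have pq j : p j - q j = delta_mx 0 j by have [] := svalP (cid (ex j)).
pose w := \sum_j (p j + q j).
exists w; apply/interior_rVP; exists 1 => // y yw.
have zj j : `|(y - w) 0 j| < 1.
  apply: le_lt_trans yw; rewrite [leRHS]/Num.norm /= mx_normrE.
  exact: (le_bigmax _ (fun i : 'I_1 * 'I_n.+1 => `|(y - w) i.1 i.2|) (0, j)).
have -> : y = \sum_j ((1 + (y - w) 0 j) *: p j + (1 - (y - w) 0 j) *: q j).
  rewrite -{1}(subrK w y) addrC {1}(row_sum_delta (y - w)) /w -big_split /=.
  apply: eq_bigr => j _; rewrite -pq !scalerDl !scale1r scalerBr scaleNr.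
  by rewrite addrACA.
apply: (big_ind P) => [||j _]; [exact: cone0|exact: cone_add|].
by have := zj j; rewrite ltr_norml => /andP[l1 l2];
  apply: cone_add; apply: (cone_scale P_cone) => //; rewrite ?subr_ge0 -?lerBlDl ?sub0r ltW.
Qed.

Lemma interior_half x : P° x -> exists2 y, P° y & y + y = x.
Proof.
move=> Px; exists (2^-1 *: x); first by apply: interior_scale => //; rewrite invr_gt0.
rewrite -scalerDl (_ : 2^-1 + 2^-1 = 1) ?scale1r//; by field.
Qed.

End cone.

Section measurable_pieces.
Context {R : realType} {d : measure_display} {T : measurableType d}.
Variable D : set T.
Hypothesis mD : measurable D.

Lemma measurable_fun_pieces (F : nat -> T -> R) (N : T -> nat) :
  (forall m, measurable_fun D (F m)) -> (forall m, measurable (D `&` [set x | N x = m])) ->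
  measurable_fun D (fun x => F (N x) x).
Proof.
move=> mF mN _ Y mY.
rewrite (_ : _ `&` _ = \bigcup_m ((D `&` [set x | N x = m]) `&` (D `&` F m @^-1` Y))).
  apply: bigcupT_measurable => m; apply: measurableI => //; exact: mF.
apply/seteqP; split=> [x [Dx Yx]|x [m _ [[Dx /= Nm] [_ Yx]]]].
  by exists (N x).
by split=> //=; rewrite Nm.
Qed.

Lemma cmeas_pieces (F : nat -> T -> cplx R) (N : T -> nat) :
  (forall m, cmeas D (F m)) -> (forall m, measurable (D `&` [set x | N x = m])) ->
  cmeas D (fun x => F (N x) x).
Proof.
move=> mF mN; split.
  by apply: (@measurable_fun_pieces (fun m x => re (F m x))) => // m; case: (mF m).
by apply: (@measurable_fun_pieces (fun m x => im (F m x))) => // m; case: (mF m).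
Qed.

(** The event is decided by [p x m] and by the number of true values below [m]; the counts are
    measurable by induction on the length of the range. *)
Lemma measurable_sel (p : T -> pred nat) :
  (forall m, measurable (D `&` [set x | p x m])) ->
  (forall x, D x -> forall M, exists2 m, (M <= m)%N & p x m) ->
  forall k m, measurable (D `&` [set x | sel (p x) k = m]).
Proof.
move=> mp pinf k m.
have mnp j : measurable (D `&` [set x | ~ p x j]).
  rewrite (_ : _ `&` _ = D `\` (D `&` [set x | p x j])); first exact: measurableD.
  apply/seteqP; split=> [x [Dx px]|x [Dx px]]; first by split=> // -[].
  by split=> // pxj; apply: px.
have mc j l : measurable (D `&` [set x | count (p x) (iota 0 j) = l]).
  elim: j l => [|j IH] l.
    have [l0|l0] := eqVneq l 0%N.
      rewrite (_ : _ `&` _ = D)//; apply/seteqP; split=> [x []//|x Dx].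
      by split=> //=; rewrite l0.
    rewrite (_ : _ `&` _ = set0)//; apply/seteqP; split=> // x [_ /= h].
    by rewrite -h eqxx in l0.
  rewrite (_ : _ `&` _ = ((D `&` [set x | count (p x) (iota 0 j) = l]) `&` (D `&` [set x | ~ p x j]))
     `|` ((if l is l'.+1 then D `&` [set x | count (p x) (iota 0 j) = l'] else set0) `&` (D `&` [set x | p x j]))).
    apply: measurableU; apply: measurableI => //.
    by case: l.
  apply/seteqP; split=> [x [Dx h]|x].
    have {h} : count (p x) (iota 0 j.+1) = l by exact: h.
    rewrite countS; case: (boolP (p x j)) => pj.
      by rewrite addn1 => <-; right.
    by rewrite addn0 => cl; left; split; split=> //; exact/negP.
  move=> h; have [Dx cl] : D x /\ count (p x) (iota 0 j.+1) = l; last by [].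
  rewrite countS; case: h => [[[Dx cl] [_ /= pj]]|[+ [Dx /= pj]]].
    split=> //; have /negbTE -> : ~~ p x j by exact/negP.
    by rewrite addn0.
  case: l => [//|l'] [_ cl]; split=> //.
  have {cl} cl : count (p x) (iota 0 j) = l' by exact: cl.
  by rewrite cl pj addn1.
rewrite (_ : _ `&` _ = (D `&` [set x | p x m]) `&` (D `&` [set x | count (p x) (iota 0 m) = k])).
  exact: measurableI.
apply/seteqP; split=> [x [Dx /= <-]|x [[Dx pm] [_ cm]]].
  by have [h1 h2] := selP (pinf x Dx) k.
by split=> //=; apply: sel_eq.
Qed.

End measurable_pieces.

Section weakly_measurable.
Context {R : realType} {H : hilbertType R}.
Variable e : nat -> H.
Hypothesis e_onb : onb e.
Context {d : measure_display} {T : measurableType d}.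
Variable D : set T.

Definition wmeas (g : T -> H) : Prop := forall j, cmeas D (fun x => ip (g x) (e j)).

Lemma wmeasB g h : wmeas g -> wmeas h -> wmeas (fun x => g x - h x).
Proof.
move=> mg mh j; rewrite (_ : (fun x => _) = fun x => ip (g x) (e j) - ip (h x) (e j)).
  exact: cmeasB.
by apply/funext => x; rewrite ipBl.
Qed.

Lemma wmeasZ c g : cmeas D c -> wmeas g -> wmeas (fun x => c x *: g x).
Proof.
move=> mc mg j; rewrite (_ : (fun x => _) = fun x => c x * ip (g x) (e j)).
  exact: cmeasM.
by apply/funext => x; rewrite ipZl.
Qed.

Lemma wmeas_sum N (g : 'I_N -> T -> H) : (forall i, wmeas (g i)) ->
  wmeas (fun x => \sum_(i < N) g i x).
Proof.
move=> mg j; rewrite (_ : (fun x => _) = fun x => \sum_(i < N) ip (g i x) (e j)).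
  by apply: cmeas_sum => i; exact: mg.
by apply/funext => x; rewrite ip_suml.
Qed.

(** With null residuals sent to 0 the recursion is one formula in inner products, sums and inverse
    square roots, without case distinction on [x]. *)
Lemma wmeas_gs (s : T -> nat -> H) : (forall m, wmeas (fun x => s x m)) ->
  forall m, wmeas (fun x => gs ip (s x) m).
Proof.
move=> ms; elim/ltn_ind => m IH.
have mr : wmeas (fun x => gs_resid ip (s x) m).
  apply: wmeasB => //; apply: wmeas_sum => j; apply: wmeasZ; last exact: IH.
  by apply: (cmeas_ip e_onb); [exact: ms|exact: (IH j (ltn_ord j))].
rewrite (_ : (fun x => _) = fun x =>
  (sqrtC (ip (gs_resid ip (s x) m) (gs_resid ip (s x) m)))^-1 *: gs_resid ip (s x) m).
  apply: wmeasZ => //; apply: cmeas_invsqrt => [x _|]; first exact: psd_ge0 ip_psd _.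
  exact: (cmeas_ip e_onb).
by apply/funext => x; rewrite gsE.
Qed.

End weakly_measurable.

Section E0_semigroups.
Context {R : realType} {n : nat}.
Variable P : set 'rV[R]_n.+1.
Hypothesis P_cone : closed_convex_cone P.
Context {H : hilbertType R}.
Hypothesis H_sep : Defs.separable H.
Variable e : nat -> H.
Hypothesis e_onb : onb e.
Variable alpha : 'rV[R]_n.+1 -> bop H -> bop H.
Hypothesis alphaP : E0_semigroup P alpha.

Let Omega : set 'rV[R]_n.+1 := P°.

Lemma E0_lin x : P x -> linear (alpha x).
Proof. by move=> Px; have [] := E0_hom alphaP Px. Qed.
Lemma E0_mul x : P x -> forall A B, alpha x (A * B) = alpha x A * alpha x B.
Proof. by move=> Px; have [] := E0_hom alphaP Px. Qed.
Lemma E0_adj x : P x -> forall A, alpha x (adj A) = adj (alpha x A).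
Proof. by move=> Px; have [] := E0_hom alphaP Px. Qed.
Lemma E0_normal x : P x -> continuous (alpha x : swop H -> swop H).
Proof. by move=> Px; have [] := E0_hom alphaP Px. Qed.

Lemma Omega_measurable : measurable (Omega : set (borel_rV R n.+1)).
Proof. by apply: borel_rV_open; exact: open_interior. Qed.

Lemma E0_weak_continuous A (u v : H) :
  {within P, continuous (fun x => ip (alpha x A u) v : cplx R)}.
Proof.
rewrite (_ : (fun x => _) = fun x => predual_pairing (alpha x A) (rank1_tc u v)).
  exact: E0_continuous alphaP _ _.
by apply/funext => x; rewrite -(tr_rank1 e_onb).
Qed.

Lemma E0_cmeas A (u v : H) :
  cmeas (Omega : set (borel_rV R n.+1)) (fun x => ip (alpha x A u) v).
Proof.
apply: (@continuous_cmeas R 'rV[R]_n.+1) => [U oU|| x Px].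
- exact: borel_rV_open.
- exact: open_interior.
have /subspace_continuousP/(_ x (interior_subset Px)) := @E0_weak_continuous A u v.
by rewrite within_interior.
Qed.

Lemma product_intertwiner x y T S : P x -> P y -> intertwiner (alpha x) T ->
  intertwiner (alpha y) S -> intertwiner (alpha (x + y)) (T * S).
Proof. by move=> Px Py aT aS A; rewrite -(E0_add alphaP)// mulrA aT -!mulrA aS. Qed.

Lemma fiberE x : Omega x ->
  fiber (product_system_of P alpha) x = [set T | intertwiner (alpha x) T].
Proof.
move=> Ox; apply/seteqP; split=> [T [_ aT]//|T aT].
by split.
Qed.

Hypothesis nonto : forall x, Omega x -> ~ (forall B, exists A, alpha x A = B).

(* Products of two isometries with orthogonal ranges in the fibre at [x / 2]. *)
Lemma large_fiber m : forall x, Omega x ->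
  exists v : nat -> bop H, (forall i, (i < m)%N -> intertwiner (alpha x) (v i)) /\
     forall i j, (i < m)%N -> (j < m)%N -> adj (v i) * v j = (i == j)%:R *: (1 : bop H).
Proof.
have pair x : Omega x -> exists V W, [/\ intertwiner (alpha x) V, intertwiner (alpha x) W,
    adj V * V = 1, adj W * W = 1 & adj V * W = 0].
  move=> Ox; have Px := interior_subset Ox.
  exact: (not_onto_pair e_onb (E0_lin Px) (E0_mul Px) (E0_adj Px) (E0_normal Px)
    (E0_unital alphaP Px) (nonto Ox)).
elim: m => [|[|m] IH] x Ox; first by exists (fun=> 0).
  (* One isometry is a base case of its own, because the step needs [v 0]. *)
  have [V [W [aV _ VV _ _]]] := pair x Ox.
  by exists (fun=> V); split=> [//|[|//] [|//] _ _]; rewrite VV eqxx scale1r.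
have [y Oy <-] := interior_half P_cone Ox.
have [v [av vv]] := IH y Oy; have [V [W [aV aW VV WW VW]]] := pair y Oy.
have WV : adj W * V = 0.
  by rewrite -[LHS]adjK adjM adjK VW; apply: adj_uniq => a b; rewrite !bop_zeroE ip0l ip0r.
have Py := interior_subset Oy.
(* The last product is orthogonal to all the others, including [v 0 * V], because [V] and [W] have
   orthogonal ranges. *)
exists (fun i => if (i < m.+1)%N then v i * V else v 0%N * W); split.
  by move=> i _; case: ifP => im; apply: product_intertwiner => //; exact: av.
have prod i j (A B : bop H) : (i < m.+1)%N -> (j < m.+1)%N ->
    adj (v i * A) * (v j * B) = (i == j)%:R *: (adj A * B).
  move=> im jm; rewrite adjM -!mulrA (mulrA (adj (v i))) vv// -bop_scalerAl mul1r.
  by rewrite bop_scalerAr.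
move=> i j im jm.
have [im'|im'] := ltnP i m.+1; have [jm'|jm'] := ltnP j m.+1; rewrite prod//.
- by rewrite VV.
- have -> : (i == j) = false by apply/negbTE; rewrite neq_ltn (leq_trans im' jm').
  by rewrite VW scaler0 scale0r.
- have -> : (i == j) = false by apply/negbTE; rewrite neq_ltn (leq_trans jm' im') orbT.
  by rewrite WV scaler0 scale0r.
have -> : i = j by apply/eqP; rewrite eqn_leq -ltnS (leq_trans im _)// -ltnS (leq_trans jm _).
by rewrite WW !eqxx.
Qed.

Lemma gvec_inf x : Omega x -> forall M, exists2 m, (M <= m)%N & gvec e (alpha x) m != 0.
Proof.
move=> Ox; have Px := interior_subset Ox.
apply: (gvec_infinite e_onb (E0_lin Px) (E0_mul Px) (E0_adj Px)) => m.
exact: large_fiber.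
Qed.

(** [ibasis] takes proofs that [alpha x] is a star homomorphism, available for [x] in [P] only.
    Selecting the operator by its properties gives a function of every [x], whose measurability can
    be stated. *)
Definition fbasis (k : nat) (x : 'rV[R]_n.+1) : bop H :=
  get [set T | intertwiner (alpha x) T /\ T (e 0%N) = basis_vec e (alpha x) k].

Lemma fbasisE x (Ox : Omega x) k : let Px := interior_subset Ox in
  fbasis k x = ibasis e_onb (E0_lin Px) (E0_mul Px) (E0_adj Px) k.
Proof.
move=> Px; set V := ibasis _ _ _ _ k.
have [aV V0] : intertwiner (alpha x) V /\ V (e 0%N) = basis_vec e (alpha x) k.
  by split; [exact: ibasis_intertwiner|exact: ibasis_e0].
have [aT T0] : [set T | intertwiner (alpha x) T /\ T (e 0%N) = basis_vec e (alpha x) k] (fbasis k x).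
  by apply: getPex; exists V.
rewrite (intertwiner_inter e_onb (E0_lin Px) (E0_mul Px) (E0_adj Px) aT) T0.
by rewrite (intertwiner_inter e_onb (E0_lin Px) (E0_mul Px) (E0_adj Px) aV) V0.
Qed.

Lemma fbasis_intertwiner x k : Omega x -> intertwiner (alpha x) (fbasis k x).
Proof. by move=> Ox; rewrite (fbasisE Ox); exact: ibasis_intertwiner. Qed.

Lemma fbasis_e0 x k : Omega x -> fbasis k x (e 0%N) = basis_vec e (alpha x) k.
Proof. by move=> Ox; rewrite (fbasisE Ox); exact: ibasis_e0. Qed.

Lemma fbasis_isometries x : Omega x -> isometries (fbasis^~ x).
Proof.
move=> Ox j k; rewrite !(fbasisE Ox).
by apply: ibasis_isometries; exact: gvec_inf.
Qed.

Lemma fbasis_total x : Omega x -> total (fbasis^~ x).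
Proof.
move=> Ox; have Px := interior_subset Ox.
rewrite (_ : fbasis^~ x = ibasis e_onb (E0_lin (interior_subset Ox)) (E0_mul (interior_subset Ox))
   (E0_adj (interior_subset Ox))); last by apply/funext => k; rewrite (fbasisE Ox).
by apply: ibasis_total; [exact: gvec_inf|exact: E0_normal|exact: E0_unital alphaP _ _].
Qed.

Lemma fbasis_onb x : Omega x ->
  orthonormal_basis (@fiber_ip R H) [set T | intertwiner (alpha x) T] (fbasis^~ x).
Proof.
move=> Ox.
rewrite (_ : fbasis^~ x = ibasis e_onb (E0_lin (interior_subset Ox)) (E0_mul (interior_subset Ox))
   (E0_adj (interior_subset Ox))); last by apply/funext => k; rewrite (fbasisE Ox).
by apply: ibasis_onb; exact: gvec_inf.
Qed.

Lemma wmeas_gvec m : wmeas e (Omega : set (borel_rV R n.+1)) (fun x => gvec e (alpha x) m).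
Proof.
apply: (@wmeas_gs R H e e_onb _ (borel_rV R n.+1) Omega
  (fun x m => corner e (alpha x) (e m)) _ m) => {}m j.
exact: E0_cmeas.
Qed.

Lemma wmeas_basis_vec k :
  wmeas e (Omega : set (borel_rV R n.+1)) (fun x => basis_vec e (alpha x) k).
Proof.
move=> j; rewrite /basis_vec.
apply: (@cmeas_pieces R _ (borel_rV R n.+1) Omega Omega_measurable
  (fun m x => ip (gvec e (alpha x) m) (e j)) (fun x => sel (fun m => gvec e (alpha x) m != 0) k)).
  by move=> m; exact: wmeas_gvec.
move=> m; apply: (measurable_sel Omega_measurable
  (p := fun x m => gvec e (alpha x) m != 0)) => [l|x Ox]; last exact: gvec_inf.
have mE : cmeas (Omega : set (borel_rV R n.+1))
    (fun x => ip (gvec e (alpha x) l) (gvec e (alpha x) l)).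
  by apply: (cmeas_ip e_onb); exact: wmeas_gvec.
rewrite (_ : _ `&` _ = Omega `\` (Omega `&` [set x | ip (gvec e (alpha x) l) (gvec e (alpha x) l) = 0])).
  apply: measurableD; [exact: Omega_measurable|].
  by apply: cmeas_set_eq => //; exact: Omega_measurable.
apply/seteqP; split=> [x [Ox /= g0]|x [Ox h]]; split=> //=.
  by move=> [_ /ip_eq0 g]; rewrite g eqxx in g0.
by apply/eqP => g; apply: h; split=> //=; rewrite g ip0l.
Qed.

Lemma fbasis_cmeas k i j :
  cmeas (Omega : set (borel_rV R n.+1)) (fun x => ip (fbasis k x (e i)) (e j)).
Proof.
(* The intertwining relation at [rank1 (e i) (e 0)] expresses [fbasis k x (e i)] through the
   semigroup and the vector [basis_vec], both measurable in [x]. *)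
apply: (@cmeas_eq_in R _ (borel_rV R n.+1) Omega
  (fun x => ip (alpha x (rank1 (e i) (e 0%N)) (basis_vec e (alpha x) k)) (e j))).
  move=> x Ox; have aT := @fbasis_intertwiner x k Ox.
  rewrite -(fbasis_e0 k Ox) -[alpha x _ _]bop_mulE aT bop_mulE rank1E.
  by rewrite (e_norm1 e_onb) scale1r.
apply: (@coef_cmeas_apply R H e e_onb _ (borel_rV R n.+1) Omega
  (fun x => alpha x (rank1 (e i) (e 0%N)))) => [i' j'| |j'].
- exact: E0_cmeas.
- exact: wmeas_basis_vec.
- exact: cmeas_cst.
Qed.

Lemma fbasis_measurable k :
  measurable_fun (Omega : set (borel_rV R n.+1)) (fbasis k : _ -> bopM H).
Proof.
apply: (bopM_measurable H_sep e_onb) => [|i j]; first exact: Omega_measurable.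
exact: fbasis_cmeas.
Qed.

End E0_semigroups.

Lemma cmeas_comp (R : realType) (d1 d2 : measure_display) (T1 : measurableType d1)
    (T2 : measurableType d2) (D1 : set T1) (D2 : set T2) (f : T2 -> cplx R) (g : T1 -> T2) :
  measurable D2 -> g @` D1 `<=` D2 -> cmeas D2 f -> measurable_fun D1 g ->
  cmeas D1 (fun x => f (g x)).
Proof.
move=> mD2 gD [f1 f2] mg; split.
  exact: (measurable_comp mD2 gD f1 mg).
exact: (measurable_comp mD2 gD f2 mg).
Qed.

Section product_system.
Context {R : realType} {n : nat}.
Variable P : set 'rV[R]_n.+1.
Hypothesis P_cone : closed_convex_cone P.
Context {H : hilbertType R}.
Hypothesis H_sep : Defs.separable H.
Variable e : nat -> H.
Hypothesis e_onb : onb e.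
Variable alpha : 'rV[R]_n.+1 -> bop H -> bop H.
Hypothesis alphaP : E0_semigroup P alpha.

Let Omega : set 'rV[R]_n.+1 := P°.
Let D : set (borel_rV R n.+1 * bopM H) := (Omega : set (borel_rV R n.+1)) `*` setT.

Lemma strip_measurable : measurable D.
Proof. by apply: measurableX => //; exact: Omega_measurable. Qed.

Lemma strip_snd_cmeas (u v : H) : cmeas D (fun q => ip ((q.2 : bop H) u) v).
Proof.
apply: (@cmeas_comp R _ _ _ (bopM H) D setT (fun A : bopM H => ip ((A : bop H) u) v) snd) => //.
  exact: (coef_cmeas e_onb).
exact: measurable_funTS.
Qed.

Lemma strip_fst_cmeas (f : 'rV[R]_n.+1 -> cplx R) :
  cmeas (Omega : set (borel_rV R n.+1)) f -> cmeas D (fun q => f q.1).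
Proof.
move=> mf; apply: (@cmeas_comp R _ _ _ (borel_rV R n.+1) D Omega f fst) => //.
- exact: Omega_measurable.
- by move=> _ [q [Oq _] <-].
exact: measurable_funTS.
Qed.

Lemma onb_ip_inj (a b : H) : (forall l, ip a (e l) = ip b (e l)) -> a = b.
Proof.
move=> ab; have [_ _ ed] := e_onb; have e01 := onb_ortho01 e_onb.
apply: cvg_seq_unique (proj_cvg e01 ed a) _.
rewrite (_ : (fun N => _) = (fun N => proj ip e N b)); first exact: proj_cvg.
by apply/funext => N; apply: eq_bigr => j _; rewrite ab.
Qed.

(** Cuts the relations for all operators [A] down to countably many coefficients: those at
    [rank1 (e k) (e 0)] already force [T] to be [inter] of its value at [e 0]. *)
Lemma intertwiner_coefP x T : P x -> intertwiner (alpha x) T <->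
  forall k l, ip (T (e k)) (e l) -
    ip (alpha x (rank1 (e k) (e 0%N)) (T (e 0%N))) (e l) = 0.
Proof.
move=> Px; split=> [aT k l|h].
  rewrite -[alpha x _ _]bop_mulE aT bop_mulE rank1E (e_norm1 e_onb) scale1r.
  by rewrite subrr.
have [_ _ ed] := e_onb; have e01 := onb_ortho01 e_onb.
have he k : T (e k) = inter e_onb (E0_lin alphaP Px) (E0_mul alphaP Px) (E0_adj alphaP Px)
    (T (e 0%N)) (e k).
  rewrite interE; apply: onb_ip_inj => l.
  by apply/eqP; rewrite -subr_eq0 h.
suff -> : T = inter e_onb (E0_lin alphaP Px) (E0_mul alphaP Px) (E0_adj alphaP Px) (T (e 0%N)).
  exact: inter_intertwiner.
set S := inter _ _ _ _ _ in he *.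
apply: bop_eq => x'; apply: cvg_seq_unique (bop_cvg (A := T) (proj_cvg e01 ed x')) _.
apply: cvg_seq_eq (bop_cvg (A := S) (proj_cvg e01 ed x')) => // N.
by rewrite !bop_sum; apply: eq_bigr => j _; rewrite !bopZ he.
Qed.

Lemma product_system_measurable : measurable (product_system_of P alpha).
Proof.
rewrite (_ : product_system_of P alpha = \bigcap_k \bigcap_l (D `&`
  [set q | ip ((q.2 : bop H) (e k)) (e l) -
    ip (alpha q.1 (rank1 (e k) (e 0%N)) ((q.2 : bop H) (e 0%N))) (e l) = 0])).
  apply: bigcapT_measurable => k; apply: bigcapT_measurable => l.
  apply: cmeas_set_eq; first exact: strip_measurable.
  apply: cmeasB; first exact: strip_snd_cmeas.
  apply: (@coef_cmeas_apply R H e e_onb _ _ D (fun q => alpha q.1 (rank1 (e k) (e 0%N)))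
    _ (fun q => (q.2 : bop H) (e 0%N)) (fun=> e l)) => [i j|j|j].
  - exact: (strip_fst_cmeas (E0_cmeas e_onb alphaP _ _ _)).
  - exact: strip_snd_cmeas.
  - exact: cmeas_cst.
apply/seteqP; split=> [[x T] [/= Ox aT] k _ l _|[x T] h].
  split; first by split.
  by apply: (intertwiner_coefP _ (interior_subset Ox)).1.
have [[/= Ox _] _] := h 0%N I 0%N I.
split=> //=; apply/(intertwiner_coefP _ (interior_subset Ox)) => k l.
by have [] := h k I l I.
Qed.

Hypothesis nonto : forall x, Omega x -> ~ (forall B, exists A, alpha x A = B).

Lemma product_system_concrete : concrete_product_system Omega (product_system_of P alpha).
Proof.
have fE := @fiberE R n P H alpha.
split.
- by move=> [x T] [Ox _].
- exact: product_system_measurable.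
- apply/seteqP; split=> [_ [[x T] [Ox _] <-]//|x Ox].
  by exists (x, 0) => //; split=> //=; exact: intertwiner0.
- move=> x Ox; split; first by rewrite inE fE//=; exact: intertwiner0.
  by move=> a u v; rewrite !inE fE//=; exact: intertwiner_lin.
- move=> x T S Ox; rewrite fE//= => aT aS; have Px := interior_subset Ox.
  exists (ip (S (e 0%N)) (T (e 0%N))).
  exact: (intertwiner_scalar e_onb (E0_lin alphaP Px) (E0_mul alphaP Px) (E0_adj alphaP Px)).
- move=> x Ox; rewrite fE//; have Px := interior_subset Ox.
  exact: (intertwiner_hilbert e_onb (E0_lin alphaP Px) (E0_mul alphaP Px) (E0_adj alphaP Px)).
- move=> x y Ox Oy; have Px := interior_subset Ox; have Py := interior_subset Oy.
  have Oxy : Omega (x + y) by exact: (interior_add P_cone).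
  have Pxy := interior_subset Oxy.
  rewrite !fE//; set G := [set T * S | T in _ & S in _].
  have GE S : Defs.span G S -> intertwiner (alpha (x + y)) S.
    move: S; apply: (@span_ind R (bop H) G [set S | intertwiner (alpha (x + y)) S]) => /=.
    + exact: intertwiner0.
    + by move=> a A B; exact: intertwiner_lin.
    + by move=> _ [T aT [S aS <-]]; exact: (product_intertwiner alphaP).
  split=> [S /GE//|T aT d d0].
  (* Each [adj (fbasis e alpha k x) * T] lies in the fibre at [y], so [T] is a limit of sums of
     products, by totality of the basis at [x]. *)
  have tV := fbasis_total P_cone e_onb alphaP nonto Ox.
  have sd : 0 < sqrtC d by rewrite sqrtC_gt0.
  have /cvg_seqP/(_ _ sd)[K hK] := tV (T (e 0%N)).
  pose W k := fbasis e alpha k x * (adj (fbasis e alpha k x) * T).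
  have GW : Defs.span G (\sum_(k < K) W k).
    apply: (big_ind (Defs.span G)) => [|S S' hS hS'|k _]; first exact: span0.
      by rewrite -[S]scale1r; exact: spanD.
    apply: span_in; have aV := fbasis_intertwiner e_onb alphaP k Ox.
    exists (fbasis e alpha k x) => //; exists (adj (fbasis e alpha k x) * T) => //.
    move=> A; rewrite mulrA.
    have aVA B : adj (fbasis e alpha k x) * alpha x B = B * adj (fbasis e alpha k x).
      by rewrite -[LHS]adjK adjM adjK -(E0_adj alphaP Px) aV adjM !adjK.
    by rewrite -aVA -[in RHS]mulrA -aT -[in RHS](E0_add alphaP)// !mulrA.
  exists (\sum_(k < K) W k) => //.
  rewrite (fiber_ip_sq e_onb (E0_lin alphaP Pxy) (E0_mul alphaP Pxy) (E0_adj alphaP Pxy)).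
    rewrite -[ltRHS]sqrtCK ltr_pXn2r ?nnegrE ?sqrtC_ge0 ?(ltW d0)//.
    by rewrite bop_addE bop_oppE bop_sumE distrC; exact: hK.
  by apply: intertwiner_sub => //; exact: GE.
- exists (fbasis e alpha); split=> [k|x Ox].
    exact: (fbasis_measurable P_cone H_sep e_onb alphaP nonto).
  by rewrite fE//; exact: (fbasis_onb P_cone e_onb alphaP nonto Ox).
Qed.

End product_system.

Lemma measurable_fun_pair_in (d d1 d2 : measure_display) (T : measurableType d)
    (T1 : measurableType d1) (T2 : measurableType d2) (D : set T) (f : T -> T1) (g : T -> T2) :
  measurable_fun D f -> measurable_fun D g -> measurable_fun D (fun x => (f x, g x)).
Proof.
move=> mf mg mD.
apply: (measurability _ (measurable_prod_measurableType T1 T2)) => //.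
move=> _ [_ [A mA [B mB <-]] <-].
rewrite (_ : _ `&` _ = (D `&` f @^-1` A) `&` (D `&` g @^-1` B)).
  by apply: measurableI; [exact: mf|exact: mg].
by apply/seteqP; split=> [x [Dx [/= Ax Bx]]|x [[Dx Ax] [_ Bx]]].
Qed.

Lemma cmeas_sub (R : realType) (d : measure_display) (T : measurableType d)
    (D E : set T) (f : T -> cplx R) :
  measurable E -> D `<=` E -> cmeas E f -> cmeas D f.
Proof. by move=> mE DE [f1 f2]; split; exact: measurable_funS mE DE _. Qed.

Lemma within_cmeas (R : realType) (n : nat) (P : set 'rV[R]_n) (f : 'rV[R]_n -> cplx R) :
  {within P, continuous f} -> cmeas (P° : set (borel_rV R n)) f.
Proof.
move=> fc; apply: (@continuous_cmeas R 'rV[R]_n) => [U oU|| x Px].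
- exact: borel_rV_open.
- exact: open_interior.
have /subspace_continuousP/(_ x (interior_subset Px)) := fc.
by rewrite within_interior.
Qed.

(** * Star automorphisms are inner *)

Section center.
Context {R : realType} {H : hilbertType R}.
Variable e : nat -> H.
Hypothesis e_onb : onb e.

(** Evaluate at [e 0] the commutation of [Q] with [rank1 x (e 0)]. *)
Lemma center_scalar (Q : bop H) : (forall B, B * Q = Q * B) ->
  exists c : cplx R, Q = c *: (1 : bop H).
Proof.
move=> Qc; exists (ip (Q (e 0%N)) (e 0%N)); apply: bop_eq => x.
rewrite bop_scaleE bop_oneE -rank1E -[RHS]bop_mulE Qc bop_mulE rank1E.
by rewrite (e_norm1 e_onb) scale1r.
Qed.

(** A normalized intertwiner [W] of [theta] is an isometry, and [W * adj W] commutes with the range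
    of [theta], which is everything. It is therefore a scalar, and [adj W * W = 1] makes this scalar
    1. *)
Lemma star_automorphism_inner (theta theta' : bop H -> bop H) : linear theta ->
  (forall A B, theta (A * B) = theta A * theta B) ->
  (forall A, theta (adj A) = adj (theta A)) ->
  cancel theta theta' -> cancel theta' theta ->
  exists2 W : bop H, unitary_op W & forall A, theta A * W = W * A.
Proof.
move=> lin mul st K K'.
have theta0 : theta 0 = 0.
  have := lin 1 0 0; rewrite scaler0 addr0 scale1r => h.
  by apply: (addrI (theta 0)); rewrite -h addr0.
pose J z := inter e_onb lin mul st z.
(* Injectivity of [theta] keeps the image of a rank one projection nonzero. *)
have [z pz] : exists z, corner e theta z != 0.
  apply: contrapT => noz.
  have : corner e theta = 0.
    apply: bop_eq => x; apply/eqP/negPn/negP => px; apply: noz; by exists x.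
  rewrite /corner -theta0 => /(can_inj K)/(congr1 (fun A : bop H => ip (A (e 0%N)) (e 0%N))).
  rewrite rank1E ipZl (e_norm1 e_onb) mulr1 bop_zeroE ip0l => /eqP.
  by rewrite oner_eq0.
pose c := `|corner e theta z|^-1.
have c0 : c != 0 by rewrite invr_eq0 normr_eq0.
pose W := c *: J z.
have aW : intertwiner theta W.
  rewrite /W -[c *: _]addr0; apply: intertwiner_lin; first exact: inter_intertwiner.
  exact: intertwiner0.
have WW : adj W * W = 1.
  rewrite (intertwiner_scalar e_onb lin mul st aW aW) ip_sq.
  rewrite /W bop_scaleE -[J z (e 0%N)]/(corner e theta z) normrZ /c normfV normr_id.
  by rewrite mulVf ?normr_eq0// expr1n scale1r.
exists W => //; split=> //.
have [k Qk] : exists k : cplx R, W * adj W = k *: (1 : bop H).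
  apply: center_scalar => B.
  rewrite -[B]K' mulrA aW -!mulrA; congr (W * _).
  by rewrite -[RHS]adjK adjM adjK -st aW adjM !adjK.
have : W * adj W * W = W by rewrite -mulrA WW mulr1.
rewrite Qk -bop_scalerAl mul1r => /(congr1 (fun A => adj W * A)).
rewrite -bop_scalerAr WW -[RHS]scale1r => /(scalar_inj e_onb) ->.
by rewrite scale1r.
Qed.

End center.

(** * From cocycle conjugacy to isomorphism *)

Section conjugate_isomorphic.
Context {R : realType} {n : nat}.
Variable P : set 'rV[R]_n.+1.
Context {H : hilbertType R}.
Hypothesis H_sep : Defs.separable H.
Variable e : nat -> H.
Hypothesis e_onb : onb e.
Variables alpha beta : 'rV[R]_n.+1 -> bop H -> bop H.
Hypothesis alphaP : E0_semigroup P alpha.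
Hypothesis betaP : E0_semigroup P beta.

Let Omega : set 'rV[R]_n.+1 := P°.

Lemma cocycle_weak_continuous u : cocycle P beta u -> forall x y,
  {within P, continuous (fun z => ip (u z x) y : cplx R)}.
Proof.
move=> cu x y; apply/subspace_continuousP => z Pz.
have /subspace_continuousP/(_ z Pz) h := cocycle_continuous cu.
exact: (cvg_comp _ _ h (@coef_continuous R H e e_onb x y (u z))).
Qed.

Lemma conjugate_isomorphic : cocycle_conjugate P alpha beta ->
  product_system_isomorphic Omega (product_system_of P alpha) (product_system_of P beta).
Proof.
move=> [theta [theta' [[lin mul st _] K K' [u cu uE]]]].
have [W [W1 W2] tW] := star_automorphism_inner e_onb lin mul st K K'.
have fE := @fiberE R n P H.
have mD := @strip_measurable R n P H.
have EaD : product_system_of P alpha `<=` Omega `*` setT by move=> [x T] [Ox _].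
have EbD : product_system_of P beta `<=` Omega `*` setT by move=> [x T] [Ox _].
have u1 x : Omega x -> adj (u x) * u x = 1 by move=> Ox; have [] := cocycle_unitary cu (interior_subset Ox).
have u2 x : Omega x -> u x * adj (u x) = 1 by move=> Ox; have [] := cocycle_unitary cu (interior_subset Ox).
have uc i j : cmeas (Omega : set (borel_rV R n.+1)) (fun x => ip (u x i) j).
  exact: (within_cmeas (@cocycle_weak_continuous u cu i j)).
(* Cancellation and commutation rules in the shape that products associated to the left require. *)
have W1K A : A * adj W * W = A by rewrite -mulrA W1 mulr1.
have W2K A : A * W * adj W = A by rewrite -mulrA W2 mulr1.
have u1K x A : Omega x -> A * adj (u x) * u x = A by move=> Ox; rewrite -mulrA u1// mulr1.
have u2K x A : Omega x -> A * u x * adj (u x) = A by move=> Ox; rewrite -mulrA u2// mulr1.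
have tWK B A : B * theta A * W = B * W * A by rewrite -mulrA tW mulrA.
have tW' A : theta' A * adj W = adj W * A.
  by rewrite -[LHS]mul1r -W1 mulrA -tWK K' W2K.
have tWK' B A : B * theta' A * adj W = B * adj W * A by rewrite -mulrA tW' mulrA.
pose U x T := adj (u x) * W * T * adj W.
pose V x T := adj W * u x * T * W.
have UP x T : Omega x -> intertwiner (alpha x) T -> intertwiner (beta x) (U x T).
  move=> Ox aT A; have Px := interior_subset Ox.
  have -> : beta x A = adj (u x) * theta (alpha x (theta' A)) * u x.
    by rewrite uE// !mulrA u1// mul1r u1K.
  by rewrite /U !mulrA u2K// tWK -(mulrA _ (alpha x _) T) aT !mulrA tWK'.
have VP x T : Omega x -> intertwiner (beta x) T -> intertwiner (alpha x) (V x T).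
  move=> Ox bT A; have Px := interior_subset Ox.
  have -> : alpha x A = adj W * (u x * beta x (theta A) * adj (u x)) * W.
    by rewrite -uE// K tWK W1 mul1r.
  by rewrite /V !mulrA W2K u1K// -(mulrA _ (beta x _) T) bT !mulrA tWK.
have UVK x T : Omega x -> V x (U x T) = T.
  by move=> Ox; rewrite /U /V !mulrA u2K// W1 mul1r W1K.
have VUK x T : Omega x -> U x (V x T) = T.
  by move=> Ox; rewrite /U /V !mulrA !W2K u1// mul1r.
have mEa := product_system_measurable e_onb alphaP.
have mEb := product_system_measurable e_onb betaP.
have snd_apply (E : set (borel_rV R n.+1 * bopM H)) (a b : H) : E `<=` Omega `*` setT ->
    cmeas E (fun q => ip ((q.2 : bop H) a) b).
  move=> ED; apply: (cmeas_sub mD ED).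
  exact: (@strip_snd_cmeas R n P H e e_onb a b).
have fst_apply (E : set (borel_rV R n.+1 * bopM H)) (a b : H) : E `<=` Omega `*` setT ->
    cmeas E (fun q => ip (u q.1 a) b).
  move=> ED; apply: (cmeas_sub mD ED).
  exact: (strip_fst_cmeas (uc a b)).
exists U, V; split.
- move=> x Ox; have Px := interior_subset Ox; rewrite !fE//; split=> /=.
  + by move=> T; exact: UP.
  + by move=> a T S _ _; rewrite /U mulrDr mulrDl -bop_scalerAr -bop_scalerAl.
  + by move=> T; exact: VP.
  + move=> T S aT bS.
    have := intertwiner_scalar e_onb (E0_lin alphaP Px) (E0_mul alphaP Px) (E0_adj alphaP Px) aT (VP x S Ox bS).
    set c := ip _ _ => Tc; rewrite (fiber_ip_scalar e_onb Tc).
    apply: (fiber_ip_scalar e_onb).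
    (* The scalar in the fibre of [alpha] survives conjugation by the unitary [W], which turns it
       into the scalar in the fibre of [beta]. *)
    have : W * (adj T * V x S) * adj W = c *: (1 : bop H).
      by rewrite Tc -bop_scalerAr -bop_scalerAl mulr1 W2.
    by move=> <-; rewrite /U /V !adjM !adjK !mulrA W2K.
  + by move=> T _; exact: UVK.
  + by move=> T _; exact: VUK.
- apply: measurable_fun_pair_in; first exact: measurable_funTS.
  apply: (bopM_measurable H_sep e_onb) => // i j.
  (* The adjoints of [W] and of [u] are moved to the second argument, leaving one varying operator
     between two measurable vectors. *)
  rewrite (_ : (fun q => _) = fun q : borel_rV R n.+1 * bopM H =>
      ip ((q.2 : bop H) (adj W (e i))) (adj W (u q.1 (e j)))).
    apply: (@coef_cmeas_apply R H e e_onb _ _ (product_system_of P alpha)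
      (fun q => (q.2 : bop H)) _ (fun=> adj W (e i)) (fun q => adj W (u q.1 (e j)))) => [k l|k|k].
    + exact: snd_apply.
    + exact: cmeas_cst.
    rewrite (_ : (fun q => _) = fun q : borel_rV R n.+1 * bopM H => ip (u q.1 (e j)) (W (e k))).
      exact: fst_apply.
    by apply/funext => q; rewrite -adjPr.
  by apply/funext => q; rewrite /U !bop_mulE -adjPr -adjP.
- apply: measurable_fun_pair_in; first exact: measurable_funTS.
  apply: (bopM_measurable H_sep e_onb) => // i j.
  rewrite (_ : (fun q => _) = fun q : borel_rV R n.+1 * bopM H =>
      ip (u q.1 ((q.2 : bop H) (W (e i)))) (W (e j))).
    apply: (@coef_cmeas_apply R H e e_onb _ _ (product_system_of P beta)
      (fun q => u q.1) _ (fun q => (q.2 : bop H) (W (e i))) (fun=> W (e j))) => [k l|k|k].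
    + exact: fst_apply.
    + exact: snd_apply.
    + exact: cmeas_cst.
  by apply/funext => q; rewrite /V !bop_mulE -adjPr.
move=> x y T S Ox Oy; have Px := interior_subset Ox; have Py := interior_subset Oy.
rewrite !fE//= => aT aS.
(* The adjoint of the cocycle identity puts [beta x (adj (u y))] on the left; passing [U x T] it
   becomes [adj (u y)], the first factor of [U y S]. *)
have bU := UP x T Ox aT.
rewrite [LHS]/U -(cocycle_add cu)// adjM -(E0_adj betaP)//.
have -> : U x T * U y S = U x T * adj (u y) * W * S * adj W by rewrite /U !mulrA.
by rewrite -bU /U !mulrA W1K.
Qed.

End conjugate_isomorphic.

(* [Baire] needs completeness joined with the norm. *)
HB.instance Definition _ (R : realType) n := Complete.on 'rV[R]_n.+1.

(** * The Baire property, and continuity of Borel functions off a meagre set *)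

Section baire_property.
Context {R : realType} {n : nat}.
Let X := 'rV[R]_n.+1.
Implicit Types A M O : set X.

Definition meagre A : Prop := exists F : nat -> set X,
  (forall i, closed (F i) /\ dense (~` F i)) /\ A `<=` \bigcup_i F i.

Lemma meagre_sub A M : A `<=` M -> meagre M -> meagre A.
Proof. by move=> AM [F [hF MF]]; exists F; split=> //; exact: subset_trans MF. Qed.

Lemma dense_setT : dense [set: X].
Proof. by move=> O [x Ox] _; exists x. Qed.

Lemma meagre_bigcup (A : nat -> set X) : (forall i, meagre (A i)) -> meagre (\bigcup_i A i).
Proof.
move=> mA; pose F i := sval (cid (mA i)).
have FP i : (forall j, closed (F i j) /\ dense (~` F i j)) /\ A i `<=` \bigcup_j F i j.
  exact: svalP (cid (mA i)).
pose G k := if (unpickle k : option (nat * nat)) is Some q then F q.1 q.2 else set0.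
exists G; split=> [k|x [i _ /((FP i).2)[j _ Fx]]].
  rewrite /G; case: unpickle => [[i j]|]; first exact: (FP i).1.
  by rewrite setC0; split; [exact: closed0|exact: dense_setT].
by exists (pickle (i, j)) => //; rewrite /G pickleK.
Qed.

Lemma meagre1 A : closed A -> dense (~` A) -> meagre A.
Proof. by move=> cA dA; exists (fun=> A); split=> // x Ax; exists 0%N. Qed.

Lemma meagreU A M : meagre A -> meagre M -> meagre (A `|` M).
Proof.
move=> mA mM; apply: (@meagre_sub _ (\bigcup_i (if i == 0%N then A else M))).
  by move=> x [Ax|Mx]; [exists 0%N|exists 1%N].
by apply: meagre_bigcup => i; case: ifP.
Qed.

Lemma meagre0 : meagre set0.
Proof. by apply: meagre1; [exact: closed0|rewrite setC0; exact: dense_setT]. Qed.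

Lemma translation_continuous (x : X) : continuous (fun y : X => x + y).
Proof.
move=> y; apply: (@cvgD _ X _ (nbhs y) _ (fun=> x) id x y); first exact: cvg_cst.
exact: cvg_id.
Qed.

Lemma meagre_translate (x : X) M : meagre M -> meagre [set y | M (x + y)].
Proof.
move=> [F [hF MF]]; exists (fun i => [set y | F i (x + y)]); split=> [i|y /MF[i _ Fy]].
  have [cF dF] := hF i; split.
    exact: (preimage_closed (fun y _ => @translation_continuous x y) cF).
  move=> O [y Oy] oO.
  have [||z [Oz Fz]] := dF [set z | O (- x + z)].
  - by exists (x + y); rewrite /= addKr.
  - exact: (open_comp (fun y _ => @translation_continuous (- x) y) oO).
  by exists (- x + z); split=> //=; rewrite addNKr.
by exists i.
Qed.

Lemma meagre_escape O M : open O -> O !=set0 -> meagre M -> exists2 y, O y & ~ M y.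
Proof.
move=> oO O0 [F [hF MF]].
have d : dense (\bigcap_i ~` F i).
  by apply: Baire => i; have [cF dF] := hF i; split=> //; exact: closed_openC.
have [y [Oy Fy]] := d O O0 oO; exists y => // /MF[i _ Fiy].
exact: (Fy i I).
Qed.

(** Equality with an open set off a meagre set. These sets form a sigma-algebra, so every Borel set
    is among them. *)
Definition baire_property A : Prop := exists O M,
  [/\ open O, meagre M & forall z, ~ M z -> (A z <-> O z)].

Lemma baire_property_sigma : sigma_algebra setT baire_property.
Proof.
split.
- by exists set0, set0; split; [exact: open0|exact: meagre0|].
(* The complement is, off [M], the closed set [F]; it is replaced by its interior, and the nowhere
   dense difference joins the exceptional set. *)
- move=> A [U [M [oU mM AU]]]; pose F := ~` U.
  exists (interior F), (M `|` (F `&` ~` interior F)); split; first exact: open_interior.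
    apply: meagreU => //; apply: meagre1.
      by apply: closedI; [exact: open_closedC|exact/open_closedC/open_interior].
    move=> D [x Dx] oD; have [DF|] := pselect (D `<=` F).
      exists x; split=> // -[_]; apply.
      by apply: filterS DF _; exact: open_nbhs_nbhs.
    by move=> /existsNP[y /not_implyP[Dy Fy]]; exists y; split=> // -[].
  move=> z /not_orP[Mz Fz]; rewrite setTD; have AUz := AU z Mz; split.
    move=> Az; apply: contrapT => Foz; apply: Fz; split=> // Uz.
    by apply: Az; apply/AUz.
  by move=> /interior_subset Fzz /AUz.
move=> A bA; pose O i := sval (cid (bA i)).
have OP i : exists M, [/\ open (O i), meagre M & forall z, ~ M z -> (A i z <-> O i z)].
  exact: svalP (cid (bA i)).
pose M i := sval (cid (OP i)).
have MP i : [/\ open (O i), meagre (M i) & forall z, ~ M i z -> (A i z <-> O i z)].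
  exact: svalP (cid (OP i)).
exists (\bigcup_i O i), (\bigcup_i M i); split.
- by apply: bigcup_open => i _; have [] := MP i.
- by apply: meagre_bigcup => i; have [] := MP i.
move=> z Mz; have Miz i : ~ M i z by move=> h; apply: Mz; exists i.
by split=> -[i _ h]; exists i => //; have [_ _ AO] := MP i; apply/AO.
Qed.

Lemma borel_baire_property A : measurable (A : set (borel_rV R n.+1)) -> baire_property A.
Proof.
move=> mA; apply: (smallest_sub baire_property_sigma _ mA) => O oO.
by exists O, set0; split; [|exact: meagre0|].
Qed.

(* Outside a meagre set the preimages of the rational half-lines are open. *)
Lemma borel_continuous_real (O : set X) (f : X -> R) : open O ->
  measurable_fun (O : set (borel_rV R n.+1)) f ->
  exists2 M, meagre M & forall (z : nat -> X) z0, z j @[j --> \oo] --> z0 ->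
    O z0 -> ~ M z0 -> (forall j, O (z j) /\ ~ M (z j)) -> f (z j) @[j --> \oo] --> f z0.
Proof.
move=> oO mf.
have mO : measurable (O : set (borel_rV R n.+1)) by exact: borel_rV_open.
have bp (Y : set R) : measurable Y -> baire_property (O `&` f @^-1` Y).
  by move=> mY; apply: borel_baire_property; exact: mf.
pose Y (q : rat) (b : bool) : set R := if b then `]-oo, ratr q[%classic else `]ratr q, +oo[%classic.
have mY q b : measurable (Y q b) by rewrite /Y; case: b; exact: measurable_itv.
pose G q b := sval (cid (bp _ (mY q b))).
have GP q b : exists M, [/\ open (G q b), meagre M &
    forall z, ~ M z -> ((O `&` f @^-1` Y q b) z <-> G q b z)].
  exact: svalP (cid (bp _ (mY q b))).
pose M q b := sval (cid (GP q b)).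
have MP q b : [/\ open (G q b), meagre (M q b) &
    forall z, ~ M q b z -> ((O `&` f @^-1` Y q b) z <-> G q b z)].
  exact: svalP (cid (GP q b)).
pose N (k : nat) := if (unpickle k : option (rat * bool)) is Some qb then M qb.1 qb.2 else set0.
exists (\bigcup_k N k).
  apply: meagre_bigcup => k; rewrite /N; case: unpickle => [[q b]|]; last exact: meagre0.
  by have [] := MP q b.
move=> z z0 zz0 Oz0 Mz0 Oz.
have notM x q b : ~ (\bigcup_k N k) x -> ~ M q b x.
  by move=> h Mx; apply: h; exists (pickle (q, b)); [exact: I|rewrite /N pickleK].
(* Off the exceptional set [z0] lies in the open set [G q b], hence so do the [z j] eventually, and
   then [f (z j)] lies in the same half-line. *)
have ev q b : Y q b (f z0) -> \forall j \near \oo, Y q b (f (z j)).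
  move=> Yf; have [oG _ GM] := MP q b.
  have Gz0 : G q b z0 by apply/GM => //; exact: notM.
  have : \forall j \near \oo, G q b (z j) by apply: zz0; exact: open_nbhs_nbhs.
  apply: filterS => j Gj; have [Oj Mj] := Oz j.
  by have [] := (GM (z j) (notM _ q b Mj)).2 Gj.
apply/cvgrPdist_lt => d d0.
have [|q1] := @rat_in_itvoo R (f z0 - d) (f z0); first by rewrite ltrBlDr ltrDl.
rewrite in_itv /= => /andP[q1a q1b].
have [|q2] := @rat_in_itvoo R (f z0) (f z0 + d); first by rewrite ltrDl.
rewrite in_itv /= => /andP[q2a q2b].
have e1 : \forall j \near \oo, Y q1 false (f (z j)) by apply: ev; rewrite /Y /= in_itv /= q1b.
have e2 : \forall j \near \oo, Y q2 true (f (z j)) by apply: ev; rewrite /Y /= in_itv.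
apply: filterS2 e1 e2 => j; rewrite /Y /= !in_itv /= andbT => h1 h2.
rewrite distrC ltr_norml; apply/andP; split.
  by rewrite ltrBrDl (lt_trans q1a).
by rewrite ltrBlDl (lt_trans h2).
Qed.

(** The exceptional sets of countably many functions unite to a single meagre set. *)
Lemma borel_continuous (O : set X) (f : nat -> nat -> X -> cplx R) : open O ->
  (forall i j, cmeas (O : set (borel_rV R n.+1)) (f i j)) ->
  exists2 M, meagre M & forall (z : nat -> X) z0, z j @[j --> \oo] --> z0 ->
    O z0 -> ~ M z0 -> (forall j, O (z j) /\ ~ M (z j)) ->
    forall i k, f i k (z j) @[j --> \oo] --> f i k z0.
Proof.
move=> oO mf.
have h i k : exists M, meagre M /\ forall (z : nat -> X) z0, z j @[j --> \oo] --> z0 ->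
    O z0 -> ~ M z0 -> (forall j, O (z j) /\ ~ M (z j)) ->
    f i k (z j) @[j --> \oo] --> f i k z0.
  have [mr mi] := mf i k.
  have [M1 mM1 h1] := borel_continuous_real oO mr.
  have [M2 mM2 h2] := borel_continuous_real oO mi.
  exists (M1 `|` M2); split; first exact: meagreU.
  move=> z z0 zz0 Oz0 /not_orP[n1 n2] Oz; apply: cvg_of_re_im.
    by apply: h1 => // j; have [Oj /not_orP[m1 m2]] := Oz j.
  by apply: h2 => // j; have [Oj /not_orP[m1 m2]] := Oz j.
pose M i k := sval (cid (h i k)).
have MP i k : meagre (M i k) /\ forall (z : nat -> X) z0, z j @[j --> \oo] --> z0 ->
    O z0 -> ~ M i k z0 -> (forall j, O (z j) /\ ~ M i k (z j)) ->
    f i k (z j) @[j --> \oo] --> f i k z0.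
  exact: svalP (cid (h i k)).
exists (\bigcup_i \bigcup_k M i k).
  by apply: meagre_bigcup => i; apply: meagre_bigcup => k; have [] := MP i k.
move=> z z0 zz0 Oz0 Mz0 Oz i k; have [_ hM] := MP i k; apply: hM => //.
  by move=> Mik; apply: Mz0; exists i => //; exists k.
move=> j; have [Oj Mj] := Oz j; split=> // Mik; apply: Mj.
by exists i => //; exists k.
Qed.

End baire_property.

(** * Strong convergence and sequential continuity *)

Section unitaries.
Context {R : realType} {H : hilbertType R}.

Lemma total_adj_eq (V : nat -> bop H) (A B : bop H) : total V ->
  (forall k, adj (V k) * A = adj (V k) * B) -> A = B.
Proof.
move=> tV AB; apply: bop_eq => x; apply: cvg_seq_unique (tV (A x)) _.
apply: cvg_seq_eq (tV (B x)) => // n; apply: eq_bigr => k _; congr (V k _).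
by rewrite -[LHS]bop_mulE AB.
Qed.

Lemma isometry_ip (v : bop H) x y : adj v * v = 1 -> ip (v x) (v y) = ip x y.
Proof. by move=> vv; rewrite adjPr -[adj v _]bop_mulE vv. Qed.

Lemma isometry_norm (v : bop H) x : adj v * v = 1 -> `|v x| = `|x|.
Proof.
move=> vv; apply/eqP; rewrite -(@eqrXn2 _ 2)// -!ip_sq.
by rewrite isometry_ip.
Qed.

Lemma unitary_adj (v : bop H) : unitary_op v -> unitary_op (adj v).
Proof. by move=> [v1 v2]; rewrite /unitary_op adjK. Qed.

Lemma unitary_mul (v w : bop H) : unitary_op v -> unitary_op w -> unitary_op (v * w).
Proof.
move=> [v1 v2] [w1 w2]; split; rewrite adjM -mulrA.
  by rewrite (mulrA (adj v)) v1 mul1r.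
by rewrite (mulrA w) w2 mul1r.
Qed.

(** Isometries preserve the norm, so [cvg_weak_norm] applies. *)
Lemma unitary_strong (v : nat -> bop H) (v0 : bop H) x :
  (forall j, adj (v j) * v j = 1) -> adj v0 * v0 = 1 ->
  (forall y, ip (v j x) y @[j --> \oo] --> ip (v0 x) y) ->
  v j x @[j --> \oo] --> v0 x.
Proof.
move=> vv v00 vw; apply: cvg_weak_norm; first exact: vw.
apply: (@cvg_seq_eq _ (cplx R) (fun=> ip x x) (ip x x)) => [j||].
- exact: isometry_ip.
- exact: isometry_ip.
exact: cvg_cst.
Qed.

End unitaries.

Section sequential.
Context {R : realType} {n : nat}.

Lemma within_seq (P : set 'rV[R]_n.+1) (x : 'rV[R]_n.+1) (f : 'rV[R]_n.+1 -> cplx R)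
    (l : cplx R) :
  (forall z : nat -> 'rV[R]_n.+1, (forall j, P (z j)) -> z j @[j --> \oo] --> x ->
     f (z j) @[j --> \oo] --> l) -> f @ within P (nbhs x) --> l.
Proof.
move=> fz; apply/cvgrPdist_lt => d d0; apply: contrapT => nf.
have ex j : exists z, [/\ P z, `|x - z| < j.+1%:R^-1 & ~ `|l - f z| < d].
  apply: contrapT => nz; apply: nf; rewrite /within /=.
  have : \forall z \near x, `|x - z| < j.+1%:R^-1.
    by apply/nbhs_normP; exists j.+1%:R^-1 => //=; rewrite invr_gt0.
  apply: filterS => z xz Pz; apply: contrapT => nd; apply: nz; exists z; split=> //.
pose z j := sval (cid (ex j)).
have zP j : [/\ P (z j), `|x - z j| < j.+1%:R^-1 & ~ `|l - f (z j)| < d].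
  exact: svalP (cid (ex j)).
have zx : z j @[j --> \oo] --> x.
  apply/cvg_seqP => r r0; have [N _ h] := near_infty_natSinv_lt (PosNum r0).
  exists N => j Nj; have [_ xz _] := zP j; rewrite distrC (lt_trans xz)//; exact: h.
have Pz j : P (z j) by have [] := zP j.
have [N hN] := (cvg_seqP (V := cplx R) _ _).1 (fz z Pz zx) d d0.
have [_ _ nd] := zP N; apply: nd; rewrite distrC; exact: hN.
Qed.

Lemma seq_within (P : set 'rV[R]_n.+1) (f : 'rV[R]_n.+1 -> cplx R) :
  {within P, continuous f} ->
  forall (z : nat -> 'rV[R]_n.+1) x, (forall j, P (z j)) -> P x -> z j @[j --> \oo] --> x ->
  f (z j) @[j --> \oo] --> f x.
Proof.
move=> fc z x Pz Px zx.
have /subspace_continuousP/(_ x Px) h := fc.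
have zw : z j @[j --> \oo] --> within P (nbhs x).
  move=> A wA; have [N _ hN] := zx [set y | P y -> A y] wA.
  by exists N => // j Nj; apply: (hN j Nj).
exact: (cvg_comp _ _ zw h).
Qed.

End sequential.

Section E0_strong.
Context {R : realType} {n : nat}.
Variable P : set 'rV[R]_n.+1.
Context {H : hilbertType R}.
Variable e : nat -> H.
Hypothesis e_onb : onb e.
Variable alpha : 'rV[R]_n.+1 -> bop H -> bop H.
Hypothesis alphaP : E0_semigroup P alpha.

(** The squared norm of [alpha t A y] is the coefficient of [alpha t (adj A * A)] at [y], so weak
    continuity already gives convergence of norms. *)
Lemma E0_strong (z : nat -> 'rV[R]_n.+1) x A (y : H) : (forall j, P (z j)) -> P x ->
  z j @[j --> \oo] --> x -> alpha (z j) A y @[j --> \oo] --> alpha x A y.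
Proof.
move=> Pz Px zx; have w B (a b : H) := seq_within (@E0_weak_continuous _ _ _ _ _ e_onb _ alphaP B a b) Pz Px zx.
apply: cvg_weak_norm; first exact: w.
have h t : P t -> ip (alpha t A y) (alpha t A y) = ip (alpha t (adj A * A) y) y.
  by move=> Pt; rewrite adjPr (E0_mul alphaP Pt) (E0_adj alphaP Pt).
apply: (@cvg_seq_eq _ (cplx R) (fun j => ip (alpha (z j) (adj A * A) y) y)) => [j||].
- exact: h.
- exact: h.
exact: w.
Qed.

Lemma E0_unitary x v : P x -> unitary_op v -> unitary_op (alpha x v).
Proof.
move=> Px [v1 v2]; rewrite /unitary_op -(E0_adj alphaP Px) -!(E0_mul alphaP Px) v1 v2.
by rewrite (E0_unital alphaP Px).
Qed.

End E0_strong.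

(** * From isomorphism to cocycle conjugacy *)

Section fiber_transfer.
Context {R : realType} {n : nat}.
Variable P : set 'rV[R]_n.+1.
Hypothesis P_cone : closed_convex_cone P.
Context {H : hilbertType R}.
Hypothesis H_sep : Defs.separable H.
Variable e : nat -> H.
Hypothesis e_onb : onb e.
Variables alpha beta : 'rV[R]_n.+1 -> bop H -> bop H.
Hypothesis alphaP : E0_semigroup P alpha.
Hypothesis betaP : E0_semigroup P beta.

Let Omega : set 'rV[R]_n.+1 := P°.
Hypothesis beta_nonto : forall x, Omega x -> ~ (forall B, exists A, beta x A = B).

Variables U F : 'rV[R]_n.+1 -> bop H -> bop H.
Hypothesis UF : forall x, Omega x ->
  fiber_unitary (fiber (product_system_of P alpha) x) (fiber (product_system_of P beta) x)
    (U x) (F x).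
Hypothesis mF : measurable_fun (product_system_of P beta)
  (fun p => (p.1, F p.1 p.2) : borel_rV R n.+1 * bopM H).
Hypothesis UM : forall x y T S, Omega x -> Omega y ->
  fiber (product_system_of P alpha) x T -> fiber (product_system_of P alpha) y S ->
  U (x + y) (T * S) = U x T * U y S.

Let fE := @fiberE R n P H.

Lemma fiber_inv_intertwiner x T : Omega x -> intertwiner (beta x) T ->
  intertwiner (alpha x) (F x T).
Proof. by move=> Ox bT; have := fiber_unitary_adj_fun (UF Ox) (T := T); rewrite !fE//; apply. Qed.

Lemma fiber_inv_lin x a T S : Omega x -> intertwiner (beta x) T -> intertwiner (beta x) S ->
  F x (a *: T + S) = a *: F x T + F x S.
Proof.
move=> Ox bT bS; have h := UF Ox; rewrite !fE// in h.
have aT := fiber_unitary_adj_fun h bT; have aS := fiber_unitary_adj_fun h bS.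
rewrite -[T in LHS](fiber_unitaryVK h bT) -[S in LHS](fiber_unitaryVK h bS).
rewrite -(fiber_unitary_linear h)// (fiber_unitaryK h)//.
exact: intertwiner_lin.
Qed.

Lemma fiber_inv_ip x T S : Omega x -> intertwiner (beta x) T -> intertwiner (beta x) S ->
  fiber_ip (F x T) (F x S) = fiber_ip T S.
Proof.
move=> Ox bT bS; have h := UF Ox; rewrite !fE// in h.
have aT := fiber_unitary_adj_fun h bT.
by rewrite -(fiber_unitary_adj h)// (fiber_unitaryVK h).
Qed.

Lemma fiber_inv_scalar x T S : Omega x -> intertwiner (beta x) T -> intertwiner (beta x) S ->
  adj (F x T) * F x S = adj T * S.
Proof.
move=> Ox bT bS; have Px := interior_subset Ox.
have aT := fiber_inv_intertwiner Ox bT; have aS := fiber_inv_intertwiner Ox bS.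
have := fiber_inv_ip Ox bT bS.
rewrite (fiber_ipE e_onb (E0_lin alphaP Px) (E0_mul alphaP Px) (E0_adj alphaP Px) aT aS).
rewrite (fiber_ipE e_onb (E0_lin betaP Px) (E0_mul betaP Px) (E0_adj betaP Px) bT bS).
rewrite (intertwiner_scalar e_onb (E0_lin alphaP Px) (E0_mul alphaP Px) (E0_adj alphaP Px) aT aS).
by rewrite (intertwiner_scalar e_onb (E0_lin betaP Px) (E0_mul betaP Px) (E0_adj betaP Px) bT bS) => ->.
Qed.

Lemma fiber_inv_mul x y T S : Omega x -> Omega y -> intertwiner (beta x) T ->
  intertwiner (beta y) S -> F (x + y) (T * S) = F x T * F y S.
Proof.
move=> Ox Oy bT bS; have Oxy : Omega (x + y) by exact: (interior_add P_cone (interior_subset Ox)).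
have hx := UF Ox; have hy := UF Oy; have hxy := UF Oxy; rewrite !fE// in hx hy hxy.
have aT := fiber_inv_intertwiner Ox bT; have aS := fiber_inv_intertwiner Oy bS.
rewrite -[T in LHS](fiber_unitaryVK hx bT) -[S in LHS](fiber_unitaryVK hy bS) -UM ?fE//.
rewrite (fiber_unitaryK hxy)//.
by apply: (product_intertwiner alphaP) => //; exact: interior_subset.
Qed.

Let V x k := fbasis e beta k x.
Let W x k := F x (V x k).

Lemma transfer_isometries x : Omega x -> isometries (W x).
Proof.
move=> Ox j k; have bV i := fbasis_intertwiner e_onb betaP i Ox.
rewrite (fiber_inv_scalar Ox (bV j) (bV k)).
exact: (fbasis_isometries P_cone e_onb betaP beta_nonto Ox).
Qed.

(** [F x] is an isometry onto the fibre of [alpha], so the images of the basis approximate every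
    intertwiner of [alpha x], as [intertwiner_basis_total] requires. *)
Lemma transfer_total x : Omega x -> total (W x).
Proof.
move=> Ox; have Px := interior_subset Ox.
have bV k := fbasis_intertwiner e_onb betaP k Ox.
apply: (intertwiner_basis_total e_onb (E0_lin alphaP Px) (E0_mul alphaP Px) (E0_adj alphaP Px)
  (E0_normal alphaP Px) (E0_unital alphaP Px) (transfer_isometries Ox)) => [k|T aT d d0].
  exact: (fiber_inv_intertwiner Ox (bV k)).
have h := UF Ox; rewrite !fE// in h.
have bT := fiber_unitary_fun h aT.
have [_ _ [_ /(_ _ bT (d ^+ 2) (exprn_gt0 2 d0))[S sS TS]]] :=
  fbasis_onb P_cone e_onb betaP beta_nonto Ox.
have [bS FS] : intertwiner (beta x) S /\ Defs.span (range (W x)) (F x S).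
  move: S sS {TS}; apply: (@span_ind R (bop H) _
    [set S | intertwiner (beta x) S /\ Defs.span (range (W x)) (F x S)]) => /=.
  - split; first exact: intertwiner0.
    have := fiber_inv_lin 0 Ox (bV 0%N) (bV 0%N).
    rewrite scale0r add0r => /eqP.
    (* Linearity at [- V + V] yields [F x 0 = 0]. *)
    have := fiber_inv_lin (-1) Ox (bV 0%N) (bV 0%N).
    rewrite !scaleN1r !addNr => -> _; exact: span0.
  - move=> a A B [bA sA] [bB sB]; split; first exact: intertwiner_lin.
    by rewrite fiber_inv_lin//; exact: spanD.
  - by move=> _ [k _ <-]; split; [exact: bV|apply: span_in; exists k].
exists (F x S) => //.
have aS := fiber_inv_intertwiner Ox bS.
have aTS : intertwiner (alpha x) (T - F x S) by exact: intertwiner_sub.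
have bTS : intertwiner (beta x) (U x T - S) by exact: intertwiner_sub.
rewrite -(@ltr_pXn2r _ 2) ?nnegrE ?(ltW d0)//.
rewrite -(fiber_ip_sq e_onb (E0_lin alphaP Px) (E0_mul alphaP Px) (E0_adj alphaP Px) aTS).
have -> : T - F x S = F x (U x T - S).
  rewrite [U x T - S]addrC -[- S]scaleN1r fiber_inv_lin// (fiber_unitaryK h)//.
  by rewrite scaleN1r addrC.
by rewrite fiber_inv_ip.
Qed.

(** [u] is constructed on the basis only. It implements [F x] on the whole fibre because [F x]
    preserves the scalars [adj (V x k) * T], and these determine [T] by totality. *)
Lemma transfer_unitary x : Omega x -> exists u : bop H, [/\ unitary_op u,
  forall T, intertwiner (beta x) T -> u * T = F x T &
  forall y, \sum_(k < K) W x k (adj (V x k) y) @[K --> \oo] --> u y].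
Proof.
move=> Ox; have bV k := fbasis_intertwiner e_onb betaP k Ox.
have VV := fbasis_isometries P_cone e_onb betaP beta_nonto Ox.
have tV := fbasis_total P_cone e_onb betaP beta_nonto Ox.
have [u [uu uV uE]] := unitary_transfer VV (transfer_isometries Ox) tV (transfer_total Ox).
exists u; split=> // T bT; have [u1 u2] := uu.
have : T = adj u * F x T.
  apply: (total_adj_eq tV) => k.
  by rewrite mulrA -adjM uV (fiber_inv_scalar Ox (bV k) bT).
by move=> {1}->; rewrite mulrA u2 mul1r.
Qed.

Lemma transfer_fun : exists u : 'rV[R]_n.+1 -> bop H, forall x, Omega x -> [/\ unitary_op (u x),
  forall T, intertwiner (beta x) T -> u x * T = F x T &
  forall y, \sum_(k < K) W x k (adj (V x k) y) @[K --> \oo] --> u x y].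
Proof.
have h x : exists u : bop H, Omega x -> [/\ unitary_op u,
    forall T, intertwiner (beta x) T -> u * T = F x T &
    forall y, \sum_(k < K) W x k (adj (V x k) y) @[K --> \oo] --> u y].
  have [/transfer_unitary[u hu]|nO] := pselect (Omega x); first by exists u.
  by exists 0.
by exists (fun x => sval (cid (h x))) => x; exact: svalP (cid (h x)).
Qed.

(** Composes the measurable section [(x, V x k)] of the product system of [beta] with the
    isomorphism; this is where the measurability of the latter enters. *)
Lemma transfer_cmeas k i j :
  cmeas (Omega : set (borel_rV R n.+1)) (fun x => ip (W x k (e i)) (e j)).
Proof.
have mE := product_system_measurable e_onb betaP.
have VE : (fun x : borel_rV R n.+1 => (x, V x k) : borel_rV R n.+1 * bopM H) @` Omega
    `<=` product_system_of P beta.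
  by move=> _ [x Ox <-]; split=> //; exact: (fbasis_intertwiner e_onb betaP k Ox).
have mVk : measurable_fun (Omega : set (borel_rV R n.+1))
    (fun x : borel_rV R n.+1 => (x, V x k) : borel_rV R n.+1 * bopM H).
  apply: measurable_fun_pair_in; first exact: measurable_id.
  exact: (fbasis_measurable P_cone H_sep e_onb betaP beta_nonto).
apply: (@cmeas_comp R _ _ (borel_rV R n.+1) (borel_rV R n.+1 * bopM H)%type Omega
  (product_system_of P beta) (fun q => ip (F q.1 q.2 (e i)) (e j)) _ mE VE _ mVk).
apply: (@cmeas_comp R _ _ (borel_rV R n.+1 * bopM H)%type (borel_rV R n.+1 * bopM H)%type
  (product_system_of P beta) setT (fun q => ip ((q.2 : bop H) (e i)) (e j)) _ _ _ _ mF) => //.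
apply: (@cmeas_comp R _ _ _ (bopM H) setT setT (fun A : bopM H => ip ((A : bop H) (e i)) (e j)) snd) => //.
exact: (coef_cmeas e_onb).
Qed.

(** Both identities are tested on total families. There [u x] acts as [F x], which maps into the
    intertwiners of [alpha x] and is multiplicative. *)
Lemma isomorphic_cocycle : exists u : 'rV[R]_n.+1 -> bop H,
  [/\ forall x, Omega x -> unitary_op (u x),
      forall x, Omega x -> forall A, alpha x A * u x = u x * beta x A,
      forall x y, Omega x -> Omega y -> u x * beta x (u y) = u (x + y)
    & forall i j, cmeas (Omega : set (borel_rV R n.+1)) (fun x => ip (u x (e i)) (e j))].
Proof.
have [u uP] := transfer_fun; exists u; split.
- by move=> x /uP[].
- move=> x Ox A; have [uu uT _] := uP x Ox.
  apply: (total_eq (fbasis_total P_cone e_onb betaP beta_nonto Ox)) => k.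
  have bV := fbasis_intertwiner e_onb betaP k Ox.
  by rewrite -!mulrA bV uT// (fiber_inv_intertwiner Ox bV) -uT// mulrA.
- move=> x y Ox Oy; have Oxy : Omega (x + y) by exact: (interior_add P_cone (interior_subset Ox)).
  have [_ ux _] := uP x Ox; have [_ uy _] := uP y Oy; have [_ uxy _] := uP _ Oxy.
  apply: (total_eq (fbasis_total P_cone e_onb betaP beta_nonto Ox)) => k.
  apply: (total_eq (fbasis_total P_cone e_onb betaP beta_nonto Oy)) => l.
  have bV := fbasis_intertwiner e_onb betaP k Ox; have bV' := fbasis_intertwiner e_onb betaP l Oy.
  have Px := interior_subset Ox; have Py := interior_subset Oy.
  rewrite -(mulrA (u x)) bV mulrA -mulrA ux// uy// -(mulrA (u (x + y))).
  rewrite -fiber_inv_mul// uxy//; exact: (product_intertwiner betaP).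
(* [u x] is the strong sum of the [W x k * adj (V x k)], so its coefficients are limits of finite
   sums of measurable ones. *)
move=> i j; apply: (@cmeas_cvg R _ (borel_rV R n.+1) Omega
    (fun K x => \sum_(k < K) ip (adj (V x k) (e i)) (adj (W x k) (e j)))).
  move=> K; apply: cmeas_sum => k; apply: (cmeas_ip e_onb) => l.
    rewrite (_ : (fun x => _) = fun x => (ip (V x k (e l)) (e i))^*).
      by apply: cmeas_conj; exact: (fbasis_cmeas P_cone e_onb betaP beta_nonto).
    by apply/funext => x; rewrite -ipC -adjPr.
  rewrite (_ : (fun x => _) = fun x => (ip (W x k (e l)) (e j))^*).
    by apply: cmeas_conj; exact: transfer_cmeas.
  by apply/funext => x; rewrite -ipC -adjPr.
move=> x Ox; have [_ _ ue] := uP x Ox.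
apply: cvg_seq_eq (cvg_ipl (e j) (ue (e i))) => // K.
by rewrite ip_suml; apply: eq_bigr => k _; rewrite -adjP.
Qed.

End fiber_transfer.

(** * Extending the cocycle to the closed cone *)

Section cocycle_extension.
Context {R : realType} {n : nat}.
Variable P : set 'rV[R]_n.+1.
Hypothesis P_cone : closed_convex_cone P.
Hypothesis P_spanning : spanning P.
Context {H : hilbertType R}.
Variable e : nat -> H.
Hypothesis e_onb : onb e.
Variables alpha beta : 'rV[R]_n.+1 -> bop H -> bop H.
Hypothesis alphaP : E0_semigroup P alpha.
Hypothesis betaP : E0_semigroup P beta.

Let Omega : set 'rV[R]_n.+1 := P°.
Variable u : 'rV[R]_n.+1 -> bop H.
Hypothesis u_unitary : forall x, Omega x -> unitary_op (u x).
Hypothesis u_inter : forall x, Omega x -> forall A, alpha x A * u x = u x * beta x A.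
Hypothesis u_mul : forall x y, Omega x -> Omega y -> u x * beta x (u y) = u (x + y).
Hypothesis u_cmeas : forall i j,
  cmeas (Omega : set (borel_rV R n.+1)) (fun x => ip (u x (e i)) (e j)).

(* The cocycle identity for [x + w] leaves no other choice. *)
Definition cocycle_ext (w x : 'rV[R]_n.+1) : bop H := u (x + w) * beta x (adj (u w)).

Let OP x : Omega x -> P x. Proof. exact: interior_subset. Qed.
Let OD x y : P x -> Omega y -> Omega (x + y). Proof. exact: (interior_add P_cone). Qed.

Let u1 x : Omega x -> adj (u x) * u x = 1. Proof. by move=> /u_unitary[]. Qed.
Let u2 x : Omega x -> u x * adj (u x) = 1. Proof. by move=> /u_unitary[]. Qed.

(** Compare the two factorizations of [u (x + w + z)], and those of [u (w + z)] inside [beta x]. *)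
Lemma cocycle_ext_indep w z x : Omega w -> Omega z -> P x ->
  cocycle_ext z x = cocycle_ext w x.
Proof.
move=> Ow Oz Px; have Pw := OP Ow; have Pz := OP Oz; rewrite /cocycle_ext.
have bwz : u z * beta z (u w) = u w * beta w (u z) by rewrite !u_mul// addrC.
have : u (x + z) * beta (x + z) (u w) = u (x + w) * beta (x + w) (u z).
  by rewrite !u_mul ?addrA 1?addrAC//; exact: OD.
rewrite -!(E0_add betaP)// => h.
have -> : u (x + z) = u (x + w) * beta x (beta w (u z)) * beta x (beta z (adj (u w))).
  rewrite -h -mulrA -(E0_mul betaP Px) -(E0_mul betaP Pz) u2//.
  by rewrite (E0_unital betaP Pz) (E0_unital betaP Px) mulr1.
rewrite -!mulrA -!(E0_mul betaP Px); congr (_ * beta x _).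
rewrite (E0_adj betaP Pz) -adjM bwz adjM -(E0_adj betaP Pw) mulrA -(E0_mul betaP Pw).
by rewrite u2// (E0_unital betaP Pw) mul1r.
Qed.

Lemma cocycle_ext_interior w x : Omega w -> Omega x -> cocycle_ext w x = u x.
Proof.
move=> Ow Ox; have Px := OP Ox.
rewrite /cocycle_ext -u_mul// -mulrA -(E0_mul betaP Px) u2//.
by rewrite (E0_unital betaP Px) mulr1.
Qed.

Lemma cocycle_ext_unitary w x : Omega w -> P x -> unitary_op (cocycle_ext w x).
Proof.
move=> Ow Px; apply: unitary_mul; first by apply: u_unitary; exact: OD.
apply: (E0_unitary betaP) => //; apply: unitary_adj; exact: u_unitary.
Qed.

Lemma cocycle_ext_mul w x y : Omega w -> P x -> P y ->
  cocycle_ext w x * beta x (cocycle_ext w y) = cocycle_ext w (x + y).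
Proof.
move=> Ow Px Py; have Oyw : Omega (y + w) by exact: OD.
rewrite -(cocycle_ext_indep Ow Oyw Px) /cocycle_ext (E0_mul betaP Px) mulrA.
rewrite -(mulrA (u _)) -(E0_mul betaP Px) u1// (E0_unital betaP Px) mulr1.
by rewrite (E0_add betaP)// addrA.
Qed.

Lemma cocycle_ext_weak w : Omega w ->
  forall (z : nat -> 'rV[R]_n.+1) x, (forall j, P (z j)) -> P x -> z j @[j --> \oo] --> x ->
  forall a b, ip (cocycle_ext w (z j) a) b @[j --> \oo] --> ip (cocycle_ext w x a) b.
Proof.
move=> Ow z x Pz Px zx a b.
(* As [w] is arbitrary, replace it by a [y] such that [u] is continuous along
   the translated sequence. *)
have [M mM uM] := borel_continuous (@open_interior _ P) u_cmeas.
have mM' : meagre ([set y | M (x + y)] `|` \bigcup_j [set y | M (z j + y)]).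
  apply: meagreU; first exact: meagre_translate.
  by apply: meagre_bigcup => j; exact: meagre_translate.
have [y Oy /not_orP[Mx Mz]] := meagre_escape (@open_interior _ P) (ex_intro _ w Ow) mM'.
have zyx : z j + y @[j --> \oo] --> x + y.
  by apply: cvgD => //; exact: cvg_cst.
have unit_zy j : unitary_op (u (z j + y)) by apply: u_unitary; exact: OD.
have unit_xy : unitary_op (u (x + y)) by apply: u_unitary; exact: OD.
have uw (c d : H) : ip (u (z j + y) c) d @[j --> \oo] --> ip (u (x + y) c) d.
  apply: (weak_of_basis e_onb (M := 1)) => [j c'|i k].
    by rewrite mul1r isometry_norm//; case: (unit_zy j).
  apply: uM => //; first exact: OD.
  by move=> j; split; [exact: OD|move=> Mj; apply: Mz; exists j].
(* A product of weakly convergent factors need not converge, so [u] is moved across the inner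
   product as its adjoint; both arguments then converge in norm. *)
have us (d : H) : adj (u (z j + y)) d @[j --> \oo] --> adj (u (x + y)) d.
  apply: unitary_strong => [j||c].
  - by case: (unitary_adj (unit_zy j)).
  - by case: (unitary_adj unit_xy).
  apply: cvg_seq_eq (cvg_conj (uw c d)) => [j|]; by rewrite -ipC adjPr.
have bs := E0_strong e_onb betaP (A := adj (u y)) (y := a) Pz Px zx.
apply: cvg_seq_eq (cvg_ip bs (us b)) => [j|].
  by rewrite -(cocycle_ext_indep Ow Oy (Pz j)) /cocycle_ext bop_mulE adjP.
by rewrite -(cocycle_ext_indep Ow Oy Px) /cocycle_ext bop_mulE adjP.
Qed.

Lemma cocycle_ext_cocycle w : Omega w -> cocycle P beta (cocycle_ext w).
Proof.
move=> Ow; split=> [|x Px|x y Px Py].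
- apply/subspace_continuousP => x Px; apply: swop_cvg => T.
  apply: within_seq => z Pz zx.
  apply: (@pairing_seq_cvg R H e e_onb (fun j => cocycle_ext w (z j)) _ 1); last exact: svalP T.
    move=> j y; rewrite mul1r isometry_norm//.
    by case: (cocycle_ext_unitary Ow (Pz j)).
  exact: cocycle_ext_weak.
- exact: cocycle_ext_unitary.
exact: cocycle_ext_mul.
Qed.

(** The relation is known in the interior, and [x] is the limit of the interior points
    [x + w / (j + 1)], along which both sides converge. *)
Lemma cocycle_ext_inter w x A : Omega w -> P x ->
  alpha x A * cocycle_ext w x = cocycle_ext w x * beta x A.
Proof.
move=> Ow Px; pose z (j : nat) := x + (j.+1%:R^-1 : R) *: w.
have Oz j : Omega (z j).
  by apply: OD => //; apply: (interior_scale P_cone) => //; rewrite invr_gt0.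
have Pz j : P (z j) := OP (Oz j).
have zx : z j @[j --> \oo] --> x.
  rewrite -[X in _ --> X]addr0 -(scale0r w).
  apply: cvgD; first exact: cvg_cst.
  by apply: cvgZr_tmp; exact: cvg_harmonic.
have uw := cocycle_ext_weak Ow Pz Px zx.
have uu j := cocycle_ext_unitary Ow (Pz j); have uux := cocycle_ext_unitary Ow Px.
have us a : cocycle_ext w (z j) a @[j --> \oo] --> cocycle_ext w x a.
  by apply: unitary_strong => [j||c]; [case: (uu j)|case: uux|exact: uw].
have us' a : adj (cocycle_ext w (z j)) a @[j --> \oo] --> adj (cocycle_ext w x) a.
  apply: unitary_strong => [j||c]; [by case: (unitary_adj (uu j))|by case: (unitary_adj uux)|].
  by apply: cvg_seq_eq (cvg_conj (uw c a)) => [j|]; rewrite -ipC adjPr.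
apply: bop_weak_eq => a b; rewrite (bop_mulE (alpha x A)) (bop_mulE (cocycle_ext w x)).
have h1 := cvg_ip (us a) (E0_strong e_onb alphaP (A := adj A) (y := b) Pz Px zx).
have h2 := cvg_ip (E0_strong e_onb betaP (A := A) (y := a) Pz Px zx) (us' b).
rewrite [LHS]adjP -(E0_adj alphaP Px) [RHS]adjP.
apply: cvg_seq_unique h1 _; apply: cvg_seq_eq h2 => // j.
rewrite (E0_adj alphaP (Pz j)) -!adjP -!bop_mulE.
by rewrite cocycle_ext_interior// u_inter.
Qed.

Lemma cocycle_ext_conjugate : cocycle_conjugate P alpha beta.
Proof.
have [w Ow] := interior_nonempty P_cone P_spanning.
(* Both semigroups act on the same space and [u x] intertwines them there, so [alpha] itself is a
   perturbation of [beta] and [theta] can be the identity. *)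
exists idfun, idfun; split=> //; first by split=> // A; exact: cvg_id.
exists (cocycle_ext w); first exact: cocycle_ext_cocycle.
move=> x Px A /=; have [_ h] := cocycle_ext_unitary Ow Px.
by rewrite -cocycle_ext_inter// -mulrA h mulr1.
Qed.

End cocycle_extension.

Lemma interior_rV0 (R : realType) (P : set 'rV[R]_0) : spanning P -> P° 0.
Proof.
move=> P_spanning; have [x Px _] : [set x - y | x in P & y in P] 0 by rewrite P_spanning.
rewrite (_ : P = setT) ?interiorT//.
by apply/seteqP; split=> // y _; rewrite (_ : y = x)//; apply/rowP => -[].
Qed.

Theorem theorem2p9 (R : realType) (n : nat) (P : set 'rV[R]_n)
    (P_cone : closed_convex_cone P) (P_spanning : spanning P)
    (P_pointed : pointed P)
    (H : hilbertType R) (H_separable : separable H)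
    (H_infinite : infinite_dimensional H) :
  let Omega := P° in
  let not_onto (alpha : 'rV[R]_n -> bop H -> bop H) :=
    forall x, Omega x -> ~ (forall B, exists A, alpha x A = B) in
  (forall alpha : 'rV[R]_n -> bop H -> bop H,
     E0_semigroup P alpha -> not_onto alpha ->
     concrete_product_system Omega (product_system_of P alpha)) /\
  (forall alpha beta : 'rV[R]_n -> bop H -> bop H,
     E0_semigroup P alpha -> not_onto alpha ->
     E0_semigroup P beta -> not_onto beta ->
     cocycle_conjugate P alpha beta <->
     product_system_isomorphic Omega
       (product_system_of P alpha) (product_system_of P beta)).
Proof.
move=> Omega not_onto; have [e e_onb] := onb_exists H_separable H_infinite.
case: n => [|n] in P P_cone P_spanning P_pointed Omega not_onto *.
  (* In dimension 0 the origin is an interior point and [alpha 0] is the identity, hence onto: no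
     semigroup satisfies the hypothesis and both claims are vacuous. *)
  have onto0 alpha : E0_semigroup P alpha -> not_onto alpha -> False.
    move=> alphaP /(_ 0 (interior_rV0 P_spanning)); apply => B.
    by exists B; exact: (E0_zero alphaP).
  by split=> [alpha alphaP /(onto0 _ alphaP)|alpha beta alphaP /(onto0 _ alphaP)].
split=> [alpha alphaP nonto|alpha beta alphaP _ betaP nonto].
  exact: (product_system_concrete P_cone H_separable e_onb alphaP nonto).
split=> [|[U [F [UF _ mF UM]]]].
  exact: (conjugate_isomorphic H_separable e_onb alphaP betaP).
have [u [uU uI uM uC]] :=
  isomorphic_cocycle P_cone H_separable e_onb alphaP betaP nonto UF mF UM.
exact: (cocycle_ext_conjugate P_cone P_spanning e_onb alphaP betaP uU uI uM uC).
Qed.
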